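(* Let $H$ be a quasi-Hopf algebra over a field $k$ and $(\mathfrak{B},\lambda,\Phi_\lambda)$ a left $H$-comodule algebra. Then $\mathfrak{B}$ is a right $H^{\rm op}$-comodule algebra via the structure $$\rho:\mathfrak{B}\to\mathfrak{B}\otimes H,\quad \rho(b)=b_{[0]}\otimes S^{-1}(b_{[-1]}),$$ $$\Phi_\rho=\tilde x^3_\lambda\otimes S^{-1}(f^2\tilde x^2_\lambda)\otimes S^{-1}(f^1\tilde x^1_\lambda)\in\mathfrak{B}\otimes H\otimes H,$$ where $f=f^1\otimes f^2$ is the Drinfeld twist of $H$. Moreover, if $(\mathfrak{B},\lambda,\Phi_\lambda)$ and $(\mathfrak{B},\lambda',\Phi_{\lambda'})$ are twist equivalent left $H$-comodule algebras, then the corresponding right $H^{\rm op}$-comodule algebras are also twist equivalent.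
   Context: $k$ is a field, $\otimes=\otimes_k$; algebras are associative and unital; summation is implicit. Quasi-bialgebra $(H,\Delta,\varepsilon,\Phi)$: an algebra $H$, algebra maps $\Delta:H\to H\otimes H$, $\varepsilon:H\to k$, an invertible $\Phi\in H^{\otimes3}$ with $(id\otimes\Delta)\Delta(h)=\Phi(\Delta\otimes id)\Delta(h)\Phi^{-1}$, $(id\otimes\varepsilon)\Delta(h)=h=(\varepsilon\otimes id)\Delta(h)$, $(1\otimes\Phi)(id\otimes\Delta\otimes id)(\Phi)(\Phi\otimes1)=(id\otimes id\otimes\Delta)(\Phi)(\Delta\otimes id\otimes id)(\Phi)$, $(id\otimes\varepsilon\otimes id)(\Phi)=1\otimes1$. Write $\Delta(h)=h_1\otimes h_2$, $\Phi=X^1\otimes X^2\otimes X^3$, $\Phi^{-1}=x^1\otimes x^2\otimes x^3$. A quasi-Hopf algebra has in addition an algebra anti-automorphism $S$ and $\alpha,\beta\in H$ with $S(h_1)\alpha h_2=\varepsilon(h)\alpha$, $h_1\beta S(h_2)=\varepsilon(h)\beta$, $X^1\beta S(X^2)\alpha X^3=1$, $S(x^1)\alpha x^2\beta S(x^3)=1$; convention: $\varepsilon(\alpha)=\varepsilon(\beta)=1$, $\varepsilon\circ S=\varepsilon$. $H^{\rm op}$ is the quasi-bialgebra with opposite multiplication, the same $\Delta,\varepsilon$, and reassociator $\Phi^{-1}$. Drinfeld twist: $f=f^1\otimes f^2=(S\otimes S)(\Delta^{\rm cop}(x^1))\,\gamma\,\Delta(x^2\beta S(x^3))\in H\otimes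 H$, an invertible element, where $\gamma=S(A^2)\alpha A^3\otimes S(A^1)\alpha A^4$, $A^1\otimes A^2\otimes A^3\otimes A^4=(\Phi\otimes1)(\Delta\otimes id\otimes id)(\Phi^{-1})$, $\Delta^{\rm cop}(h)=h_2\otimes h_1$. It satisfies $f\Delta(S(h))f^{-1}=(S\otimes S)(\Delta^{\rm cop}(h))$ and $(1\otimes f)(id\otimes\Delta)(f)\Phi(\Delta\otimes id)(f^{-1})(f^{-1}\otimes1)=S(X^3)\otimes S(X^2)\otimes S(X^1)$. Left $H$-comodule algebra $(\mathfrak{B},\lambda,\Phi_\lambda)$: algebra $\mathfrak{B}$, algebra map $\lambda:\mathfrak{B}\to H\otimes\mathfrak{B}$, $\lambda(b)=b_{[-1]}\otimes b_{[0]}$, invertible $\Phi_\lambda\in H\otimes H\otimes\mathfrak{B}$ with inverse $\tilde x^1_\lambda\otimes\tilde x^2_\lambda\otimes\tilde x^3_\lambda$, such that $(id\otimes\lambda)(\lambda(b))\Phi_\lambda=\Phi_\lambda(\Delta\otimes id)(\lambda(b))$, $(1_H\otimes\Phi_\lambda)(id\otimes\Delta\otimes id)(\Phi_\lambda)(\Phi\otimes1)=(id\otimes id\otimes\lambda)(\Phi_\lambda)(\Delta\otimes id\otimes id)(\Phi_\lambda)$, $(\varepsilon\otimes id)\lambda=id$, $(id\otimes\varepsilon\otimes id)(\Phi_\lambda)=(\varepsilon\otimes id\otimes id)(\Phi_\lambda)=1\otimes1$. Right $H$-comodule algebra $(\mathfrak{A},\rho,\Phi_\rho)$: algebra $\mathfrak{A}$,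 algebra map $\rho:\mathfrak{A}\to\mathfrak{A}\otimes H$, invertible $\Phi_\rho\in\mathfrak{A}\otimes H\otimes H$ with $\Phi_\rho(\rho\otimes id)(\rho(a))=(id\otimes\Delta)(\rho(a))\Phi_\rho$, $(1\otimes\Phi)(id\otimes\Delta\otimes id)(\Phi_\rho)(\Phi_\rho\otimes1_H)=(id\otimes id\otimes\Delta)(\Phi_\rho)(\rho\otimes id\otimes id)(\Phi_\rho)$, $(id\otimes\varepsilon)\rho=id$, $(id\otimes\varepsilon\otimes id)(\Phi_\rho)=(id\otimes id\otimes\varepsilon)(\Phi_\rho)=1\otimes1$. (For $H^{\rm op}$, the products in the $H$-factors and the reassociator are those of $H^{\rm op}$.) Twist equivalence. Left: $(\mathfrak{B},\lambda,\Phi_\lambda)$ and $(\mathfrak{B},\lambda',\Phi_{\lambda'})$ are twist equivalent if there is an invertible $\mathbb{U}\in H\otimes\mathfrak{B}$ with $(\varepsilon\otimes id)(\mathbb{U})=1$, $\lambda'(b)=\mathbb{U}\lambda(b)\mathbb{U}^{-1}$, $\Phi_{\lambda'}=(1_H\otimes\mathbb{U})(id\otimes\lambda)(\mathbb{U})\Phi_\lambda(\Delta\otimes id)(\mathbb{U}^{-1})$. Right: $(\mathfrak{A},\rho,\Phi_\rho)$ and $(\mathfrak{A},\rho',\Phi_{\rho'})$ are twist equivalent if there is an invertible $\mathbb{V}\in\mathfrak{A}\otimes H$ with $(id\otimes\varepsilon)(\mathbb{V})=1$, $\rho'(a)=\mathbb{V}\rho(a)\mathbb{V}^{-1}$, $\Phi_{\rho'}=(id\otimes\Delta)(\mathbb{V})\Phi_\rho(\rho\otimes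 id)(\mathbb{V}^{-1})(\mathbb{V}^{-1}\otimes1_H)$. *)

(* Defs.v *)
From HB Require Import structures.
From mathcomp Require Import all_boot all_order all_algebra.
From mathcomp Require Import boolp.

Set Implicit Arguments.
Unset Strict Implicit.
Unset Printing Implicit Defensive.

Import GRing.Theory.
Local Open Scope ring_scope.
Local Open Scope quotient_scope.

(* MathComp's [algType] imposes [1 != 0], whereas an associative unital algebra
   may be zero: [pzAlgType k] drops that condition. *)
HB.mixin Record Lmodule_isPzAlgebra (k : fieldType) A of GRing.Lmodule k A := {
  pz_one : A;
  pz_mul : A -> A -> A;
  pz_mulA : associative pz_mul;
  pz_mul1l : left_id pz_one pz_mul;
  pz_mul1r : right_id pz_one pz_mul;
  pz_mulDl : left_distributive pz_mul +%R;
  pz_mulDr : right_distributive pz_mul +%R;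
  pz_scaleAl : forall (c : k) (x y : A), c *: pz_mul x y = pz_mul (c *: x) y;
  pz_scaleAr : forall (c : k) (x y : A), c *: pz_mul x y = pz_mul x (c *: y)
}.

#[short(type="pzAlgType")]
HB.structure Definition PzAlgebra (k : fieldType) :=
  {A of GRing.Lmodule k A & Lmodule_isPzAlgebra k A}.

HB.instance Definition _ (k : fieldType) (A : pzAlgType k) :=
  GRing.Zmodule_isPzRing.Build (PzAlgebra.sort A) (@pz_mulA k A) pz_mul1l pz_mul1r
    pz_mulDl pz_mulDr.

Notation bilin f := (bilinear_for *:%R *:%R f).

Section LinearFun.
Variables (k : fieldType) (V W : lmodType k) (f : V -> W).
Hypothesis fL : linear f.

Lemma linfD x y : f (x + y) = f x + f y.
Proof. by have := fL 1 x y; rewrite [1 *: x]scale1r [_ 1 _]scale1r. Qed.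

Lemma linf0 : f 0 = 0.
Proof. by apply: (@addrI _ (f 0)); rewrite -linfD !addr0. Qed.

Lemma linfZ c x : f (c *: x) = c *: f x.
Proof. by have := fL c x 0; rewrite linf0 !addr0. Qed.

End LinearFun.

Reserved Notation "A ⊗ B" (at level 35, right associativity).

Section TensorSpace.
Variables (k : fieldType) (A B : lmodType k).

(* The sequence [:: (a1, b1); ...; (an, bn)] stands for the formal sum of the
   pure tensors ai ⊗ bi; [ten_eq] is the congruence generated by
   bilinearity. *)
Inductive ten_eq : seq (A * B) -> seq (A * B) -> Prop :=
| ten_refl s : ten_eq s s
| ten_sym s t : ten_eq s t -> ten_eq t s
| ten_trans s t u : ten_eq s t -> ten_eq t u -> ten_eq s u
| ten_cat s s' t t' : ten_eq s s' -> ten_eq t t' -> ten_eq (s ++ t) (s' ++ t')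
| ten_catC s t : ten_eq (s ++ t) (t ++ s)
| ten_addl a a' b : ten_eq [:: (a + a', b)] [:: (a, b); (a', b)]
| ten_addr a b b' : ten_eq [:: (a, b + b')] [:: (a, b); (a, b')]
| ten_scale c a b : ten_eq [:: (c *: a, b)] [:: (a, c *: b)]
| ten_zero b : ten_eq [:: (0, b)] [::].

Definition ten_rel (s t : seq (A * B)) : bool := `[< ten_eq s t >].

Lemma ten_rel_equiv : equiv_class_of ten_rel.
Proof.
split.
- by move=> s; apply/asboolP/ten_refl.
- by move=> s t; apply/asboolP/asboolP; apply: ten_sym.
- by move=> t s u /asboolP st /asboolP tu; apply/asboolP; apply: ten_trans tu.
Qed.

Canonical ten_equiv := EquivRelPack ten_rel_equiv.

Definition tensor : Type := {eq_quot ten_rel}.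
HB.instance Definition _ := Choice.on tensor.
HB.instance Definition _ := EqQuotient.on tensor.

Definition pure (a : A) (b : B) : tensor := \pi_tensor [:: (a, b)].

Lemma ten_piP s t : ten_eq s t <-> \pi_tensor s = \pi_tensor t.
Proof.
split=> [st|/eqquotP /asboolP //].
by apply/eqquotP; apply/asboolP.
Qed.

Lemma ten_repr s : ten_eq (repr (\pi_tensor s)) s.
Proof. by apply/ten_piP; rewrite reprK. Qed.

Definition ten_add (x y : tensor) : tensor := \pi_tensor (repr x ++ repr y).
Definition ten_scal (c : k) (x : tensor) : tensor :=
  \pi_tensor [seq (c *: p.1, p.2) | p <- repr x].

Lemma ten_add_pi s t : ten_add (\pi_tensor s) (\pi_tensor t) = \pi_tensor (s ++ t).
Proof. by apply/ten_piP; apply: ten_cat; apply: ten_repr. Qed.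

Lemma ten_eq_scal c s t : ten_eq s t ->
  ten_eq [seq (c *: p.1, p.2) | p <- s] [seq (c *: p.1, p.2) | p <- t].
Proof.
elim=> {s t} /=.
- by move=> s; apply: ten_refl.
- by move=> s t _; apply: ten_sym.
- by move=> s t u _ st _; apply: ten_trans.
- by move=> s s' t t' _ ss' _ tt'; rewrite !map_cat; apply: ten_cat.
- by move=> s t; rewrite !map_cat; apply: ten_catC.
- by move=> a a' b; rewrite scalerDr; apply: ten_addl.
- by move=> a b b'; apply: ten_addr.
- by move=> d a b; rewrite scalerA mulrC -scalerA; apply: ten_scale.
- by move=> b; rewrite scaler0; apply: ten_zero.
Qed.

Lemma ten_scal_pi c s :
  ten_scal c (\pi_tensor s) = \pi_tensor [seq (c *: p.1, p.2) | p <- s].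
Proof. exact/ten_piP/ten_eq_scal/ten_repr. Qed.

Lemma ten_quotP (P : tensor -> Prop) :
  (forall s, P (\pi_tensor s)) -> forall x, P x.
Proof. by move=> Ps x; rewrite -[x]reprK. Qed.

Lemma ten_addA : associative ten_add.
Proof.
elim/ten_quotP=> s; elim/ten_quotP=> t; elim/ten_quotP=> u.
by rewrite !ten_add_pi catA.
Qed.

Lemma ten_addC : commutative ten_add.
Proof.
elim/ten_quotP=> s; elim/ten_quotP=> t; rewrite !ten_add_pi.
by apply/ten_piP; apply: ten_catC.
Qed.

Lemma ten_add0 : left_id (\pi_tensor [::]) ten_add.
Proof. by elim/ten_quotP=> s; rewrite ten_add_pi. Qed.

Lemma ten_scal0 x : ten_scal 0 x = \pi_tensor [::].
Proof.
elim/ten_quotP: x => s; rewrite ten_scal_pi; apply/ten_piP.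
elim: s => [|p s IHs] /=; first exact: ten_refl.
rewrite scale0r; exact: (ten_cat (ten_zero p.2) IHs).
Qed.

Lemma ten_scalDl x c d : ten_scal (c + d) x = ten_add (ten_scal c x) (ten_scal d x).
Proof.
elim/ten_quotP: x => s; rewrite !ten_scal_pi ten_add_pi; apply/ten_piP.
elim: s => [|p s IHs] /=; first exact: ten_refl.
rewrite scalerDl; apply: ten_trans (ten_cat (ten_addl _ _ _) IHs) _.
apply: (ten_cat (ten_refl [:: _])).
rewrite -[X in ten_eq _ (_ ++ X)]cat1s !catA.
exact: (ten_cat (ten_catC [:: _] _) (ten_refl _)).
Qed.

Lemma ten_scal1 : left_id 1 ten_scal.
Proof.
elim/ten_quotP=> s; rewrite ten_scal_pi; congr (\pi_ _ _).
by rewrite -[RHS]map_id; apply: eq_map => -[a b] /=; rewrite scale1r.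
Qed.

Lemma ten_addN : left_inverse (\pi_tensor [::]) (ten_scal (-1)) ten_add.
Proof.
move=> x; rewrite -{2}[x]ten_scal1 -ten_scalDl addNr; exact: ten_scal0.
Qed.

HB.instance Definition _ :=
  GRing.isZmodule.Build tensor ten_addA ten_addC ten_add0 ten_addN.

Lemma ten_addE s t : \pi_tensor s + \pi_tensor t = \pi_tensor (s ++ t).
Proof. exact: ten_add_pi. Qed.

Lemma ten_scalA c d x : ten_scal c (ten_scal d x) = ten_scal (c * d) x.
Proof.
elim/ten_quotP: x => s; rewrite !ten_scal_pi -map_comp; congr (\pi_ _ _).
by apply: eq_map => p /=; rewrite scalerA.
Qed.

Lemma ten_scalDr : right_distributive ten_scal +%R.
Proof.
move=> c; elim/ten_quotP=> s; elim/ten_quotP=> t.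
by rewrite ten_addE !ten_scal_pi ten_addE map_cat.
Qed.

HB.instance Definition _ := GRing.Zmodule_isLmodule.Build k tensor
  ten_scalA ten_scal1 ten_scalDr ten_scalDl.

Lemma ten_scaleE c s :
  c *: \pi_tensor s = \pi_tensor [seq (c *: p.1, p.2) | p <- s].
Proof. exact: ten_scal_pi. Qed.

Lemma ten_piE s : \pi_tensor s = \sum_(p <- s) pure p.1 p.2.
Proof.
elim: s => [|p s IHs]; first by rewrite big_nil.
by rewrite big_cons -IHs ten_addE -surjective_pairing.
Qed.

Lemma pure_linl b c x y : pure (c *: x + y) b = c *: pure x b + pure y b.
Proof.
by rewrite /pure ten_scaleE ten_addE; apply/ten_piP; apply: ten_addl.
Qed.

Lemma pure_linr a c x y : pure a (c *: x + y) = c *: pure a x + pure a y.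
Proof.
rewrite /pure ten_scaleE ten_addE; apply/ten_piP.
apply: ten_trans (ten_addr _ _ _) _.
exact: (ten_cat (ten_sym (ten_scale _ _ _)) (ten_refl [:: _])).
Qed.

Lemma pure_bilin : bilin pure.
Proof. by split=> [b|a] c x y; [apply: pure_linl | apply: pure_linr]. Qed.

(* The linear map sending a ⊗ b to [phi a b], for a bilinear [phi]
   ([tlift_pure], [tlift_linear]); for other [phi] it depends on the chosen
   representative. Sweedler-style formulas are written with it: the sum of
   E(x1, x2) over x = x1 ⊗ x2 is [tlift (fun x1 x2 => E) x]. *)
Definition tlift (V : lmodType k) (phi : A -> B -> V) (x : tensor) : V :=
  \sum_(p <- repr x) phi p.1 p.2.

Section Lift.
Variables (V : lmodType k) (phi : A -> B -> V).
Hypothesis phiL : bilin phi.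

Lemma ten_eq_sum s t : ten_eq s t ->
  \sum_(p <- s) phi p.1 p.2 = \sum_(p <- t) phi p.1 p.2.
Proof.
elim=> // {s t}.
- by move=> s t u _ -> _ ->.
- by move=> s s' t t' _ ss' _ tt'; rewrite !big_cat /= ss' tt'.
- by move=> s t; rewrite !big_cat /= addrC.
- move=> a a' b; rewrite !big_cons !big_nil !addr0 /=.
  exact: (linfD (phiL.1 b)).
- move=> a b b'; rewrite !big_cons !big_nil !addr0 /=.
  exact: (linfD (phiL.2 a)).
- move=> c a b; rewrite !big_cons !big_nil !addr0 /=.
  by rewrite (linfZ (phiL.1 b)) (linfZ (phiL.2 a)).
- by move=> b; rewrite big_cons !big_nil addr0 /= (linf0 (phiL.1 b)).
Qed.

Lemma tlift_pi s : tlift phi (\pi_tensor s) = \sum_(p <- s) phi p.1 p.2.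
Proof. exact/ten_eq_sum/ten_repr. Qed.

Lemma tlift_pure a b : tlift phi (pure a b) = phi a b.
Proof. by rewrite tlift_pi big_seq1. Qed.

Lemma tlift_linear : linear (tlift phi).
Proof.
move=> c; elim/ten_quotP=> s; elim/ten_quotP=> t.
rewrite ten_scaleE ten_addE !tlift_pi.
rewrite big_cat /= big_map scaler_sumr; congr (_ + _).
by apply: eq_bigr => p _; rewrite /= (linfZ (phiL.1 p.2)).
Qed.

End Lift.

Lemma tensor_ind (P : tensor -> Prop) :
  (forall a b, P (pure a b)) -> P 0 -> (forall x y, P x -> P y -> P (x + y)) ->
  forall x, P x.
Proof.
move=> Pp P0 PD; elim/ten_quotP=> s; rewrite ten_piE.
by elim/big_ind: _ => // p _; apply: Pp.
Qed.

(* Linear maps out of a tensor product are determined on pure tensors. *)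
Lemma tensor_ext (V : lmodType k) (f g : tensor -> V) :
  linear f -> linear g -> (forall a b, f (pure a b) = g (pure a b)) -> f =1 g.
Proof.
move=> fL gL fg; elim/tensor_ind=> // [|x y fx fy].
  by rewrite (linf0 fL) (linf0 gL).
by rewrite (linfD fL) (linfD gL) fx fy.
Qed.

End TensorSpace.

Arguments pure {k A B} & a b.
Notation "A ⊗ B" := (tensor A%type B%type) : type_scope.
Notation "a ⊗ b" := (pure a b) : ring_scope.

Lemma pzAl (k : fieldType) (A : pzAlgType k) (c : k) (x y : A) :
  c *: (x * y) = (c *: x) * y.
Proof. exact: pz_scaleAl. Qed.

Lemma pzAr (k : fieldType) (A : pzAlgType k) (c : k) (x y : A) :
  c *: (x * y) = x * (c *: y).
Proof. exact: pz_scaleAr. Qed.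

Lemma mull_linear (k : fieldType) (A : pzAlgType k) (a : A) :
  linear (fun x : A => a * x).
Proof. by move=> c x y; rewrite mulrDr -pzAr. Qed.

Lemma mulr_linear (k : fieldType) (A : pzAlgType k) (a : A) :
  linear (fun x : A => x * a).
Proof. by move=> c x y; rewrite mulrDl -pzAl. Qed.

Lemma tlift_lin_phi (k : fieldType) (A B V : lmodType k) (c : k)
    (phi phi1 phi2 : A -> B -> V) (x : A ⊗ B) :
  (forall a b, phi a b = c *: phi1 a b + phi2 a b) ->
  tlift phi x = c *: tlift phi1 x + tlift phi2 x.
Proof.
move=> phiE; rewrite /tlift scaler_sumr -big_split /=.
by apply: eq_bigr => p _; rewrite phiE.
Qed.

Section TensorAlgebra.
Variables (k : fieldType) (A B : pzAlgType k).
Implicit Types (a : A) (b : B) (x y z : A ⊗ B).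

Definition ten_one : A ⊗ B := 1 ⊗ 1.

Definition ten_mul x y : A ⊗ B :=
  tlift (fun a b => tlift (fun c d => (a * c) ⊗ (b * d)) y) x.

Lemma ten_mul_inner_bilin a b : bilin (fun c d => (a * c) ⊗ (b * d)).
Proof.
split=> [d|c] e u v /=.
  by rewrite mulrDr -pzAr pure_linl.
by rewrite mulrDr -pzAr pure_linr.
Qed.

Lemma ten_mul_outer_bilin y :
  bilin (fun a b => tlift (fun c d => (a * c) ⊗ (b * d)) y).
Proof.
split=> [b|a] e u v /=; apply: tlift_lin_phi => c d.
  by rewrite mulrDl -pzAl pure_linl.
by rewrite mulrDl -pzAl pure_linr.
Qed.

Lemma ten_mul_pure a b c d : ten_mul (a ⊗ b) (c ⊗ d) = (a * c) ⊗ (b * d).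
Proof.
rewrite /ten_mul tlift_pure; last exact: ten_mul_outer_bilin.
by rewrite tlift_pure; last exact: ten_mul_inner_bilin.
Qed.

Lemma ten_mul_linr x : linear (ten_mul x).
Proof.
move=> c y z; apply: tlift_lin_phi => a b.
exact: (tlift_linear (ten_mul_inner_bilin a b)).
Qed.

Lemma ten_mul_linl y : linear (ten_mul^~ y).
Proof. exact: (tlift_linear (ten_mul_outer_bilin y)). Qed.

Lemma ten_mulDl : left_distributive ten_mul +%R.
Proof. by move=> x y z; apply: (linfD (ten_mul_linl z)). Qed.

Lemma ten_mulDr : right_distributive ten_mul +%R.
Proof. by move=> x y z; apply: (linfD (ten_mul_linr x)). Qed.

Lemma ten_scaleAl c x y : c *: ten_mul x y = ten_mul (c *: x) y.
Proof. by rewrite (linfZ (ten_mul_linl y)). Qed.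

Lemma ten_scaleAr c x y : c *: ten_mul x y = ten_mul x (c *: y).
Proof. by rewrite (linfZ (ten_mul_linr x)). Qed.

Lemma ten_mul0l y : ten_mul 0 y = 0.
Proof. exact: (linf0 (ten_mul_linl y)). Qed.

Lemma ten_mul0r x : ten_mul x 0 = 0.
Proof. exact: (linf0 (ten_mul_linr x)). Qed.

Lemma ten_mul1l : left_id ten_one ten_mul.
Proof.
elim/tensor_ind=> [a b||x y ex ey]; first by rewrite ten_mul_pure !mul1r.
  exact: ten_mul0r.
by rewrite ten_mulDr ex ey.
Qed.

Lemma ten_mul1r : right_id ten_one ten_mul.
Proof.
elim/tensor_ind=> [a b||x y ex ey]; first by rewrite ten_mul_pure !mulr1.
  exact: ten_mul0l.
by rewrite ten_mulDl ex ey.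
Qed.

Lemma ten_mulA : associative ten_mul.
Proof.
elim/tensor_ind=> [a b||x x' ex ex'] y z; last first.
- by rewrite !ten_mulDl ex ex'.
- by rewrite !ten_mul0l.
elim/tensor_ind: y => [c d||y y' ey ey']; last first.
- by rewrite ten_mulDl !ten_mulDr ten_mulDl ey ey'.
- by rewrite ten_mul0l !ten_mul0r ten_mul0l.
elim/tensor_ind: z => [e f||z z' ez ez']; last first.
- by rewrite !ten_mulDr ez ez'.
- by rewrite !ten_mul0r.
by rewrite !ten_mul_pure !mulrA.
Qed.

HB.instance Definition _ := Lmodule_isPzAlgebra.Build k (tensor A B)
  ten_mulA ten_mul1l ten_mul1r ten_mulDl ten_mulDr ten_scaleAl ten_scaleAr.
HB.instance Definition _ := GRing.Zmodule_isPzRing.Build (tensor A B)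
  ten_mulA ten_mul1l ten_mul1r ten_mulDl ten_mulDr.

Lemma pureM a b c d : (a ⊗ b) * (c ⊗ d) = (a * c) ⊗ (b * d).
Proof. exact: ten_mul_pure. Qed.

Lemma pure1 : 1 ⊗ 1 = 1 :> A ⊗ B.
Proof. by []. Qed.

End TensorAlgebra.

Section OppositeAlgebra.
Variables (k : fieldType) (A : pzAlgType k).

HB.instance Definition _ := GRing.Lmodule.on A^c.

Lemma op_scaleAl (c : k) (x y : A^c) : c *: (x * y) = (c *: x) * y.
Proof. exact: (pzAr c (y : A) (x : A)). Qed.

Lemma op_scaleAr (c : k) (x y : A^c) : c *: (x * y) = x * (c *: y).
Proof. exact: (pzAl c (y : A) (x : A)). Qed.

HB.instance Definition _ := Lmodule_isPzAlgebra.Build k A^c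
  (@mulrA A^c) (@mul1r A^c) (@mulr1 A^c) (@mulrDl A^c) (@mulrDr A^c)
  op_scaleAl op_scaleAr.

(* The identity map, read as a map into the opposite algebra. *)
Definition toop (x : A) : A^c := x.

Lemma toopM (x y : A) : toop (x * y) = toop y * toop x. Proof. by []. Qed.
Lemma toop_linear : linear toop. Proof. by []. Qed.

End OppositeAlgebra.

Section TensorMaps.
Variable k : fieldType.

Definition tmap (A B A' B' : lmodType k) (f : A -> A') (g : B -> B') :
  A ⊗ B -> A' ⊗ B' := tlift (fun a b => f a ⊗ g b).

Definition tswap (A B : lmodType k) : A ⊗ B -> B ⊗ A :=
  tlift (fun a b => b ⊗ a).

(* Iterated tensor products are nested to the right: A ⊗ (B ⊗ C), etc. *)
Definition tassoc (A B C : lmodType k) : (A ⊗ B) ⊗ C -> A ⊗ B ⊗ C :=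
  tlift (fun x c => tlift (fun a b => a ⊗ b ⊗ c) x).

Definition tassoc3 (A B C D : lmodType k) : (A ⊗ B ⊗ C) ⊗ D -> A ⊗ B ⊗ C ⊗ D :=
  fun x => tmap id (@tassoc B C D) (tassoc x).

(* f ⊗ id for f : A -> B ⊗ C, with the codomain reassociated to the right. *)
Definition tfirst (A B C D : lmodType k) (f : A -> B ⊗ C) :
  A ⊗ D -> B ⊗ C ⊗ D := fun x => tassoc (tmap f id x).

(* e ⊗ id and id ⊗ e for a linear form e, using k ⊗ B = B and B ⊗ k = B. *)
Definition tform_l (A B : lmodType k) (e : A -> k) : A ⊗ B -> B :=
  tlift (fun a b => e a *: b).
Definition tform_r (A B : lmodType k) (e : A -> k) : B ⊗ A -> B :=
  tlift (fun b a => e a *: b).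

End TensorMaps.

Section TensorMapsTheory.
Variable k : fieldType.
Implicit Types A B C D V W : lmodType k.

Lemma comp_linear A B C (f : B -> C) (g : A -> B) :
  linear f -> linear g -> linear (fun x => f (g x)).
Proof. by move=> fL gL c x y; rewrite (linfD gL) (linfD fL) (linfZ gL) (linfZ fL). Qed.

Lemma tmap_bilin A B C D (f : A -> C) (g : B -> D) :
  linear f -> linear g -> bilin (fun a b => f a ⊗ g b).
Proof.
move=> fL gL; split=> [b|a] c x y /=.
  by rewrite (linfD fL) (linfZ fL) pure_linl.
by rewrite (linfD gL) (linfZ gL) pure_linr.
Qed.

Lemma tmap_linear A B C D (f : A -> C) (g : B -> D) :
  linear f -> linear g -> linear (tmap f g).
Proof. by move=> fL gL; apply/tlift_linear/tmap_bilin. Qed.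

Lemma tmap_pure A B C D (f : A -> C) (g : B -> D) a b :
  linear f -> linear g -> tmap f g (a ⊗ b) = f a ⊗ g b.
Proof. by move=> fL gL; rewrite /tmap tlift_pure //; apply: tmap_bilin. Qed.

Lemma tswap_bilin A B : bilin (fun (a : A) (b : B) => b ⊗ a).
Proof. by split=> [b|a] c x y /=; rewrite ?pure_linl ?pure_linr. Qed.

Lemma tswap_linear A B : linear (@tswap k A B).
Proof. exact/tlift_linear/tswap_bilin. Qed.

Lemma tswap_pure A B (a : A) (b : B) : tswap (a ⊗ b) = b ⊗ a.
Proof. by rewrite /tswap tlift_pure //; apply: tswap_bilin. Qed.

Lemma tassoc_inner_bilin A B C (c : C) :
  bilin (fun (a : A) (b : B) => a ⊗ b ⊗ c).
Proof. by split=> [b|a] d x y /=; rewrite ?pure_linl ?pure_linr. Qed.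

Lemma tassoc_bilin A B C :
  bilin (fun (x : A ⊗ B) (c : C) => tlift (fun a b => a ⊗ b ⊗ c) x).
Proof.
split=> [c|x] d y z /=; first exact/tlift_linear/tassoc_inner_bilin.
by apply: tlift_lin_phi => a b; rewrite !pure_linr.
Qed.

Lemma tassoc_linear A B C : linear (@tassoc k A B C).
Proof. exact/tlift_linear/tassoc_bilin. Qed.

Lemma tassoc_pure A B C (a : A) (b : B) (c : C) :
  tassoc ((a ⊗ b) ⊗ c) = a ⊗ b ⊗ c.
Proof.
rewrite /tassoc tlift_pure; last exact: tassoc_bilin.
by rewrite tlift_pure //; apply: tassoc_inner_bilin.
Qed.

Lemma id_linear A : linear (@id A). Proof. by []. Qed.

Lemma tfirst_linear A B C D (f : A -> B ⊗ C) :
  linear f -> linear (tfirst f : A ⊗ D -> _).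
Proof.
move=> fL; apply: comp_linear; first exact: tassoc_linear.
exact: tmap_linear.
Qed.

Lemma tassoc3_linear A B C D : linear (@tassoc3 k A B C D).
Proof.
apply: comp_linear; last exact: tassoc_linear.
by apply: tmap_linear => //; apply: tassoc_linear.
Qed.

Lemma tform_l_bilin A B (e : A -> k) :
  scalar e -> bilin (fun (a : A) (b : B) => e a *: b).
Proof.
move=> eL; split=> [b|a] c x y /=.
  by rewrite eL scalerDl scalerA.
by rewrite scalerDr !scalerA mulrC.
Qed.

Lemma tform_r_bilin A B (e : A -> k) :
  scalar e -> bilin (fun (b : B) (a : A) => e a *: b).
Proof.
move=> eL; split=> [a|b] c x y /=.
  by rewrite scalerDr !scalerA mulrC.
by rewrite eL scalerDl scalerA.
Qed.

Lemma tform_l_linear A B (e : A -> k) :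
  scalar e -> linear (tform_l e : A ⊗ B -> B).
Proof. by move=> eL; apply/tlift_linear/tform_l_bilin. Qed.

Lemma tform_r_linear A B (e : A -> k) :
  scalar e -> linear (tform_r e : B ⊗ A -> B).
Proof. by move=> eL; apply/tlift_linear/tform_r_bilin. Qed.

Lemma tform_l_pure A B (e : A -> k) (a : A) (b : B) :
  scalar e -> tform_l e (a ⊗ b) = e a *: b.
Proof. by move=> eL; rewrite /tform_l tlift_pure //; apply: tform_l_bilin. Qed.

Lemma tform_r_pure A B (e : A -> k) (a : A) (b : B) :
  scalar e -> tform_r e (b ⊗ a) = e a *: b.
Proof. by move=> eL; rewrite /tform_r tlift_pure //; apply: tform_r_bilin. Qed.

Lemma tmap_comp A B A' B' A'' B'' (f : A -> A') (f' : A' -> A'')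
    (g : B -> B') (g' : B' -> B'') (x : A ⊗ B) :
  linear f -> linear f' -> linear g -> linear g' ->
  tmap f' g' (tmap f g x) = tmap (fun a => f' (f a)) (fun b => g' (g b)) x.
Proof.
move=> fL f'L gL g'L; have ffL := comp_linear f'L fL.
have ggL := comp_linear g'L gL.
move: x; apply: tensor_ext => [||a b].
- by apply: comp_linear; apply: tmap_linear.
- exact: tmap_linear.
- by rewrite !tmap_pure.
Qed.

Lemma tensor_ext3 A B C V (f g : (A ⊗ B) ⊗ C -> V) : linear f -> linear g ->
  (forall a b c, f ((a ⊗ b) ⊗ c) = g ((a ⊗ b) ⊗ c)) -> f =1 g.
Proof.
move=> fL gL fg; apply: tensor_ext => // x c; move: x.
apply: tensor_ext => [||a b]; last exact: fg.
- by apply: (@comp_linear _ _ _ f (pure^~ c)) => // *; apply: pure_linl.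
- by apply: (@comp_linear _ _ _ g (pure^~ c)) => // *; apply: pure_linl.
Qed.

Lemma tassoc_nat A B C A' B' C' (f : A -> A') (g : B -> B') (h : C -> C')
    (x : (A ⊗ B) ⊗ C) : linear f -> linear g -> linear h ->
  tassoc (tmap (tmap f g) h x) = tmap f (tmap g h) (tassoc x).
Proof.
move=> fL gL hL; have fgL := tmap_linear fL gL; have ghL := tmap_linear gL hL.
move: x; apply: tensor_ext3 => [||a b c].
- by apply: comp_linear; [apply: tassoc_linear | apply: tmap_linear].
- by apply: comp_linear; [apply: tmap_linear | apply: tassoc_linear].
- by rewrite tassoc_pure !tmap_pure // tassoc_pure.
Qed.

Lemma tfirst_nat A B C D A' B' C' D' (d : A -> B ⊗ C) (d' : A' -> B' ⊗ C')
    (fA : A -> A') (fB : B -> B') (fC : C -> C') (fD : D -> D') (x : A ⊗ D) :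
  linear d -> linear d' -> linear fA -> linear fB -> linear fC -> linear fD ->
  (forall a, d' (fA a) = tmap fB fC (d a)) ->
  tfirst d' (tmap fA fD x) = tmap fB (tmap fC fD) (tfirst d x).
Proof.
move=> dL d'L fAL fBL fCL fDL dE; have fBCL := tmap_linear fBL fCL.
rewrite /tfirst -tassoc_nat // !tmap_comp //; congr (tassoc (tmap _ _ x)).
exact: funext.
Qed.

Lemma tassoc3_nat A B C D A' B' C' D' (fA : A -> A') (fB : B -> B')
    (fC : C -> C') (fD : D -> D') (x : (A ⊗ B ⊗ C) ⊗ D) :
  linear fA -> linear fB -> linear fC -> linear fD ->
  tassoc3 (tmap (tmap fA (tmap fB fC)) fD x)
  = tmap fA (tmap fB (tmap fC fD)) (tassoc3 x).
Proof.
move=> fAL fBL fCL fDL; have BCL := tmap_linear fBL fCL.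
have CDL := tmap_linear fCL fDL; have BCDL := tmap_linear BCL fDL.
have BCDL' := tmap_linear fBL CDL.
rewrite /tassoc3 tassoc_nat // !tmap_comp //; try exact: tassoc_linear.
by congr (tmap _ _ _); apply: funext => y; apply: tassoc_nat.
Qed.

End TensorMapsTheory.

Section AlgebraMaps.
Variables (k : fieldType) (A B : pzAlgType k).

Definition algebra_map (f : A -> B) : Prop := linear f /\ monoid_morphism f.
Definition augmentation (e : A -> k) : Prop := scalar e /\ monoid_morphism e.
Definition algebra_antimap (f : A -> B) : Prop :=
  [/\ linear f, f 1 = 1 & forall x y, f (x * y) = f y * f x].

End AlgebraMaps.

Section Inverse.
Variable R : pzRingType.

Definition mutual_inverse (x y : R) : Prop := x * y = 1 /\ y * x = 1.
Definition invertible (x : R) : Prop := exists y, mutual_inverse x y.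

(* The two-sided inverse of [x]; [0] if [x] is not invertible. *)
Definition inv (x : R) : R :=
  if pselect (invertible x) is left h then sval (cid h) else 0.

Lemma invP x : invertible x -> mutual_inverse x (inv x).
Proof. by rewrite /inv; case: pselect => // h _; apply: svalP. Qed.

Lemma inv_unique x y : mutual_inverse x y -> inv x = y.
Proof.
move=> [xy yx]; have [_ ix] : mutual_inverse x (inv x) by apply: invP; exists y.
by rewrite -[LHS]mulr1 -xy mulrA ix mul1r.
Qed.

Lemma mutual_inverse_sym x y : mutual_inverse x y -> mutual_inverse y x.
Proof. by case. Qed.

Lemma mutual_inverseM x x' y y' : mutual_inverse x x' -> mutual_inverse y y' ->
  mutual_inverse (x * y) (y' * x').
Proof.
move=> [xx x'x] [yy y'y]; split.
  by rewrite mulrA -[x * y * y']mulrA yy mulr1.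
by rewrite mulrA -[y' * x' * x]mulrA x'x mulr1.
Qed.

End Inverse.

Section AlgebraMapsTheory.
Variable k : fieldType.
Implicit Types A B C D : pzAlgType k.

Lemma tensor_extM A B C (f : A ⊗ B -> C) : linear f ->
  (forall a b a' b', f ((a ⊗ b) * (a' ⊗ b')) = f (a ⊗ b) * f (a' ⊗ b')) ->
  {morph f : x y / x * y}.
Proof.
move=> fL fM; elim/tensor_ind=> [a b||x x' ex ex'] y; last first.
- by rewrite mulrDl !(linfD fL) mulrDl ex ex'.
- by rewrite mul0r (linf0 fL) mul0r.
elim/tensor_ind: y => [c d||y y' ey ey']; last first.
- by rewrite mulrDr !(linfD fL) mulrDr ey ey'.
- by rewrite mulr0 (linf0 fL) mulr0.
exact: fM.
Qed.

Lemma id_algebra_map A : algebra_map (@id A). Proof. by []. Qed.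

Lemma comp_algebra_map A B C (f : B -> C) (g : A -> B) :
  algebra_map f -> algebra_map g -> algebra_map (fun x => f (g x)).
Proof.
move=> [fL [f1 fM]] [gL [g1 gM]]; split; first exact: comp_linear.
by split=> [|x y]; rewrite ?g1 ?f1 ?gM ?fM.
Qed.

Lemma tmap_algebra_map A B C D (f : A -> C) (g : B -> D) :
  algebra_map f -> algebra_map g -> algebra_map (tmap f g).
Proof.
move=> [fL [f1 fM]] [gL [g1 gM]]; split; first exact: tmap_linear.
split; first by rewrite -!pure1 tmap_pure // f1 g1.
apply: tensor_extM => [|a b a' b']; first exact: tmap_linear.
by rewrite pureM !tmap_pure // pureM fM gM.
Qed.

Lemma tmap_algebra_antimap A B C D (f : A -> C) (g : B -> D) :
  algebra_antimap f -> algebra_antimap g -> algebra_antimap (tmap f g).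
Proof.
move=> [fL f1 fM] [gL g1 gM]; have tL := tmap_linear fL gL; split=> //.
  by rewrite -!pure1 tmap_pure // f1 g1.
apply: (@tensor_extM A B (tensor C D)^c) => // a b a' b'.
by rewrite pureM !tmap_pure // fM gM -pureM.
Qed.

Lemma tassoc_algebra_map A B C : algebra_map (@tassoc k A B C).
Proof.
have aL := @tassoc_linear k A B C; split=> //; split.
  by rewrite -[1 in LHS]pure1 -[1 in X in _ X _]pure1 tassoc_pure.
have pM : forall x c x' c', tassoc ((x ⊗ c) * (x' ⊗ c'))
    = tassoc (x ⊗ c) * tassoc (x' ⊗ c') :> A ⊗ B ⊗ C.
  move=> x c x' c'; rewrite pureM.
  have pL (d : C) (D E : lmodType k) (f : D ⊗ C -> E) :
      linear f -> linear (fun x => f (x ⊗ d)).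
    by move=> fL; apply: (comp_linear fL) => ? ? ?; rewrite pure_linl.
  elim/tensor_ind: x => [a b||x y ex ey]; last first.
  - by rewrite mulrDl !(linfD (pL _ _ _ _ aL)) mulrDl ex ey.
  - by rewrite mul0r !(linf0 (pL _ _ _ _ aL)) mul0r.
  elim/tensor_ind: x' => [a' b'||x y ex ey]; last first.
  - by rewrite mulrDr !(linfD (pL _ _ _ _ aL)) mulrDr ex ey.
  - by rewrite mulr0 !(linf0 (pL _ _ _ _ aL)) mulr0.
  by rewrite pureM !tassoc_pure !pureM.
exact: tensor_extM.
Qed.

Lemma tassoc3_algebra_map A B C D : algebra_map (@tassoc3 k A B C D).
Proof.
apply: comp_algebra_map; last exact: tassoc_algebra_map.
apply: tmap_algebra_map; first exact: id_algebra_map.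
exact: tassoc_algebra_map.
Qed.

Lemma tfirst_algebra_map A B C D (f : A -> B ⊗ C) :
  algebra_map f -> algebra_map (tfirst f : A ⊗ D -> _).
Proof.
move=> fA; apply: comp_algebra_map; first exact: tassoc_algebra_map.
by apply: tmap_algebra_map; last exact: id_algebra_map.
Qed.

Lemma pure1l_algebra_map A B : algebra_map (fun b : B => (1 : A) ⊗ b).
Proof.
split; first by move=> c x y; rewrite pure_linr.
by split=> // x y; rewrite pureM mulr1.
Qed.

Lemma pure1r_algebra_map A B : algebra_map (fun a : A => a ⊗ (1 : B)).
Proof.
split; first by move=> c x y; rewrite pure_linl.
by split=> // x y; rewrite pureM mulr1.
Qed.

Lemma inv_algebra_map A B (f : A -> B) x :
  algebra_map f -> invertible x -> mutual_inverse (f x) (f (inv x)).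
Proof.
move=> [_ [f1 fM]] /invP[xi ix].
by split; rewrite -fM ?xi ?ix f1.
Qed.

Lemma inv_algebra_antimap A B (f : A -> B) x :
  algebra_antimap f -> invertible x -> mutual_inverse (f x) (f (inv x)).
Proof.
move=> [_ f1 fM] /invP[xi ix].
by split; rewrite -fM ?xi ?ix f1.
Qed.

End AlgebraMapsTheory.

Record quasi_bialgebra (k : fieldType) (H : pzAlgType k) := QuasiBialgebra {
  comul : H -> H ⊗ H;
  counit : H -> k;
  reass : H ⊗ H ⊗ H;
  comul_algebra_map : algebra_map comul;
  counit_algebra_map : augmentation counit;
  reass_invertible : invertible reass;
  comul_coassoc : forall h,
    tmap id comul (comul h) = reass * tfirst comul (comul h) * inv reass;
  comul_counit_r : forall h, tform_r counit (comul h) = h;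
  comul_counit_l : forall h, tform_l counit (comul h) = h;
  reass_pentagon :
    ((1 : H) ⊗ reass) * tmap id (tfirst comul) reass * tassoc3 (reass ⊗ (1 : H))
    = tmap id (tmap id comul) reass * tfirst comul reass;
  reass_counit : tmap id (tform_l counit) reass = 1
}.

Record quasi_hopf (k : fieldType) (H : pzAlgType k) := QuasiHopf {
  qhopf_bialgebra :> quasi_bialgebra H;
  antipode : H -> H;
  antipode_inv : H -> H;
  qalpha : H;
  qbeta : H;
  antipode_antimap : algebra_antimap antipode;
  antipodeK : cancel antipode antipode_inv;
  antipode_invK : cancel antipode_inv antipode;
  antipode_alpha : forall h,
    tlift (fun h1 h2 : H => antipode h1 * qalpha * h2) (comul qhopf_bialgebra h)
    = counit qhopf_bialgebra h *: qalpha;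
  antipode_beta : forall h,
    tlift (fun h1 h2 : H => h1 * qbeta * antipode h2) (comul qhopf_bialgebra h)
    = counit qhopf_bialgebra h *: qbeta;
  antipode_reass :
    tlift (fun X1 : H => tlift (fun X2 X3 : H =>
      X1 * qbeta * antipode X2 * qalpha * X3)) (reass qhopf_bialgebra) = 1;
  antipode_reass_inv :
    tlift (fun x1 : H => tlift (fun x2 x3 : H =>
      antipode x1 * qalpha * x2 * qbeta * antipode x3))
      (inv (reass qhopf_bialgebra)) = 1;
  counit_alpha : counit qhopf_bialgebra qalpha = 1;
  counit_beta : counit qhopf_bialgebra qbeta = 1;
  counit_antipode : forall h,
    counit qhopf_bialgebra (antipode h) = counit qhopf_bialgebra h
}.

Section OppositeQuasiBialgebra.
Variables (k : fieldType) (H : pzAlgType k) (Q : quasi_bialgebra H).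
Let T2 : H ⊗ H -> H^c ⊗ H^c := tmap (@toop k H) (@toop k H).
Let T3 := tmap (@toop k H) T2.
Let T4 := tmap (@toop k H) T3.

Definition op_comul (h : H^c) : H^c ⊗ H^c :=
  tmap (@toop k H) (@toop k H) (comul Q h).
Definition op_counit (h : H^c) : k := counit Q h.
Definition op_reass : H^c ⊗ H^c ⊗ H^c :=
  tmap (@toop k H) (tmap (@toop k H) (@toop k H)) (inv (reass Q)).

Let toopA : algebra_antimap (@toop k H).
Proof. by []. Qed.
Let T2A : algebra_antimap T2. Proof. exact: tmap_algebra_antimap. Qed.
Let T3A : algebra_antimap T3. Proof. exact: tmap_algebra_antimap. Qed.
Let T4A : algebra_antimap T4. Proof. exact: tmap_algebra_antimap. Qed.
Let toopL := @toop_linear k H.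
Let T2L : linear T2. Proof. by case: T2A. Qed.
Let T3L : linear T3. Proof. by case: T3A. Qed.
Let dL : linear (comul Q). Proof. by case: (comul_algebra_map Q). Qed.
Let eL : scalar (counit Q). Proof. by case: (counit_algebra_map Q). Qed.
Let opdL : linear op_comul. Proof. exact: (comp_linear T2L dL). Qed.

Lemma op_comul_algebra_map : algebra_map op_comul.
Proof.
split=> //; have [_ [d1 dM]] := comul_algebra_map Q; have [_ t1 tM] := T2A.
split=> [|x y]; first by rewrite /op_comul [comul _ _]d1; apply: t1.
by rewrite /op_comul [comul _ _]dM; apply: tM.
Qed.

Lemma op_counit_algebra_map : augmentation op_counit.
Proof.
split=> //; have [_ [e1 eM]] := counit_algebra_map Q.
by split=> // x y; rewrite /op_counit [counit _ _]eM mulrC.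
Qed.

Lemma op_reass_inverse : mutual_inverse op_reass (T3 (reass Q)).
Proof.
exact/mutual_inverse_sym/(inv_algebra_antimap T3A)/(reass_invertible Q).
Qed.

Lemma op_coassoc h : tmap id op_comul (op_comul h)
  = op_reass * tfirst op_comul (op_comul h) * inv op_reass.
Proof.
have -> : tmap id op_comul (op_comul h) = T3 (tmap id (comul Q) (comul Q h)).
  by rewrite /op_comul /T3 !tmap_comp.
have -> : tfirst op_comul (op_comul h) = T3 (tfirst (comul Q) (comul Q h)).
  exact: tfirst_nat.
rewrite (inv_unique op_reass_inverse) (comul_coassoc Q).
by have [_ _ T3M] := T3A; rewrite !T3M mulrA.
Qed.

Lemma op_counit_r h : tform_r op_counit (op_comul h) = h.
Proof.
transitivity (toop (tform_r (counit Q) (comul Q h))); last first.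
  by rewrite (comul_counit_r Q).
rewrite /op_comul; move: (comul Q h); apply: tensor_ext => [||a b].
- by apply: (comp_linear _ T2L); apply: tform_r_linear.
- exact: tform_r_linear.
- by rewrite tmap_pure // !tform_r_pure.
Qed.

Let tform_lT (D D' : lmodType k) (f : D -> D') (x : H ⊗ D) : linear f ->
  tform_l op_counit (tmap (@toop k H) f x) = f (tform_l (counit Q) x).
Proof.
move=> fL; move: x; apply: tensor_ext => [||a b].
- apply: comp_linear; first exact: tform_l_linear.
  exact: tmap_linear.
- by apply: comp_linear => //; apply: tform_l_linear.
- by rewrite tmap_pure // !tform_l_pure // (linfZ fL).
Qed.

Lemma op_counit_l h : tform_l op_counit (op_comul h) = h.
Proof. by rewrite /op_comul tform_lT // (comul_counit_l Q). Qed.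

Lemma op_reass_counit : tmap id (tform_l op_counit) op_reass = 1.
Proof.
have lL : linear (tform_l op_counit : H^c ⊗ H^c -> _) by apply: tform_l_linear.
have lL' : linear (tform_l (counit Q) : H ⊗ H -> H) by apply: tform_l_linear.
have -> : tmap id (tform_l op_counit) op_reass
    = T2 (tmap id (tform_l (counit Q)) (inv (reass Q))).
  rewrite /op_reass /T2 !tmap_comp //; congr (tmap _ _ _).
  by apply: funext => y; rewrite tform_lT.
have lA : algebra_map (tform_l (counit Q) : H ⊗ H -> H).
  split=> //; have [_ [e1 eM]] := counit_algebra_map Q.
  split; first by rewrite -pure1 tform_l_pure // e1 scale1r.
  apply: tensor_extM => // a b a' b'.
  by rewrite pureM !tform_l_pure // eM -pzAl -pzAr scalerA.
have [_] := inv_algebra_map (tmap_algebra_map (@id_algebra_map k H) lA)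
              (reass_invertible Q).
rewrite (reass_counit Q) mulr1 => ->.
by case: T2A.
Qed.

Lemma op_pentagon :
  ((1 : H^c) ⊗ op_reass) * tmap id (tfirst op_comul) op_reass
    * tassoc3 (op_reass ⊗ (1 : H^c))
  = tmap id (tmap id op_comul) op_reass * tfirst op_comul op_reass.
Proof.
set Phi := reass Q; set D := comul Q.
have DA := comul_algebra_map Q; have iP := reass_invertible Q.
have idA := @id_algebra_map k H.
have -> : (1 : H^c) ⊗ op_reass = T4 ((1 : H) ⊗ inv Phi) by rewrite /T4 tmap_pure.
have -> : tassoc3 (op_reass ⊗ (1 : H^c)) = T4 (tassoc3 (inv Phi ⊗ (1 : H))).
  by rewrite /T4 -tassoc3_nat // tmap_pure //; apply: T3L.
have tfL : linear (tfirst D : H ⊗ H -> _) by apply: tfirst_linear.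
have tfL' : linear (tfirst op_comul : H^c ⊗ H^c -> _) by apply: tfirst_linear.
have -> : tmap id (tfirst op_comul) op_reass = T4 (tmap id (tfirst D) (inv Phi)).
  rewrite /op_reass /T4 !tmap_comp //; congr (tmap _ _ _).
  by apply: funext => y; apply: tfirst_nat.
have tmL : linear (tmap id D : H ⊗ H -> _) by apply: tmap_linear.
have tmL' : linear (tmap id op_comul : H^c ⊗ H^c -> _) by apply: tmap_linear.
have -> : tmap id (tmap id op_comul) op_reass = T4 (tmap id (tmap id D) (inv Phi)).
  rewrite /op_reass /T4 !tmap_comp //; congr (tmap _ _ _).
  by apply: funext => y; rewrite /T3 !tmap_comp.
have -> : tfirst op_comul op_reass = T4 (tfirst D (inv Phi)).
  exact: tfirst_nat.
have [_ _ T4M] := T4A; rewrite -!T4M; congr (T4 _).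
have i1 := inv_algebra_map (@pure1l_algebra_map k H _) iP.
have i2 := inv_algebra_map (tmap_algebra_map idA (tfirst_algebra_map _ DA)) iP.
have i3 := inv_algebra_map (comp_algebra_map (@tassoc3_algebra_map k H H H H)
  (@pure1r_algebra_map k _ H)) iP.
have i4 := inv_algebra_map (tmap_algebra_map idA (tmap_algebra_map idA DA)) iP.
have i5 := inv_algebra_map (tfirst_algebra_map _ DA) iP.
have iL := mutual_inverseM (mutual_inverseM i1 i2) i3.
have iR := mutual_inverseM i4 i5.
rewrite -(inv_unique iR) -(inv_unique iL); congr (inv _).
exact: reass_pentagon.
Qed.

(* [H^op]: opposite product, same coproduct and counit, reassociator Phi^-1. *)
Definition op_quasi_bialgebra : quasi_bialgebra H^c :=
  QuasiBialgebra op_comul_algebra_map op_counit_algebra_map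
    (ex_intro _ _ op_reass_inverse) op_coassoc op_counit_r op_counit_l
    op_pentagon op_reass_counit.

End OppositeQuasiBialgebra.

Section DrinfeldTwist.
Variables (k : fieldType) (H : pzAlgType k) (Q : quasi_hopf H).
Local Notation S := (antipode Q).
Local Notation D := (comul Q).
Local Notation alpha := (qalpha Q).
Local Notation beta := (qbeta Q).
Local Notation Phi := (reass Q).

(* A = (Phi ⊗ 1) (Delta ⊗ id ⊗ id)(Phi^-1)
   gamma = S(A2) alpha A3 ⊗ S(A1) alpha A4 *)
Definition drinfeld_A : H ⊗ H ⊗ H ⊗ H :=
  tassoc3 (Phi ⊗ (1 : H)) * tfirst D (inv Phi).

Definition drinfeld_gamma : H ⊗ H :=
  tlift (fun A1 : H => tlift (fun A2 : H => tlift (fun A3 A4 : H =>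
    (S A2 * alpha * A3) ⊗ (S A1 * alpha * A4)))) drinfeld_A.

(* f = (S ⊗ S)(Delta^cop(x1)) gamma Delta(x2 beta S(x3)) *)
Definition drinfeld_twist : H ⊗ H :=
  tlift (fun x1 : H => tlift (fun x2 x3 : H =>
    tmap S S (tswap (D x1)) * drinfeld_gamma * D (x2 * beta * S x3))) (inv Phi).

End DrinfeldTwist.

Section ComoduleAlgebras.
Variables (k : fieldType) (H : pzAlgType k) (Q : quasi_bialgebra H).
Local Notation D := (comul Q).
Local Notation eps := (counit Q).

Record left_comodule_algebra (B : pzAlgType k)
    (lam : B -> H ⊗ B) (Phil : H ⊗ H ⊗ B) : Prop := LeftComoduleAlgebra {
  lcoact_algebra_map : algebra_map lam;
  lreass_invertible : invertible Phil;
  lcoact_coassoc : forall b,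
    tmap id lam (lam b) * Phil = Phil * tfirst D (lam b);
  lreass_pentagon :
    ((1 : H) ⊗ Phil) * tmap id (tfirst D) Phil * tassoc3 (reass Q ⊗ (1 : B))
    = tmap id (tmap id lam) Phil * tfirst D Phil;
  lcoact_counit : forall b, tform_l eps (lam b) = b;
  lreass_counit2 : tmap id (tform_l eps) Phil = 1;
  lreass_counit1 : tform_l eps Phil = 1
}.

Record right_comodule_algebra (A : pzAlgType k)
    (rho : A -> A ⊗ H) (Phir : A ⊗ H ⊗ H) : Prop := RightComoduleAlgebra {
  rcoact_algebra_map : algebra_map rho;
  rreass_invertible : invertible Phir;
  rcoact_coassoc : forall a,
    Phir * tfirst rho (rho a) = tmap id D (rho a) * Phir;
  rreass_pentagon :
    ((1 : A) ⊗ reass Q) * tmap id (tfirst D) Phir * tassoc3 (Phir ⊗ (1 : H))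
    = tmap id (tmap id D) Phir * tfirst rho Phir;
  rcoact_counit : forall a, tform_r eps (rho a) = a;
  rreass_counit2 : tmap id (tform_l eps) Phir = 1;
  rreass_counit3 : tmap id (tform_r eps) Phir = 1
}.

Definition left_twist_equivalent (B : pzAlgType k)
    (lam : B -> H ⊗ B) (Phil : H ⊗ H ⊗ B)
    (lam' : B -> H ⊗ B) (Phil' : H ⊗ H ⊗ B) : Prop :=
  exists U : H ⊗ B,
    [/\ invertible U,
        tform_l eps U = 1,
        forall b, lam' b = U * lam b * inv U
      & Phil' = ((1 : H) ⊗ U) * tmap id lam U * Phil * tfirst D (inv U)].

Definition right_twist_equivalent (A : pzAlgType k)
    (rho : A -> A ⊗ H) (Phir : A ⊗ H ⊗ H)
    (rho' : A -> A ⊗ H) (Phir' : A ⊗ H ⊗ H) : Prop :=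
  exists V : A ⊗ H,
    [/\ invertible V,
        tform_r eps V = 1,
        forall a, rho' a = V * rho a * inv V
      & Phir' = tmap id D V * Phir * tfirst rho (inv V)
                * tassoc (inv V ⊗ (1 : H))].

End ComoduleAlgebras.

Section OppositeComoduleAlgebra.
Variables (k : fieldType) (H : pzAlgType k) (Q : quasi_hopf H).
Variable B : pzAlgType k.
Local Notation Sinv := (antipode_inv Q).

(* b |-> b_[0] ⊗ S^-1(b_[-1]) *)
Definition op_coact (lam : B -> H ⊗ B) (b : B) : B ⊗ H^c :=
  tlift (fun (h : H) (b0 : B) => b0 ⊗ toop (Sinv h)) (lam b).

(* x3 ⊗ S^-1(f2 x2) ⊗ S^-1(f1 x1), where x1 ⊗ x2 ⊗ x3 is the inverse of Phil *)
Definition op_coact_reass (Phil : H ⊗ H ⊗ B) : B ⊗ H^c ⊗ H^c :=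
  tlift (fun f1 f2 : H => tlift (fun x1 : H => tlift (fun (x2 : H) (x3 : B) =>
      x3 ⊗ toop (Sinv (f2 * x2)) ⊗ toop (Sinv (f1 * x1)))) (inv Phil))
    (drinfeld_twist Q).

End OppositeComoduleAlgebra.

(* Main.v *)
(* The Drinfeld twist f conjugates one antipode of H along Delta into another.

   Let F : H -> N be an algebra map. An antipode along F is a triple
   (G, rho, sigma), with G : H -> N an anti-algebra map, subject to the axioms
   of (S, alpha, beta) read through F. Drinfeld's uniqueness argument shows that
   two antipodes along F are conjugate by the unit
   u = G'(x1) rho' F(x2) sigma G(x3), and that u is the only element with
   u G(h) = G'(h) u and u rho = rho'. Two antipodes with commuting values
   multiply to an antipode along h |-> F1(h1) F2(h2), by two zigzag identities.
   Along Delta this compares (Delta S, Delta alpha, Delta beta) with the product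
   of two copies of (S, alpha, beta), and u is then the twist f; so f is
   invertible and f Delta(S h) = (S ⊗ S) Delta^cop(h) f. The cocycle identity
   for f is the uniqueness of u along (Delta ⊗ id) Delta.

   All identities between reassociators are computed inside one algebra E that
   receives pairwise commuting maps from H, rather than in the tensor powers
   of H: then Phi yields u(X1) v(X2) w(X3) in E for any three such maps u, v, w.

   Finally, h ⊗ b |-> b ⊗ S^-1(h) is an algebra map H ⊗ B -> B ⊗ H^op; it carries
   the axioms of (lambda, Phi_lambda^-1) to those of (rho, Phi_rho), the
   cocycle identity of f accounting for the pentagon. *)

From mathcomp Require Import all_boot all_order all_algebra.
From mathcomp Require Import boolp.
Require Import Defs.

Set Implicit Arguments.
Unset Strict Implicit.
Unset Printing Implicit Defensive.

Import GRing.Theory.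
Local Open Scope ring_scope.

(** * Words of commuting maps *)

(** The obstacle is that alpha and beta are not in the algebra of words: S(h1) alpha h2 collapses
    only when both legs touch the same alpha. An expression is therefore read as a linear functional
    on E, with the alphas and betas at fixed places. Since the antipode letters take values in
    opposite algebras, the leftmost factor of a product in E is the one next to the alphas, and the
    rightmost the one next to the betas. So alpha removes a pair of letters only at the left end,
    and beta only at the right end. Proving an identity means factoring a rebracketing so that every
    pair to be removed arrives at its end as a block; reassociators with a counit leg then
    disappear. The formula for gamma has the same origin: two caps are nested, and A rebrackets
    (ab)(cd) into (a(bc))d, where the inner pair goes before the outer one. Uniqueness of u comes
    from multiplying S(x1) alpha x2 beta S(x3) = 1, read along F, by u on the left. It also gives
    the counit normalisation of f, because a counit on one leg of Delta leaves the identity map. *)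

Section TensorToAlgebra.
Variables (k : fieldType) (E : pzAlgType k).
Implicit Types A B C D : lmodType k.

Lemma linear_tensor_ext3 A B C D (f g : A ⊗ B ⊗ C -> D) : linear f -> linear g ->
  (forall a b c, f (a ⊗ b ⊗ c) = g (a ⊗ b ⊗ c)) -> f =1 g.
Proof.
move=> fL gL fg; apply: tensor_ext => // a x; move: x.
apply: tensor_ext => [||b c]; last exact: fg.
- by apply: (@comp_linear _ _ _ _ f (pure a)) => // *; apply: pure_linr.
- by apply: (@comp_linear _ _ _ _ g (pure a)) => // *; apply: pure_linr.
Qed.

Lemma linear_tensor_ext4 A B C A' D (f g : A ⊗ B ⊗ C ⊗ A' -> D) :
  linear f -> linear g ->
  (forall a b c d, f (a ⊗ b ⊗ c ⊗ d) = g (a ⊗ b ⊗ c ⊗ d)) -> f =1 g.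
Proof.
move=> fL gL fg; apply: tensor_ext => // a x; move: x.
apply: linear_tensor_ext3 => [||b c d]; last exact: fg.
- by apply: (@comp_linear _ _ _ _ f (pure a)) => // *; apply: pure_linr.
- by apply: (@comp_linear _ _ _ _ g (pure a)) => // *; apply: pure_linr.
Qed.

Definition ten2 A B (u : A -> E) (v : B -> E) : A ⊗ B -> E :=
  tlift (fun a b => u a * v b).

Lemma ten2_bilin A B (u : A -> E) (v : B -> E) :
  linear u -> linear v -> bilin (fun a b => u a * v b).
Proof.
move=> uL vL; split=> [b|a] c x y /=.
  by rewrite (linfD uL) (linfZ uL) mulrDl pzAl.
by rewrite (linfD vL) (linfZ vL) mulrDr pzAr.
Qed.

Lemma ten2_linear A B (u : A -> E) (v : B -> E) :
  linear u -> linear v -> linear (ten2 u v).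
Proof. by move=> uL vL; apply/tlift_linear/ten2_bilin. Qed.

Lemma ten2_pure A B (u : A -> E) (v : B -> E) a b :
  linear u -> linear v -> ten2 u v (a ⊗ b) = u a * v b.
Proof. by move=> uL vL; rewrite /ten2 tlift_pure //; apply: ten2_bilin. Qed.

Lemma ten2_tmap A B A' B' (u : A -> E) (v : B -> E) (f : A' -> A) (g : B' -> B) x :
  linear u -> linear v -> linear f -> linear g ->
  ten2 u v (tmap f g x) = ten2 (fun a => u (f a)) (fun b => v (g b)) x.
Proof.
move=> uL vL fL gL; move: x; apply: tensor_ext => [||a b].
- by apply: comp_linear; [apply: ten2_linear | apply: tmap_linear].
- by apply: ten2_linear; apply: comp_linear.
- by rewrite tmap_pure // !ten2_pure //; apply: comp_linear.
Qed.

Lemma ten2_tassoc A B C (u : A -> E) (v : B -> E) (w : C -> E) x :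
  linear u -> linear v -> linear w ->
  ten2 u (ten2 v w) (tassoc x) = ten2 (ten2 u v) w x.
Proof.
move=> uL vL wL; have vwL := ten2_linear vL wL; have uvL := ten2_linear uL vL.
move: x; apply: tensor_ext3 => [||a b c].
- by apply: comp_linear; [apply: ten2_linear | apply: tassoc_linear].
- exact: ten2_linear.
- by rewrite tassoc_pure !ten2_pure // mulrA.
Qed.

Definition intertwine (A : Type) (g : E) (u v : A -> E) := forall a, g * u a = v a * g.

Lemma intertwine_ten2 A B (g : E) (u u' : A -> E) (v v' : B -> E) :
  linear u -> linear u' -> linear v -> linear v' ->
  intertwine g u u' -> intertwine g v v' -> intertwine g (ten2 u v) (ten2 u' v').
Proof.
move=> uL u'L vL v'L gu gv; apply: tensor_ext => [||a b].
- by apply: (comp_linear (mull_linear g)); apply: ten2_linear.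
- by apply: (comp_linear (mulr_linear g)); apply: ten2_linear.
- by rewrite !ten2_pure // mulrA gu -mulrA gv mulrA.
Qed.

Definition commuting (A B : Type) (u : A -> E) (v : B -> E) := forall a, intertwine (u a) v v.

Lemma commutingC A B (u : A -> E) (v : B -> E) : commuting u v -> commuting v u.
Proof. by move=> uv b a; rewrite uv. Qed.

Lemma commuting_ten2r A B C (w : C -> E) (u : A -> E) (v : B -> E) :
  linear u -> linear v ->
  commuting w u -> commuting w v -> commuting w (ten2 u v).
Proof. by move=> uL vL wu wv c; apply: intertwine_ten2. Qed.

Lemma ten2_algebra_map (A B : pzAlgType k) (u : A -> E) (v : B -> E) :
  algebra_map u -> algebra_map v -> commuting u v -> algebra_map (ten2 u v).
Proof.
move=> [uL [u1 uM]] [vL [v1 vM]] uv; have L := ten2_linear uL vL; split=> //.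
split; first by rewrite -pure1 ten2_pure // u1 v1 mulr1.
apply: tensor_extM => // a b a' b'.
by rewrite pureM !ten2_pure // uM vM !mulrA -(mulrA (u a)) uv !mulrA.
Qed.

End TensorToAlgebra.

(* A word is a bracketing of letters, each letter standing for an algebra map
   H -> E; [wmap] reads a node as [h |-> x(h1) y(h2)] and [Unit] as the counit.
   Requiring distinct letters to commute turns every commutation side condition
   into the computable condition that a word has no repeated letter. *)
Inductive word := Unit | Letter of nat | Node of word & word.

Fixpoint letters (w : word) : seq nat :=
  match w with
  | Unit => [::]
  | Letter n => [:: n]
  | Node x y => letters x ++ letters y
  end.

Reserved Notation "x ∙ y" (at level 40, left associativity).
Notation "x ∙ y" := (Node x y).

Section Words.
Variables (k : fieldType) (H : pzAlgType k) (Q : quasi_bialgebra H).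
Variables (E : pzAlgType k) (L : nat -> H -> E).
Hypothesis Lhom : forall n, algebra_map (L n).
Hypothesis Lcomm : forall m n : nat, m != n -> commuting (L m) (L n).

Fixpoint wmap (w : word) : H -> E :=
  match w with
  | Unit => fun h => counit Q h *: (1 : E)
  | Letter n => L n
  | Node x y => fun h => ten2 (wmap x) (wmap y) (comul Q h)
  end.

Lemma wmap_linear w : linear (wmap w).
Proof.
elim: w => [|n|x xL y yL] /=; last 2 first.
- by case: (Lhom n).
- apply: comp_linear; first exact: ten2_linear.
  by case: (comul_algebra_map Q).
have [eL _] := counit_algebra_map Q.
by move=> c x y; rewrite eL scalerDl scalerA.
Qed.
Hint Resolve wmap_linear : core.

Definition ten3 x y z : H ⊗ H ⊗ H -> E := ten2 (wmap x) (ten2 (wmap y) (wmap z)).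

Lemma ten3_linear x y z : linear (ten3 x y z).
Proof. by apply: ten2_linear => //; apply: ten2_linear. Qed.
Hint Resolve ten3_linear : core.

Definition wdisj x y := ~~ has (mem (letters x)) (letters y).

Lemma wmap_comm x y : wdisj x y -> commuting (wmap x) (wmap y).
Proof.
rewrite /wdisj; elim: x y => [|n|x1 IH1 x2 IH2] y xy.
- by move=> a b /=; rewrite -pzAl -pzAr mul1r mulr1.
- elim: y xy => [|m|y1 IH1 y2 IH2] /= xy.
  + by move=> a b; rewrite -pzAl -pzAr mul1r mulr1.
  + apply: Lcomm; move: xy; rewrite orbF inE; apply: contra => /eqP->; exact: eqxx.
  + move: xy; rewrite has_cat negb_or => /andP[/IH1 c1 /IH2 c2].
    by move=> a b; apply: commuting_ten2r.
- have {}xy : ~~ has (mem (letters x1)) (letters y) /\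
             ~~ has (mem (letters x2)) (letters y).
    split; apply: contra xy => /hasP[z zy zx]; apply/hasP; exists z => //=.
      by move: zx; rewrite /= mem_cat => ->.
    by move: zx; rewrite /= mem_cat => ->; rewrite orbT.
  have [/IH1 c1 /IH2 c2] := xy.
  apply: commutingC => b a /=; apply: commuting_ten2r => //; exact: commutingC.
Qed.

Lemma wdisjr x y z : wdisj x (y ∙ z) = wdisj x y && wdisj x z.
Proof. by rewrite /wdisj /= has_cat negb_or. Qed.

Lemma wdisjC x y : wdisj x y = wdisj y x.
Proof.
rewrite /wdisj; congr (~~ _); apply/hasP/hasP => -[n nx ny]; by exists n.
Qed.

Lemma wdisjl x y z : wdisj (x ∙ y) z = wdisj x z && wdisj y z.
Proof. by rewrite wdisjC wdisjr !(wdisjC z). Qed.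

Definition wf w := uniq (letters w).

Lemma wf_node x y : wf (x ∙ y) = [&& wf x, wf y & wdisj x y].
Proof. by rewrite /wf /= cat_uniq; congr (_ && _); apply: andbC. Qed.

Lemma wmap_hom w : wf w -> algebra_map (wmap w).
Proof.
elim: w => [|n|x IHx y IHy] /=; last 2 first.
- by move=> _; apply: Lhom.
- rewrite wf_node => /and3P[/IHx xA /IHy yA /wmap_comm xy].
  apply: comp_algebra_map; first exact: ten2_algebra_map.
  exact: comul_algebra_map.
move=> _; split; first exact: (wmap_linear Unit).
have [eL [e1 eM]] := counit_algebra_map Q.
split=> [|a b]; first by rewrite e1 scale1r.
by rewrite eM -pzAl -pzAr mulr1 scalerA.
Qed.

(* [Phi3 x y z = x(X1) y(X2) z(X3)] rebrackets (xy)z into x(yz), and [Phi3V]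
   goes back; products of these elements are read from right to left. *)
Definition Phi3 x y z := ten3 x y z (reass Q).
Definition Phi3V x y z := ten3 x y z (inv (reass Q)).

Lemma ten3_hom x y z : wf (x ∙ (y ∙ z)) -> algebra_map (ten3 x y z).
Proof.
rewrite wf_node wdisjr wf_node.
case/and3P=> /wmap_hom xA /and3P[/wmap_hom yA /wmap_hom zA /wmap_comm yz].
case/andP=> /wmap_comm xy /wmap_comm xz.
apply: ten2_algebra_map => //; first exact: ten2_algebra_map.
exact: commuting_ten2r.
Qed.

Lemma Phi3_inv x y z : wf (x ∙ (y ∙ z)) -> mutual_inverse (Phi3 x y z) (Phi3V x y z).
Proof. by move/ten3_hom=> /inv_algebra_map; apply; apply: reass_invertible. Qed.

Lemma mulPhi3V x y z : wf (x ∙ (y ∙ z)) -> Phi3 x y z * Phi3V x y z = 1.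
Proof. by case/Phi3_inv. Qed.

Lemma mulVPhi3 x y z : wf (x ∙ (y ∙ z)) -> Phi3V x y z * Phi3 x y z = 1.
Proof. by case/Phi3_inv. Qed.

Lemma ten2_comulL (A : lmodType k) x y (v : A -> E) t : linear v ->
  ten2 (wmap x) (ten2 (wmap y) v) (tfirst (comul Q) t) = ten2 (wmap (x ∙ y)) v t.
Proof.
move=> vL; have [dL _] := comul_algebra_map Q.
by rewrite /tfirst ten2_tassoc // ten2_tmap //; apply: ten2_linear.
Qed.

Lemma ten2_comulR (A : lmodType k) (v : A -> E) x y t : linear v ->
  ten2 v (ten2 (wmap x) (wmap y)) (tmap id (comul Q) t) = ten2 v (wmap (x ∙ y)) t.
Proof.
move=> vL; have [dL _] := comul_algebra_map Q.
by rewrite ten2_tmap //; apply: ten2_linear.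
Qed.

(** Image of [reass_pentagon] under the map from the fourth tensor power of H to E given by the four
    words. It is an algebra map because a word without repeated letters has commuting parts. *)
Lemma pentagon x y z w : wf (x ∙ (y ∙ (z ∙ w))) ->
  Phi3 y z w * Phi3 x (y ∙ z) w * Phi3 x y z = Phi3 x y (z ∙ w) * Phi3 (x ∙ y) z w.
Proof.
rewrite wf_node => /and3P[wx wyzw]; rewrite wdisjr => /andP[xy xzw].
have xA := wmap_hom wx; have yzwA := ten3_hom wyzw.
have cx : commuting (wmap x) (ten3 y z w).
  move: xzw; rewrite wdisjr => /andP[/wmap_comm xz /wmap_comm xw].
  apply: commuting_ten2r => //; [exact: ten2_linear | exact: wmap_comm |].
  exact: commuting_ten2r.
have [_ [_ M]] := ten2_algebra_map xA yzwA cx.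
have := congr1 (ten2 (wmap x) (ten3 y z w)) (reass_pentagon Q); rewrite !M.
have [dL _] := comul_algebra_map Q.
have [_ [x1 _]] := xA; rewrite ten2_pure // x1 mul1r.
rewrite [ten2 _ _ (tmap id (tfirst _) _)]ten2_tmap //; last exact: tfirst_linear.
rewrite [ten2 _ _ (tmap id (tmap _ _) _)]ten2_tmap //; last exact: tmap_linear.
have -> : (fun b => ten3 y z w (tfirst (comul Q) b)) = ten2 (wmap (y ∙ z)) (wmap w).
  by apply: funext => b; apply: ten2_comulL.
have -> : (fun b => ten3 y z w (tmap id (comul Q) b)) = ten2 (wmap y) (wmap (z ∙ w)).
  by apply: funext => b; apply: ten2_comulR.
rewrite [ten2 _ _ (tfirst _ _)]ten2_comulL; last exact: ten2_linear.
rewrite /tassoc3 ten2_tmap //; last exact: tassoc_linear.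
have -> : (fun b => ten3 y z w (tassoc b)) = ten2 (ten2 (wmap y) (wmap z)) (wmap w).
  by apply: funext => b; apply: ten2_tassoc.
rewrite ten2_tassoc ?ten2_pure //; try by do ![apply: ten2_linear | apply: wmap_linear].
have [_ [-> _]] : algebra_map (wmap w).
  by apply: wmap_hom; move: wyzw; rewrite !wf_node => /and3P[_ /and3P[]].
  by rewrite mulr1.
exact: ten3_linear.
Qed.

Lemma Phi3_intertwine x y z : wf (x ∙ (y ∙ z)) ->
  intertwine (Phi3 x y z) (wmap (x ∙ y ∙ z)) (wmap (x ∙ (y ∙ z))).
Proof.
move=> w h; have [_ [_ M]] := ten3_hom w.
have := congr1 (ten3 x y z) (comul_coassoc Q h); rewrite !M.
rewrite [ten3 _ _ _ (tmap id _ _)]ten2_comulR // [ten3 _ _ _ (tfirst _ _)]ten2_comulL //.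
by move=> /= ->; rewrite -[RHS]mulrA (mulVPhi3 w) mulr1.
Qed.

Lemma intertwine_inv (A : Type) (g gi : E) (u v : A -> E) : mutual_inverse g gi ->
  (forall a, g * u a = v a * g) -> forall a, gi * v a = u a * gi.
Proof.
by move=> [gg ggi] guv a; rewrite -[v a]mulr1 -gg [v a * _]mulrA -guv !mulrA ggi mul1r.
Qed.

Lemma Phi3V_intertwine x y z : wf (x ∙ (y ∙ z)) ->
  intertwine (Phi3V x y z) (wmap (x ∙ (y ∙ z))) (wmap (x ∙ y ∙ z)).
Proof. by move=> w; apply: intertwine_inv (Phi3_inv w) (Phi3_intertwine w). Qed.

Lemma ten3_comm x y z w t : wdisj w x && wdisj w y && wdisj w z ->
  intertwine (ten3 x y z t) (wmap w) (wmap w).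
Proof.
case/andP=> /andP[/wmap_comm wx /wmap_comm wy] /wmap_comm wz.
have : commuting (wmap w) (ten3 x y z).
  by apply: commuting_ten2r => //; [exact: ten2_linear | exact: commuting_ten2r].
by move/commutingC; apply.
Qed.

Lemma intertwine_node (g : E) x x' y y' :
  intertwine g (wmap x) (wmap x') -> intertwine g (wmap y) (wmap y') ->
  intertwine g (wmap (x ∙ y)) (wmap (x' ∙ y')).
Proof. by move=> gx gy h; apply: intertwine_ten2. Qed.

Lemma intertwine_ten3 (g : E) x x' y y' z z' :
  intertwine g (wmap x) (wmap x') -> intertwine g (wmap y) (wmap y') ->
  intertwine g (wmap z) (wmap z') -> intertwine g (ten3 x y z) (ten3 x' y' z').
Proof.
move=> gx gy gz; apply: intertwine_ten2 => //; try exact: ten2_linear.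
exact: intertwine_ten2.
Qed.

Lemma wmap_unitl x : wmap (Unit ∙ x) = wmap x.
Proof.
apply: funext => h /=; rewrite -[in RHS](comul_counit_l Q h).
have [eL _] := counit_algebra_map Q.
move: (comul Q h); apply: tensor_ext => [||a b].
- by apply: ten2_linear; first exact: (wmap_linear Unit).
- by apply: comp_linear => //; apply: tform_l_linear.
rewrite tform_l_pure // ten2_pure //; last exact: (wmap_linear Unit).
by rewrite -pzAl mul1r (linfZ (@wmap_linear x)).
Qed.

Lemma wmap_unitr x : wmap (x ∙ Unit) = wmap x.
Proof.
apply: funext => h /=; rewrite -[in RHS](comul_counit_r Q h).
have [eL _] := counit_algebra_map Q.
move: (comul Q h); apply: tensor_ext => [||a b].
- by apply: ten2_linear; last exact: (wmap_linear Unit).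
- by apply: comp_linear => //; apply: tform_r_linear.
rewrite tform_r_pure // ten2_pure //; last exact: (wmap_linear Unit).
by rewrite -pzAr mulr1 (linfZ (@wmap_linear x)).
Qed.

Lemma eq_wmap_node x x' y y' : wmap x = wmap x' -> wmap y = wmap y' ->
  wmap (x ∙ y) = wmap (x' ∙ y').
Proof. by move=> /= -> ->. Qed.

Lemma Phi3_unit2 x y : wf (x ∙ y) -> Phi3 x Unit y = 1.
Proof.
rewrite wf_node => /and3P[wx wy /wmap_comm xy].
have [_ [<- _]] := ten2_algebra_map (wmap_hom wx) (wmap_hom wy) xy.
rewrite -(reass_counit Q) ten2_tmap //; last first.
  by apply: tform_l_linear; case: (counit_algebra_map Q).
congr (ten2 _ _ _); apply: funext; have [eL _] := counit_algebra_map Q.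
apply: tensor_ext => [||a b].
- by apply: ten2_linear => //; exact: (wmap_linear Unit).
- by apply: comp_linear => //; apply: tform_l_linear.
rewrite tform_l_pure // ten2_pure //=.
  by rewrite -pzAl mul1r (linfZ (@wmap_linear y)).
exact: (wmap_linear Unit).
Qed.

Lemma eq_Phi3 x x' y y' z z' : wmap x = wmap x' -> wmap y = wmap y' -> wmap z = wmap z' ->
  Phi3 x y z = Phi3 x' y' z'.
Proof. by rewrite /Phi3 /ten3 => -> -> ->. Qed.

Lemma eq_Phi3V x x' y y' z z' : wmap x = wmap x' -> wmap y = wmap y' -> wmap z = wmap z' ->
  Phi3V x y z = Phi3V x' y' z'.
Proof. by rewrite /Phi3V /ten3 => -> -> ->. Qed.

(* The pentagon at two counits leaves [Phi3 Unit y z] alone on one side. *)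
Lemma Phi3_unit1 y z : wf (y ∙ z) -> Phi3 Unit y z = 1.
Proof.
move=> w; have := pentagon (x := Unit) (y := Unit) w.
rewrite (eq_Phi3 (erefl _) (wmap_unitl y) (erefl _)).
rewrite (eq_Phi3 (wmap_unitl Unit) (erefl _) (erefl _)).
rewrite Phi3_unit2; last by move: w; rewrite /wf /= cat_uniq => /andP[].
rewrite mulr1 Phi3_unit2 // mul1r => e.
by rewrite -[LHS]mulr1 -(@mulPhi3V Unit y z) // mulrA e.
Qed.

(** Mirror image of [Phi3_unit1]: the pentagon with counits in its last two legs. *)
Lemma Phi3_unit3 x y : wf (x ∙ y) -> Phi3 x y Unit = 1.
Proof.
move=> w; have := pentagon (x := x) (y := y) (z := Unit) (w := Unit).
have w' : wf (x ∙ (y ∙ Unit)) by move: w; rewrite /wf /= cats0.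
rewrite (eq_Phi3 (erefl _) (wmap_unitr y) (erefl _)).
rewrite (eq_Phi3 (erefl _) (erefl _) (wmap_unitl Unit)).
rewrite [Phi3 y _ _]Phi3_unit2; last by move: w'; rewrite wf_node => /and3P[].
rewrite mul1r [Phi3 (_ ∙ _) _ _]Phi3_unit2; last by move: w; rewrite /wf /= cats0.
rewrite mulr1 => /(_ w') e.
by rewrite -[LHS]mul1r -(@mulVPhi3 x y Unit) // -mulrA e.
Qed.

Lemma Phi3V_unit x y z : wf (x ∙ (y ∙ z)) -> Phi3 x y z = 1 -> Phi3V x y z = 1.
Proof. by move=> w P1; rewrite -(mulPhi3V w) P1 mul1r. Qed.

(** * Contraction of pairs of letters by alpha and beta *)

Section Contraction.
Variables (M : lmodType k) (V : E -> M).

(* [V] plays the role of an expression in which alpha and beta have been inserted: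
   an alpha between the legs [x] and [y] makes [x ∙ y] left equivalent to [Unit],
   a beta makes it right equivalent to [Unit]. *)
Definition lefteq (A : Type) (u u' : A -> E) :=
  forall a C, V (u a * C) = V (u' a * C).
Definition righteq (A : Type) (u u' : A -> E) :=
  forall a C, V (C * u a) = V (C * u' a).

Lemma lefteq_refl A (u : A -> E) : lefteq u u. Proof. by []. Qed.
Lemma righteq_refl A (u : A -> E) : righteq u u. Proof. by []. Qed.

Hypothesis VL : linear V.

(** Only the leftmost factor can be replaced. After [u] has become [u'], it must be moved past [v]
    to let [v] be replaced, and then back past [v']: hence the two commutation hypotheses on
    [u']. *)
Lemma lefteq_ten2 (A B : lmodType k) (u u' : A -> E) (v v' : B -> E) :
  linear u -> linear u' -> linear v -> linear v' ->
  lefteq u u' -> lefteq v v' -> commuting u' v -> commuting u' v' ->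
  lefteq (ten2 u v) (ten2 u' v').
Proof.
move=> uL u'L vL v'L uu vv c c' x C; move: x; apply: tensor_ext => [||a b].
- apply: (comp_linear VL); apply: (comp_linear (mulr_linear C)).
  exact: ten2_linear.
- apply: (comp_linear VL); apply: (comp_linear (mulr_linear C)).
  exact: ten2_linear.
- by rewrite !ten2_pure // -mulrA uu mulrA c -mulrA vv mulrA -c'.
Qed.

Lemma righteq_ten2 (A B : lmodType k) (u u' : A -> E) (v v' : B -> E) :
  linear u -> linear u' -> linear v -> linear v' ->
  righteq u u' -> righteq v v' -> commuting u v' -> commuting u' v' ->
  righteq (ten2 u v) (ten2 u' v').
Proof.
move=> uL u'L vL v'L uu vv c c' x C; move: x; apply: tensor_ext => [||a b].
- apply: (comp_linear VL); apply: (comp_linear (mull_linear C)).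
  exact: ten2_linear.
- apply: (comp_linear VL); apply: (comp_linear (mull_linear C)).
  exact: ten2_linear.
- by rewrite !ten2_pure // mulrA vv -mulrA c mulrA uu -mulrA -c'.
Qed.

Lemma lefteq_node x x' y y' : wdisj x' y && wdisj x' y' ->
  lefteq (wmap x) (wmap x') -> lefteq (wmap y) (wmap y') ->
  lefteq (wmap (x ∙ y)) (wmap (x' ∙ y')).
Proof.
case/andP=> /wmap_comm c /wmap_comm c' xx yy h C.
exact: (lefteq_ten2 _ _ _ _ xx yy).
Qed.

Lemma righteq_node x x' y y' : wdisj x y' && wdisj x' y' ->
  righteq (wmap x) (wmap x') -> righteq (wmap y) (wmap y') ->
  righteq (wmap (x ∙ y)) (wmap (x' ∙ y')).
Proof.
case/andP=> /wmap_comm c /wmap_comm c' xx yy h C.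
exact: (righteq_ten2 _ _ _ _ xx yy).
Qed.

Lemma commuting_ten2_words x y z : wdisj x y && wdisj x z ->
  commuting (wmap x) (ten2 (wmap y) (wmap z)).
Proof. by case/andP=> /wmap_comm c /wmap_comm c'; apply: commuting_ten2r. Qed.

Lemma lefteq_ten3 x x' y y' z z' :
  [&& wdisj x' y && wdisj x' z, wdisj x' y' && wdisj x' z' & wdisj y' z && wdisj y' z'] ->
  lefteq (wmap x) (wmap x') -> lefteq (wmap y) (wmap y') ->
  lefteq (wmap z) (wmap z') -> lefteq (ten3 x y z) (ten3 x' y' z').
Proof.
case/and3P=> c c' /andP[d d'] xx yy zz.
apply: lefteq_ten2 => //; try exact: ten2_linear; try exact: commuting_ten2_words.
by apply: lefteq_ten2 => //; apply: wmap_comm.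
Qed.

Lemma righteq_ten3 x x' y y' z z' :
  [&& wdisj x y' && wdisj x z', wdisj x' y' && wdisj x' z' & wdisj y z' && wdisj y' z'] ->
  righteq (wmap x) (wmap x') -> righteq (wmap y) (wmap y') ->
  righteq (wmap z) (wmap z') -> righteq (ten3 x y z) (ten3 x' y' z').
Proof.
case/and3P=> c c' /andP[d d'] xx yy zz.
apply: righteq_ten2 => //; try exact: ten2_linear; try exact: commuting_ten2_words.
by apply: righteq_ten2 => //; apply: wmap_comm.
Qed.

End Contraction.

(** A prefix [D] commuting with both maps does not shield what follows it: the factor to be replaced
    can be moved to the left end and back. *)
Lemma lefteq_mull (M : lmodType k) (V : E -> M) (A : Type) D (u u' : A -> E) :
  intertwine D u u -> intertwine D u' u' -> lefteq V u u' ->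
  lefteq (fun C : E => V (D * C)) u u'.
Proof. by move=> Du Du' uu a C; rewrite !mulrA Du Du' -!mulrA uu. Qed.

Lemma righteq_mulr (M : lmodType k) (V : E -> M) (A : Type) D (u u' : A -> E) :
  intertwine D u u -> intertwine D u' u' -> righteq V u u' ->
  righteq (fun C : E => V (C * D)) u u'.
Proof. by move=> Du Du' uu a C; rewrite -!mulrA -Du -Du' !mulrA uu. Qed.

Lemma mulrK_inv (x y yi : E) : mutual_inverse y yi -> x * y * yi = x.
Proof. by move=> [yy _]; rewrite -mulrA yy mulr1. Qed.

Lemma mulKr_inv (x y yi : E) : mutual_inverse y yi -> yi * (y * x) = x.
Proof. by move=> [_ yy]; rewrite mulrA yy mul1r. Qed.

(** * The pentagon solved for some of its factors *)

Section PentagonForms.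
Variables (x y z w : word).
Hypothesis wxyzw : wf (x ∙ (y ∙ (z ∙ w))).

Let disj : [&& wf x, wf y, wf z & wf w] &&
  [&& wdisj x y, wdisj x z, wdisj x w, wdisj y z, wdisj y w & wdisj z w].
Proof.
move: wxyzw; rewrite !wf_node !wdisjr.
case/and3P=> -> /and3P[-> /and3P[-> -> ->] /andP[-> ->]].
by case/and3P=> -> -> ->.
Qed.

Let wf5 : [/\ wf (y ∙ (z ∙ w)), wf (x ∙ (y ∙ z ∙ w)), wf (x ∙ (y ∙ z)),
  wf (x ∙ (y ∙ (z ∙ w))) & wf (x ∙ y ∙ (z ∙ w))].
Proof.
move: disj; rewrite !wf_node !wdisjr !wdisjl.
case/andP=> /and4P[-> -> -> ->] /and5P[-> -> -> -> /andP[-> ->]].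
by split.
Qed.

Let iX : mutual_inverse (Phi3 y z w) (Phi3V y z w). Proof. by case: wf5 => /Phi3_inv. Qed.
Let iY : mutual_inverse (Phi3 x (y ∙ z) w) (Phi3V x (y ∙ z) w).
Proof. by case: wf5 => _ /Phi3_inv. Qed.
Let iZ : mutual_inverse (Phi3 x y z) (Phi3V x y z). Proof. by case: wf5 => _ _ /Phi3_inv. Qed.
Let iW : mutual_inverse (Phi3 x y (z ∙ w)) (Phi3V x y (z ∙ w)).
Proof. by case: wf5 => _ _ _ /Phi3_inv. Qed.
Let iT : mutual_inverse (Phi3 (x ∙ y) z w) (Phi3V (x ∙ y) z w).
Proof. by case: wf5 => _ _ _ _ /Phi3_inv. Qed.
Let e := pentagon wxyzw.

(** Write the pentagon as X Y Z = W T, with X = [Phi3 y z w], Y = [Phi3 x (y ∙ z) w], Z =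
    [Phi3 x y z], W = [Phi3 x y (z ∙ w)] and T = [Phi3 (x ∙ y) z w]. The letters in the name of each
    form list the factors on its left-hand side, up to inversion. *)
Lemma pentagon_WTZ : Phi3 x y (z ∙ w) * Phi3 (x ∙ y) z w * Phi3V x y z = Phi3 y z w * Phi3 x (y ∙ z) w.
Proof. by rewrite -e; apply: mulrK_inv. Qed.

Lemma pentagon_TZ : Phi3 (x ∙ y) z w * Phi3V x y z = Phi3V x y (z ∙ w) * (Phi3 y z w * Phi3 x (y ∙ z) w).
Proof. by rewrite -pentagon_WTZ -mulrA mulKr_inv. Qed.

Lemma pentagon_YZT : Phi3 x (y ∙ z) w * Phi3 x y z * Phi3V (x ∙ y) z w = Phi3V y z w * Phi3 x y (z ∙ w).
Proof.
rewrite -[Phi3 x y (z ∙ w)](mulrK_inv _ iT) -e -[Phi3 x (y ∙ z) w * _](mulKr_inv _ iX).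
by rewrite !mulrA.
Qed.

Lemma pentagon_ZT : Phi3 x y z * Phi3V (x ∙ y) z w = Phi3V x (y ∙ z) w * (Phi3V y z w * Phi3 x y (z ∙ w)).
Proof. by rewrite -pentagon_YZT -mulrA mulKr_inv. Qed.

Lemma pentagon_TWX : Phi3V (x ∙ y) z w * Phi3V x y (z ∙ w) * Phi3 y z w = Phi3V x y z * Phi3V x (y ∙ z) w.
Proof.
rewrite -[Phi3 y z w](mulrK_inv _ iY) -[Phi3 y z w * _](mulrK_inv _ iZ) e.
by rewrite !mulrA -(mulrA (Phi3V (x ∙ y) z w)) (proj2 iW) mulr1 (proj2 iT) mul1r.
Qed.

Lemma pentagon_WX : Phi3V x y (z ∙ w) * Phi3 y z w = Phi3 (x ∙ y) z w * (Phi3V x y z * Phi3V x (y ∙ z) w).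
Proof. by rewrite -pentagon_TWX !mulrA (proj1 iT) mul1r. Qed.

End PentagonForms.

Lemma intertwineM (A : Type) (g g' : E) (u : A -> E) :
  intertwine g u u -> intertwine g' u u -> intertwine (g * g') u u.
Proof. by move=> gu gu' a; rewrite -mulrA gu' !mulrA gu. Qed.

(** * Zigzag identities for two nested antipodes *)

Section Zigzag.
Local Notation a := (Letter 0).
Local Notation b := (Letter 1).
Local Notation c := (Letter 2).
Local Notation d := (Letter 3).
Local Notation e := (Letter 4).
Local Notation f := (Letter 5).

Ltac intertwine_tac := solve [ repeat first
  [ by apply: ten3_comm | by apply: Phi3_intertwine | by apply: Phi3V_intertwine
  | apply: intertwine_ten3 | apply: intertwine_node | apply: intertwineM ] ].

(* Both sides rebracket ((a(bc))d)(ef) into (ab)((c(de))f). The right-hand side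
   treats (de) as one letter in its left half and (bc) as one letter in its right
   half, so that contracting them leaves two pentagons. *)
Lemma zig_factor :
  Phi3 c d e * Phi3V (c ∙ d) e f * Phi3 (a ∙ b) (c ∙ d) (e ∙ f) * (Phi3 (a ∙ b) c d * Phi3V a b c)
  = Phi3V c (d ∙ e) f * Phi3 (a ∙ b) c (d ∙ e ∙ f) * Phi3V a b c * (Phi3V d e f
    * Phi3 (a ∙ (b ∙ c)) d (e ∙ f)).
Proof.
have nabc : Phi3V a b c * Phi3 (a ∙ (b ∙ c)) d (e ∙ f) = Phi3 (a ∙ b ∙ c) d (e ∙ f) * Phi3V a b c.
  by apply: intertwine_ten3; intertwine_tac.
have ndef : Phi3V d e f * Phi3 (a ∙ b) c (d ∙ (e ∙ f)) = Phi3 (a ∙ b) c (d ∙ e ∙ f) * Phi3V d e f.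
  by apply: intertwine_ten3; intertwine_tac.
have comm : Phi3V d e f * Phi3V a b c = Phi3V a b c * Phi3V d e f.
  by apply: intertwine_ten3; intertwine_tac.
rewrite pentagon_ZT // !mulrA -(mulrA (Phi3V c _ f * _)) -(mulrA (Phi3V c _ f * _)).
rewrite [_ * Phi3 (a ∙ b) c d]pentagon // !mulrA -(mulrA (Phi3V c _ f)) ndef.
by rewrite -[_ * Phi3V a b c in LHS]mulrA -nabc !mulrA -[_ * Phi3V d e f * Phi3V a b c]mulrA comm !mulrA.
Qed.

Variables (M : lmodType k) (V : E -> M).
Hypothesis VL : linear V.

Let VL_mull (D : E) : linear (fun C : E => V (D * C)).
Proof. by apply: (comp_linear VL); apply: mull_linear. Qed.
Let VL_mulr (D : E) : linear (fun C : E => V (C * D)).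
Proof. by apply: (comp_linear VL); apply: mulr_linear. Qed.
Hint Resolve VL VL_mull VL_mulr lefteq_refl righteq_refl : core.

Ltac contract_tac := solve [ repeat first
  [ done | apply: lefteq_ten3 => // | apply: righteq_ten3 => //
  | apply: lefteq_node => // | apply: righteq_node => //
  | by apply: lefteq_mull => //; intertwine_tac
  | by apply: righteq_mulr => //; intertwine_tac ] ].

(** The four contractions link the six letters into two strings, [a d e] and [b c f], one for each
    antipode. Everything in [zig_factor] collapses except the reassociator of each string, which is
    what the zigzag axiom of that antipode evaluates. *)
Lemma zig_contract : lefteq V (wmap (d ∙ e)) (wmap Unit) ->
  lefteq V (wmap (c ∙ f)) (wmap Unit) ->
  righteq V (wmap (b ∙ c)) (wmap Unit) -> righteq V (wmap (a ∙ d)) (wmap Unit) ->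
  V (Phi3 c d e * Phi3V (c ∙ d) e f * Phi3 (a ∙ b) (c ∙ d) (e ∙ f) * (Phi3 (a ∙ b) c d * Phi3V a b c))
  = V (Phi3 b c f * Phi3 a d e).
Proof.
move=> de cf bc ad; rewrite zig_factor -!mulrA.
transitivity (V (Phi3V c Unit f * (Phi3 (a ∙ b) c (d ∙ e ∙ f) *
    (Phi3V a b c * (Phi3V d e f * Phi3 (a ∙ (b ∙ c)) d (e ∙ f)))))).
  have : lefteq V (ten3 c (d ∙ e) f) (ten3 c Unit f) by contract_tac.
  by apply.
rewrite Phi3V_unit ?Phi3_unit2 // mul1r.
transitivity (V (Phi3 (a ∙ b) c (Unit ∙ f) *
    (Phi3V a b c * (Phi3V d e f * Phi3 (a ∙ (b ∙ c)) d (e ∙ f))))).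
  have : lefteq V (ten3 (a ∙ b) c (d ∙ e ∙ f)) (ten3 (a ∙ b) c (Unit ∙ f)) by contract_tac.
  by apply.
rewrite !mulrA.
transitivity (V (Phi3 (a ∙ b) c (Unit ∙ f) * Phi3V a b c * Phi3V d e f *
     Phi3 (a ∙ Unit) d (e ∙ f))).
  have : righteq V (ten3 (a ∙ (b ∙ c)) d (e ∙ f)) (ten3 (a ∙ Unit) d (e ∙ f)) by contract_tac.
  by apply.
rewrite (eq_Phi3 (erefl _) (erefl _) (wmap_unitl f)) (eq_Phi3 (wmap_unitr a) (erefl _) (erefl _)).
(* One pentagon on [a b c f] and one on [a d e f]. They bring [c ∙ f] to the left end and [a ∙ d] to
   the right end, where alpha and beta remove them. *)
rewrite pentagon_TZ // -!mulrA -pentagon_YZT //.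
transitivity (V (Phi3V a b Unit * (Phi3 b c f * (Phi3 a (b ∙ c) f * (Phi3 a (d ∙ e) f * Phi3 a d e * Phi3V (a ∙ d) e f))))).
  have : lefteq V (ten3 a b (c ∙ f)) (ten3 a b Unit) by contract_tac.
  by apply.
rewrite Phi3V_unit ?Phi3_unit3 // mul1r !mulrA.
transitivity (V (Phi3 b c f * Phi3 a (b ∙ c) f * Phi3 a (d ∙ e) f * Phi3 a d e * Phi3V Unit e f)).
  have : righteq V (ten3 (a ∙ d) e f) (ten3 Unit e f) by contract_tac.
  by apply.
rewrite Phi3V_unit ?Phi3_unit1 // mulr1 -mulrA.
(* The prefix contains only the letters [a b c f], so it commutes with [d ∙ e], and alpha acts
   through it. The same holds below for beta, [b ∙ c] and the suffix in [a d e]. *)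
transitivity (V (Phi3 b c f * Phi3 a (b ∙ c) f * (Phi3 a Unit f * Phi3 a d e))).
  have : lefteq (fun C : E => V (Phi3 b c f * Phi3 a (b ∙ c) f * C)) (ten3 a (d ∙ e) f) (ten3 a Unit f) by contract_tac.
  by apply.
rewrite Phi3_unit2 // mul1r.
transitivity (V (Phi3 b c f * Phi3 a Unit f * Phi3 a d e)).
  have : righteq (fun C : E => V (C * Phi3 a d e)) (ten3 a (b ∙ c) f) (ten3 a Unit f) by contract_tac.
  by apply.
by rewrite Phi3_unit2 // mulr1.
Qed.

(** Both sides of [zig_factor] inverted, compared by uniqueness of inverses. *)
Lemma zag_factor :
  Phi3 a b c * Phi3V (a ∙ b) c d * Phi3V (a ∙ b) (c ∙ d) (e ∙ f) * (Phi3 (c ∙ d) e f * Phi3V c d e)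
  = Phi3V (a ∙ (b ∙ c)) d (e ∙ f) * Phi3 d e f
    * (Phi3 a b c * (Phi3V (a ∙ b) c (d ∙ e ∙ f) * Phi3 c (d ∙ e) f)).
Proof.
have i x y z (w : wf (x ∙ (y ∙ z))) := Phi3_inv w.
have i' x y z (w : wf (x ∙ (y ∙ z))) := mutual_inverse_sym (Phi3_inv w).
have := mutual_inverseM (mutual_inverseM (mutual_inverseM (i c d e isT)
  (i' (c ∙ d) e f isT)) (i (a ∙ b) (c ∙ d) (e ∙ f) isT))
  (mutual_inverseM (i (a ∙ b) c d isT) (i' a b c isT)).
rewrite zig_factor => /inv_unique iC.
have := mutual_inverseM (mutual_inverseM (mutual_inverseM (i' c (d ∙ e) f isT)
  (i (a ∙ b) c (d ∙ e ∙ f) isT)) (i' a b c isT))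
  (mutual_inverseM (i' d e f isT) (i (a ∙ (b ∙ c)) d (e ∙ f) isT)).
by move/inv_unique; rewrite iC !mulrA.
Qed.

(** Alpha and beta exchange their pairs with respect to [zig_contract]; the strings are again
    [a d e] and [b c f], now with inverse reassociators. *)
Lemma zag_contract : lefteq V (wmap (b ∙ c)) (wmap Unit) ->
  lefteq V (wmap (a ∙ d)) (wmap Unit) ->
  righteq V (wmap (d ∙ e)) (wmap Unit) -> righteq V (wmap (c ∙ f)) (wmap Unit) ->
  V (Phi3 a b c * Phi3V (a ∙ b) c d * Phi3V (a ∙ b) (c ∙ d) (e ∙ f) * (Phi3 (c ∙ d) e f * Phi3V c d e))
  = V (Phi3V a d e * Phi3V b c f).
Proof.
move=> bc ad de cf; rewrite zag_factor -!mulrA.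
transitivity (V (Phi3V (a ∙ Unit) d (e ∙ f) * (Phi3 d e f
    * (Phi3 a b c * (Phi3V (a ∙ b) c (d ∙ e ∙ f) * Phi3 c (d ∙ e) f))))).
  have : lefteq V (ten3 (a ∙ (b ∙ c)) d (e ∙ f)) (ten3 (a ∙ Unit) d (e ∙ f)) by contract_tac.
  by apply.
rewrite !mulrA.
transitivity (V (Phi3V (a ∙ Unit) d (e ∙ f) * Phi3 d e f
    * Phi3 a b c * Phi3V (a ∙ b) c (d ∙ e ∙ f) * Phi3 c Unit f)).
  have : righteq V (ten3 c (d ∙ e) f) (ten3 c Unit f) by contract_tac.
  by apply.
rewrite Phi3_unit2 // mulr1.
transitivity (V (Phi3V (a ∙ Unit) d (e ∙ f) * Phi3 d e f
    * Phi3 a b c * Phi3V (a ∙ b) c (Unit ∙ f))).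
  have : righteq V (ten3 (a ∙ b) c (d ∙ e ∙ f)) (ten3 (a ∙ b) c (Unit ∙ f)) by contract_tac.
  by apply.
rewrite (eq_Phi3V (erefl _) (erefl _) (wmap_unitl f)) (eq_Phi3V (wmap_unitr a) (erefl _) (erefl _)).
rewrite pentagon_WX // -!mulrA pentagon_ZT //.
transitivity (V (Phi3 Unit e f * (Phi3V a d e * (Phi3V a (d ∙ e) f * (Phi3V a (b ∙ c) f
    * (Phi3V b c f * Phi3 a b (c ∙ f))))))).
  have : lefteq V (ten3 (a ∙ d) e f) (ten3 Unit e f) by contract_tac.
  by apply.
rewrite Phi3_unit1 // mul1r !mulrA.
transitivity (V (Phi3V a d e * Phi3V a (d ∙ e) f * Phi3V a (b ∙ c) f * Phi3V b c f * Phi3 a b Unit)).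
  have : righteq V (ten3 a b (c ∙ f)) (ten3 a b Unit) by contract_tac.
  by apply.
rewrite Phi3_unit3 // mulr1 -mulrA.
transitivity (V (Phi3V a d e * Phi3V a Unit f * (Phi3V a (b ∙ c) f * Phi3V b c f))).
  have : righteq (fun C : E => V (C * (Phi3V a (b ∙ c) f * Phi3V b c f)))
    (ten3 a (d ∙ e) f) (ten3 a Unit f) by contract_tac.
  by apply.
rewrite [Phi3V a Unit f]Phi3V_unit ?Phi3_unit2 // mulr1.
transitivity (V (Phi3V a d e * (Phi3V a Unit f * Phi3V b c f))).
  have : lefteq (fun C : E => V (Phi3V a d e * C)) (ten3 a (b ∙ c) f) (ten3 a Unit f) by contract_tac.
  by apply.
by rewrite [Phi3V a Unit f]Phi3V_unit ?Phi3_unit2 // mul1r.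
Qed.

(* Both sides rebracket (a(bc))((de)f) into (a((b(cd))e))f; on the left, (cd) is
   one letter in the first three factors. *)
Lemma assoc_factor :
  Phi3 a (b ∙ (c ∙ d)) e * Phi3 a b (c ∙ d) * Phi3V (a ∙ b ∙ (c ∙ d)) e f
    * (Phi3 (a ∙ b) c d * Phi3V (a ∙ b ∙ c) d (e ∙ f)) * (Phi3V a b c * Phi3 d e f)
  = Phi3 b c d * Phi3V (b ∙ c) d e * (Phi3 a (b ∙ c) (d ∙ e) * Phi3V (a ∙ (b ∙ c)) (d ∙ e) f).
Proof.
have n1 : Phi3V a b c * Phi3V (a ∙ (b ∙ c)) d (e ∙ f) = Phi3V (a ∙ b ∙ c) d (e ∙ f) * Phi3V a b c.
  by apply: intertwine_ten3; intertwine_tac.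
have n2 : Phi3 (a ∙ b) c d * Phi3V (a ∙ b ∙ c ∙ d) e f
    = Phi3V (a ∙ b ∙ (c ∙ d)) e f * Phi3 (a ∙ b) c d.
  by apply: intertwine_ten3; intertwine_tac.
have n3 : Phi3V a b c * Phi3V (a ∙ (b ∙ c) ∙ d) e f = Phi3V (a ∙ b ∙ c ∙ d) e f * Phi3V a b c.
  by apply: intertwine_ten3; intertwine_tac.
have n4 : Phi3 b c d * Phi3 a (b ∙ c ∙ d) e = Phi3 a (b ∙ (c ∙ d)) e * Phi3 b c d.
  by apply: intertwine_ten3; intertwine_tac.
transitivity (Phi3 a (b ∙ (c ∙ d)) e * (Phi3 a b (c ∙ d) * Phi3 (a ∙ b) c d * Phi3V a b c)
   * (Phi3V (a ∙ (b ∙ c) ∙ d) e f * Phi3V (a ∙ (b ∙ c)) d (e ∙ f) * Phi3 d e f)).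
  rewrite !mulrA -2![_ * Phi3V _ d (e ∙ f) * _]mulrA -n1 !mulrA.
  rewrite -[_ * Phi3V _ e f * Phi3 _ c d]mulrA -n2 !mulrA.
  by rewrite -[_ * Phi3V _ e f * Phi3V a b c]mulrA -n3 !mulrA.
rewrite pentagon_WTZ // pentagon_TWX // !mulrA -n4.
by rewrite -!mulrA [Phi3 a (b ∙ c ∙ d) e * _]mulrA [Phi3 a (b ∙ c ∙ d) e * _ * _]mulrA pentagon_YZT // !mulrA.
Qed.

(** Removing [c ∙ d] from the left-hand side of [assoc_factor] leaves the pattern of [drinfeld_A] on
    the outer letters [a b e f]. The two sides then describe the alpha of a triple product in its
    two bracketings; the last two factors are the reassociators that relate them. *)
Lemma assoc_contract : lefteq V (wmap (c ∙ d)) (wmap Unit) ->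
  V (Phi3 a b e * Phi3V (a ∙ b) e f * (Phi3 (a ∙ b) c d * Phi3V (a ∙ b ∙ c) d (e ∙ f))
     * (Phi3V a b c * Phi3 d e f))
  = V (Phi3 b c d * Phi3V (b ∙ c) d e * (Phi3 a (b ∙ c) (d ∙ e) * Phi3V (a ∙ (b ∙ c)) (d ∙ e) f)).
Proof.
move=> cd; rewrite -assoc_factor -!mulrA.
set X := Phi3 (a ∙ b) c d * _.
transitivity (V (Phi3 a (b ∙ Unit) e * (Phi3 a b (c ∙ d) * (Phi3V (a ∙ b ∙ (c ∙ d)) e f * X)))); last first.
  have : lefteq V (ten3 a (b ∙ (c ∙ d)) e) (ten3 a (b ∙ Unit) e) by contract_tac.
  by move=> ->.
rewrite (eq_Phi3 (erefl _) (wmap_unitr b) (erefl _)).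
transitivity (V (Phi3 a b e * (Phi3 a b Unit * (Phi3V (a ∙ b ∙ (c ∙ d)) e f * X)))); last first.
  have : lefteq (fun C : E => V (Phi3 a b e * C)) (ten3 a b (c ∙ d)) (ten3 a b Unit) by contract_tac.
  by move=> ->.
rewrite Phi3_unit3 // mul1r.
transitivity (V (Phi3 a b e * (Phi3V (a ∙ b ∙ Unit) e f * X))); last first.
  have : lefteq (fun C : E => V (Phi3 a b e * C)) (ten3 (a ∙ b ∙ (c ∙ d)) e f)
    (ten3 (a ∙ b ∙ Unit) e f) by contract_tac.
  by move=> ->.
by rewrite (eq_Phi3V (wmap_unitr (a ∙ b)) (erefl _) (erefl _)).
Qed.
End Zigzag.

End Words.

(** * Insertion of alpha and beta *)

Section Linearity.
Variables (k : fieldType) (N : pzAlgType k).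
Implicit Types A B C D : lmodType k.

Lemma linear_mull A (u : A -> N) (c : N) : linear u -> linear (fun x => c * u x).
Proof. by move=> uL; apply: (comp_linear (mull_linear c)). Qed.

Lemma linear_mulr A (u : A -> N) (c : N) : linear u -> linear (fun x => u x * c).
Proof. by move=> uL; apply: (comp_linear (mulr_linear c)). Qed.

Lemma linear_tlift A B D C (phi : A -> B -> D -> C) y :
  (forall b d, linear (fun a => phi a b d)) -> linear (fun a => tlift (phi a) y).
Proof. by move=> phiL c a a'; apply: tlift_lin_phi => b d; apply: phiL. Qed.

Definition fromop (x : N^c) : N := x.
Lemma fromop_linear : linear fromop. Proof. by []. Qed.
Lemma fromopM x y : fromop (x * y) = fromop y * fromop x. Proof. by []. Qed.
Lemma fromop1 : fromop 1 = 1. Proof. by []. Qed.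
Lemma toopK x : fromop (toop x) = x. Proof. by []. Qed.
End Linearity.

Ltac linear_tac := repeat first
  [ assumption | exact: id_linear | exact: fromop_linear | exact: toop_linear
  | apply: linear_mulr | apply: linear_mull
  | apply: linear_tlift => ? ? /= ].
Ltac bilin_tac := split=> ? /=; linear_tac.

Section Sandwich.
Variables (k : fieldType) (N : pzAlgType k).

(* A tensor [x ⊗ y ⊗ z ⊗ w] encodes the product [x r y s z t w] in N. Antipodes
   take their values in [x] and [z], which therefore live in the opposite
   algebra. *)
Definition quad_alg : pzAlgType k := (N^c ⊗ N ⊗ N^c ⊗ N)%type.
Definition quad (x : N^c) (y : N) (z : N^c) (w : N) : quad_alg := x ⊗ y ⊗ z ⊗ w.

Lemma quadM x y z w x' y' z' w' :
  quad x y z w * quad x' y' z' w' = quad (x * x') (y * y') (z * z') (w * w').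
Proof. by rewrite /quad !pureM. Qed.

Lemma quad_ext (D : lmodType k) (f g : quad_alg -> D) : linear f -> linear g ->
  (forall x y z w, f (quad x y z w) = g (quad x y z w)) -> f =1 g.
Proof. exact: linear_tensor_ext4. Qed.

Definition sand_zw (u t : N) (z : N^c) (w : N) : N := u * fromop z * t * w.
Definition sand_y (u s t : N) (y : N) : N^c ⊗ N -> N := tlift (sand_zw (u * y * s) t).
Definition sand_x (r s t : N) (x : N^c) : N ⊗ N^c ⊗ N -> N :=
  tlift (sand_y (fromop x * r) s t).
Definition sandwich (r s t : N) : quad_alg -> N := tlift (sand_x r s t).

Definition sand_xy (r : N) (x : N^c) (y : N) : N := fromop x * r * y.
Definition sand_yz (s : N) (y : N) (z : N^c) : N := y * s * fromop z.
Definition sandwich2 (r : N) : N^c ⊗ N -> N := tlift (sand_xy r).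
Definition sandwich2' (s : N) : N ⊗ N^c -> N := tlift (sand_yz s).

Lemma sand_xy_bilin r : bilin (sand_xy r).
Proof. by rewrite /sand_xy; bilin_tac. Qed.
Lemma sand_yz_bilin r : bilin (sand_yz r).
Proof. by rewrite /sand_yz; bilin_tac. Qed.
Lemma sand_zw_bilin u t : bilin (sand_zw u t).
Proof. by rewrite /sand_zw; bilin_tac. Qed.
Lemma sand_y_bilin u s t : bilin (sand_y u s t).
Proof.
split=> ? /=; last exact/tlift_linear/sand_zw_bilin.
by rewrite /sand_y /sand_zw; linear_tac.
Qed.
Lemma sand_x_bilin r s t : bilin (sand_x r s t).
Proof.
split=> ? /=; last exact/tlift_linear/sand_y_bilin.
by rewrite /sand_x /sand_y /sand_zw; linear_tac.
Qed.
Hint Resolve sand_xy_bilin sand_yz_bilin sand_zw_bilin sand_y_bilin sand_x_bilin : core.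

Lemma sandwich2_linear r : linear (sandwich2 r).
Proof. exact/tlift_linear. Qed.
Lemma sandwich2'_linear r : linear (sandwich2' r).
Proof. exact/tlift_linear. Qed.
Lemma sandwich_linear r s t : linear (sandwich r s t).
Proof. exact/tlift_linear. Qed.
Lemma sandwich2_pure r x y : sandwich2 r (x ⊗ y) = fromop x * r * y.
Proof. by rewrite /sandwich2 tlift_pure. Qed.
Lemma sandwich2'_pure r x y : sandwich2' r (x ⊗ y) = x * r * fromop y.
Proof. by rewrite /sandwich2' tlift_pure. Qed.
Lemma sandwich_pure r s t x y z w :
  sandwich r s t (quad x y z w) = fromop x * r * y * s * fromop z * t * w.
Proof. by rewrite /sandwich /quad tlift_pure // /sand_x tlift_pure // /sand_y tlift_pure. Qed.

Lemma sandwich_linear1 s t C : linear (fun r => sandwich r s t C).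
Proof.
apply: linear_tlift => x b /=; apply: linear_tlift => y d /=.
by rewrite /sand_y /sand_zw; linear_tac.
Qed.

Lemma sandwich_linear2 r t C : linear (fun s => sandwich r s t C).
Proof.
apply: linear_tlift => x b /=; apply: linear_tlift => y d /=.
by rewrite /sand_y /sand_zw; linear_tac.
Qed.

Lemma sandwich_linear3 r s C : linear (fun t => sandwich r s t C).
Proof.
apply: linear_tlift => x b /=; apply: linear_tlift => y d /=.
by rewrite /sand_y /sand_zw; linear_tac.
Qed.

Definition slot1 (x : N^c) : quad_alg := quad x 1 1 1.
Definition slot2 (y : N) : quad_alg := quad 1 y 1 1.
Definition slot3 (z : N^c) : quad_alg := quad 1 1 z 1.
Definition slot4 (w : N) : quad_alg := quad 1 1 1 w.

Lemma slot1_algebra_map : algebra_map slot1.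
Proof. exact: pure1r_algebra_map. Qed.
Lemma slot2_algebra_map : algebra_map slot2.
Proof. exact: (comp_algebra_map (pure1l_algebra_map _ _) (pure1r_algebra_map _ _)). Qed.
Lemma slot3_algebra_map : algebra_map slot3.
Proof.
exact: (comp_algebra_map (pure1l_algebra_map _ _)
  (comp_algebra_map (pure1l_algebra_map _ _) (pure1r_algebra_map _ _))).
Qed.
Lemma slot4_algebra_map : algebra_map slot4.
Proof.
exact: (comp_algebra_map (pure1l_algebra_map _ _)
  (comp_algebra_map (pure1l_algebra_map _ _) (pure1l_algebra_map _ _))).
Qed.

Lemma slot1_linear : linear slot1. Proof. by case: slot1_algebra_map. Qed.
Lemma slot2_linear : linear slot2. Proof. by case: slot2_algebra_map. Qed.
Lemma slot3_linear : linear slot3. Proof. by case: slot3_algebra_map. Qed.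
Lemma slot4_linear : linear slot4. Proof. by case: slot4_algebra_map. Qed.
Hint Resolve slot1_linear slot2_linear slot3_linear slot4_linear sandwich_linear
  sandwich2_linear sandwich2'_linear : core.

(** Slots 1 and 3 multiply in reverse, so in a product the left factor lands next to [r] and [t] and
    the right factor next to [s]. This is why caps are absorbed from the left, here and in
    [absorb34], and cups from the right, in [absorb23]. *)
Lemma absorb12 r s t X C :
  sandwich r s t (ten2 slot1 slot2 X * C) = sandwich (sandwich2 r X) s t C.
Proof.
move: X; apply: tensor_ext => [||x y].
- apply: (comp_linear (sandwich_linear r s t)); apply: linear_mulr.
  exact: ten2_linear.
- exact: (comp_linear (sandwich_linear1 s t C)).
move: C; apply: quad_ext => // [|x' y' z' w'].
  by apply: (comp_linear (sandwich_linear r s t)); apply: mull_linear.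
rewrite ten2_pure // !quadM !sandwich_pure sandwich2_pure.
by rewrite !mulr1 !mul1r fromopM !mulrA.
Qed.

Lemma absorb34 r s t X C :
  sandwich r s t (ten2 slot3 slot4 X * C) = sandwich r s (sandwich2 t X) C.
Proof.
move: X; apply: tensor_ext => [||x y].
- apply: (comp_linear (sandwich_linear r s t)); apply: linear_mulr.
  exact: ten2_linear.
- exact: (comp_linear (sandwich_linear3 r s C)).
move: C; apply: quad_ext => // [|x' y' z' w'].
  by apply: (comp_linear (sandwich_linear r s t)); apply: mull_linear.
rewrite ten2_pure // !quadM !sandwich_pure sandwich2_pure.
by rewrite !mulr1 !mul1r fromopM !mulrA.
Qed.

Lemma absorb23 r s t X C :
  sandwich r s t (C * ten2 slot2 slot3 X) = sandwich r (sandwich2' s X) t C.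
Proof.
move: X; apply: tensor_ext => [||x y].
- apply: (comp_linear (sandwich_linear r s t)); apply: linear_mull.
  exact: ten2_linear.
- exact: (comp_linear (sandwich_linear2 r t C)).
move: C; apply: quad_ext => // [|x' y' z' w'].
  by apply: (comp_linear (sandwich_linear r s t)); apply: mulr_linear.
rewrite ten2_pure // !quadM !sandwich_pure sandwich2'_pure.
by rewrite !mulr1 !mul1r fromopM !mulrA.
Qed.

End Sandwich.

(** * Uniqueness of antipodes *)

Section SandwichSums.
Variables (k : fieldType) (N : pzAlgType k) (A B C : lmodType k).
Variables (p : A -> N) (q : B -> N) (u : C -> N).
Hypotheses (pL : linear p) (qL : linear q) (uL : linear u).

Definition sand2 r : A ⊗ B -> N := tlift (fun a b => p a * r * q b).
Definition sand3 r s : A ⊗ B ⊗ C -> N :=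
  tlift (fun a => tlift (fun b c => p a * r * q b * s * u c)).

Let bilin2 r : bilin (fun a b => p a * r * q b).
Proof. by bilin_tac. Qed.
Let bilin_in v s : bilin (fun b c => v * q b * s * u c).
Proof. by bilin_tac. Qed.
Let bilin3 r s : bilin (fun a => tlift (fun b c => p a * r * q b * s * u c)).
Proof. by split=> ? /=; [linear_tac | apply: tlift_linear]. Qed.

Lemma sand2_linear r : linear (sand2 r). Proof. exact/tlift_linear. Qed.
Lemma sand3_linear r s : linear (sand3 r s). Proof. exact/tlift_linear. Qed.
Lemma sand2_pure r a b : sand2 r (a ⊗ b) = p a * r * q b.
Proof. by rewrite /sand2 tlift_pure. Qed.
Lemma sand3_pure r s a b c : sand3 r s (a ⊗ b ⊗ c) = p a * r * q b * s * u c.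
Proof. by rewrite /sand3 !tlift_pure. Qed.

End SandwichSums.

Section SandwichTheory.
Variables (k : fieldType) (N : pzAlgType k) (A B C : lmodType k).

Lemma sandwich2_tmap (p : A -> N) (q : B -> N) r X : linear p -> linear q ->
  sandwich2 r (tmap (fun a => toop (p a)) q X) = sand2 p q r X.
Proof.
move=> pL qL; have pL' : linear (fun a => toop (p a)) by [].
move: X; apply: tensor_ext => [||a b].
- by apply: (comp_linear (sandwich2_linear r)); apply: tmap_linear.
- exact: sand2_linear.
- by rewrite tmap_pure // sandwich2_pure sand2_pure.
Qed.

Lemma sandwich2'_tmap (p : A -> N) (q : B -> N) r X : linear p -> linear q ->
  sandwich2' r (tmap p (fun a => toop (q a)) X) = sand2 p q r X.
Proof.
move=> pL qL; have qL' : linear (fun a => toop (q a)) by [].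
move: X; apply: tensor_ext => [||a b].
- by apply: (comp_linear (sandwich2'_linear r)); apply: tmap_linear.
- exact: sand2_linear.
- by rewrite tmap_pure // sandwich2'_pure sand2_pure.
Qed.

Lemma sand3_mull (p p' : A -> N) (q : B -> N) (u : C -> N) x r s X :
  linear p -> linear p' -> linear q -> linear u -> (forall a, x * p a = p' a * x) ->
  x * sand3 p q u r s X = sand3 p' q u (x * r) s X.
Proof.
move=> pL p'L qL uL xp; move: X; apply: linear_tensor_ext3 => [||a b c].
- by apply: linear_mull; apply: sand3_linear.
- exact: sand3_linear.
- by rewrite !sand3_pure // !mulrA xp.
Qed.
End SandwichTheory.

Section Antipodal.
Variables (k : fieldType) (H : pzAlgType k) (Q : quasi_bialgebra H).
Local Notation D := (comul Q).
Local Notation eps := (counit Q).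
Local Notation Phi := (reass Q).

(* [g], [r], [s] are the antipode, alpha and beta along the map [f]. *)
Record antipodal (N : pzAlgType k) (f g : H -> N) (r s : N) : Prop := Antipodal {
  antipodal_map : algebra_map f;
  antipodal_antimap : algebra_antimap g;
  antipodal_cap : forall h, sand2 g f r (D h) = eps h *: r;
  antipodal_cup : forall h, sand2 f g s (D h) = eps h *: s;
  antipodal_zig : sand3 f g f s r Phi = 1;
  antipodal_zag : sand3 g f g r s (inv Phi) = 1
}.

Section SlotLetters.
Variables (N : pzAlgType k).

Definition unit_letter (E : pzAlgType k) : H -> E := fun h => eps h *: (1 : E).

Lemma unit_letter_algebra_map (E : pzAlgType k) : algebra_map (@unit_letter E).
Proof.
have [eL [e1 eM]] := counit_algebra_map Q; split=> [c x y|].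
  by rewrite /unit_letter eL scalerDl scalerA.
split=> [|x y]; first by rewrite /unit_letter e1 scale1r.
by rewrite /unit_letter eM -pzAl -pzAr mul1r scalerA.
Qed.

Lemma commuting_unit_letter (A : Type) (E : pzAlgType k) (u : A -> E) :
  commuting (@unit_letter E) u.
Proof. by move=> a b; rewrite /unit_letter -pzAl -pzAr mul1r mulr1. Qed.

(** The antipode axiom in the form that contraction uses: the pair of letters is left equivalent to
    [Unit]. *)
Lemma cap12 (p q : H -> N) r s t C h : linear p -> linear q ->
  (forall h, sand2 p q r (D h) = eps h *: r) ->
  sandwich r s t (ten2 (fun a => slot1 (toop (p a))) (fun a => slot2 (q a)) (D h) * C)
  = sandwich r s t (eps h *: (1 : quad_alg N) * C).
Proof.
move=> pL qL inv_r; have pL' : linear (fun a => toop (p a)) by [].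
rewrite -(ten2_tmap _ (@slot1_linear k N) (@slot2_linear k N) pL' qL) absorb12.
rewrite sandwich2_tmap // inv_r (linfZ (sandwich_linear1 s t C)).
by rewrite -pzAl mul1r (linfZ (sandwich_linear r s t)).
Qed.

Lemma cap34 (p q : H -> N) r s t C h : linear p -> linear q ->
  (forall h, sand2 p q t (D h) = eps h *: t) ->
  sandwich r s t (ten2 (fun a => slot3 (toop (p a))) (fun a => slot4 (q a)) (D h) * C)
  = sandwich r s t (eps h *: (1 : quad_alg N) * C).
Proof.
move=> pL qL inv_r; have pL' : linear (fun a => toop (p a)) by [].
rewrite -(ten2_tmap _ (@slot3_linear k N) (@slot4_linear k N) pL' qL) absorb34.
rewrite sandwich2_tmap // inv_r (linfZ (sandwich_linear3 r s C)).
by rewrite -pzAl mul1r (linfZ (sandwich_linear r s t)).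
Qed.

Lemma cup23 (p q : H -> N) r s t C h : linear p -> linear q ->
  (forall h, sand2 p q s (D h) = eps h *: s) ->
  sandwich r s t (C * ten2 (fun a => slot2 (p a)) (fun a => slot3 (toop (q a))) (D h))
  = sandwich r s t (C * (eps h *: (1 : quad_alg N))).
Proof.
move=> pL qL inv_s; have qL' : linear (fun a => toop (q a)) by [].
rewrite -(ten2_tmap _ (@slot2_linear k N) (@slot3_linear k N) pL qL') absorb23.
rewrite sandwich2'_tmap // inv_s (linfZ (sandwich_linear2 r t C)).
by rewrite -pzAr mulr1 (linfZ (sandwich_linear r s t)).
Qed.

Definition at1 (p : H -> N) : H -> quad_alg N := fun h => slot1 (toop (p h)).
Definition at2 (p : H -> N) : H -> quad_alg N := fun h => slot2 (p h).
Definition at3 (p : H -> N) : H -> quad_alg N := fun h => slot3 (toop (p h)).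
Definition at4 (p : H -> N) : H -> quad_alg N := fun h => slot4 (p h).

Lemma antimap_toop (p : H -> N) : algebra_antimap p ->
  algebra_map (fun h => toop (p h)).
Proof. by case=> pL p1 pM; split=> //; split=> // x y; rewrite pM. Qed.

Lemma at1_map p : algebra_antimap p -> algebra_map (at1 p).
Proof. by move/antimap_toop; apply: comp_algebra_map (@slot1_algebra_map k N). Qed.
Lemma at2_map p : algebra_map p -> algebra_map (at2 p).
Proof. exact: comp_algebra_map (@slot2_algebra_map k N). Qed.
Lemma at3_map p : algebra_antimap p -> algebra_map (at3 p).
Proof. by move/antimap_toop; apply: comp_algebra_map (@slot3_algebra_map k N). Qed.
Lemma at4_map p : algebra_map p -> algebra_map (at4 p).
Proof. exact: comp_algebra_map (@slot4_algebra_map k N). Qed.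

Lemma at_comm (p q : H -> N) :
  [/\ commuting (at1 p) (at2 q), commuting (at1 p) (at3 q), commuting (at1 p) (at4 q),
      commuting (at2 p) (at3 q) & commuting (at2 p) (at4 q)] /\
  commuting (at3 p) (at4 q).
Proof. by do !split; move=> a b; rewrite !quadM !mul1r !mulr1. Qed.

Lemma at_comm' (p q : H -> N) :
  [/\ commuting (at2 p) (at1 q), commuting (at3 p) (at1 q), commuting (at4 p) (at1 q),
      commuting (at3 p) (at2 q) & commuting (at4 p) (at2 q)] /\
  commuting (at4 p) (at3 q).
Proof. by do !split; move=> a b; rewrite !quadM !mul1r !mulr1. Qed.

Lemma at_comm_same (p q : H -> N) : commuting p q ->
  [/\ commuting (at1 p) (at1 q), commuting (at2 p) (at2 q), commuting (at3 p) (at3 q)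
    & commuting (at4 p) (at4 q)].
Proof.
by move=> pq; split=> a b; rewrite !quadM !mul1r; congr (quad _ _ _ _); rewrite ?pq // -!toopM pq.
Qed.

Lemma at1_linear (p : H -> N) : linear p -> linear (at1 p).
Proof. by move=> pL; apply: (comp_linear (@slot1_linear k N)). Qed.
Lemma at2_linear (p : H -> N) : linear p -> linear (at2 p).
Proof. by move=> pL; apply: (comp_linear (@slot2_linear k N)). Qed.
Lemma at3_linear (p : H -> N) : linear p -> linear (at3 p).
Proof. by move=> pL; apply: (comp_linear (@slot3_linear k N)). Qed.
Lemma at4_linear (p : H -> N) : linear p -> linear (at4 p).
Proof. by move=> pL; apply: (comp_linear (@slot4_linear k N)). Qed.

Lemma sandwich_mul_slot1 (r s t : N) C y :
  sandwich r s t (C * slot1 (toop y)) = y * sandwich r s t C.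
Proof.
move: C; apply: quad_ext => [||x y' z w].
- by apply: (comp_linear (sandwich_linear r s t)); apply: mulr_linear.
- by apply: linear_mull; apply: sandwich_linear.
- by rewrite quadM !sandwich_pure !mulr1 fromopM toopK !mulrA.
Qed.

Lemma sandwich_ten3_123 (p q u : H -> N) r s t y X :
  linear p -> linear q -> linear u ->
  sandwich r s t (slot3 (toop y) * ten2 (at1 p) (ten2 (at2 q) (at3 u)) X)
  = sand3 p q u r s X * y * t.
Proof.
move=> pL qL uL; have p1 := at1_linear pL; have q2 := at2_linear qL.
have u3 := at3_linear uL; have qu := ten2_linear q2 u3; have pqu := ten2_linear p1 qu.
move: X; apply: linear_tensor_ext3 => [||x y' z].
- by apply: (comp_linear (sandwich_linear r s t)); apply: linear_mull.
- by do 2!apply: linear_mulr; apply: sand3_linear.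
- rewrite !ten2_pure // !quadM sandwich_pure sand3_pure // !mulr1 !mul1r.
  by rewrite fromopM !toopK !mulrA.
Qed.

Lemma sandwich_ten3_234 (p q u : H -> N) r s t X :
  linear p -> linear q -> linear u ->
  sandwich r s t (ten2 (at2 p) (ten2 (at3 q) (at4 u)) X) = r * sand3 p q u s t X.
Proof.
move=> pL qL uL; have p1 := at2_linear pL; have q2 := at3_linear qL.
have u3 := at4_linear uL; have qu := ten2_linear q2 u3; have pqu := ten2_linear p1 qu.
move: X; apply: linear_tensor_ext3 => [||x y' z].
- exact: (comp_linear (sandwich_linear r s t)).
- by apply: linear_mull; apply: sand3_linear.
- rewrite !ten2_pure // !quadM sandwich_pure sand3_pure // !mulr1 !mul1r.
  by rewrite !toopK !mulrA.
Qed.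

End SlotLetters.

(** Indices past the end of the list read as the counit, an algebra map commuting with everything,
    so that the hypotheses on letters hold at every index. *)
Definition letter (E : pzAlgType k) (s : seq (H -> E)) : nat -> H -> E :=
  nth (@unit_letter E) s.

End Antipodal.

Ltac comm_slots := match goal with |- commuting (_ ?p) (_ ?q) => solve
  [ by have [[? ? ? ? ?] ?] := at_comm p q
  | by have [[? ? ? ? ?] ?] := at_comm' p q
  | (have pq : commuting p q by first [assumption | refine (commutingC _); assumption]);
    by have [? ? ? ?] := at_comm_same pq ] end.
Ltac comm_letters := case=> [|[|[|[|[|[|[|m]]]]]]] [|[|[|[|[|[|[|n]]]]]]] //= ?;
  rewrite /letter /= ?nth_nil; first
  [ exact: commuting_unit_letter | exact: (commutingC (commuting_unit_letter _ _))
  | comm_slots ].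
Ltac hom_letters := case=> [|[|[|[|[|[|[|n]]]]]]]; rewrite /letter /= ?nth_nil; first
  [ exact: unit_letter_algebra_map | by apply: at1_map | by apply: at2_map
  | by apply: at3_map | by apply: at4_map ].

(** * The element comparing two antipodes along the same map *)

Section Transport.
Variables (k : fieldType) (H : pzAlgType k) (Q : quasi_bialgebra H).
Local Notation D := (comul Q).
Local Notation eps := (counit Q).
Local Notation Phi := (reass Q).

Section Unique.
Variables (N : pzAlgType k) (f g g' : H -> N) (r s r' : N).
Hypothesis T : antipodal Q f g r s.
Hypothesis g'A : algebra_antimap g'.
Hypothesis cap' : forall h, sand2 g' f r' (D h) = eps h *: r'.

Definition transport : N := sand3 g' f g r' s (inv Phi).

Let L := letter Q [:: at1 g'; at2 f; at3 g; at4 f].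

Let fA : algebra_map f. Proof. by case: T. Qed.
Let gA : algebra_antimap g. Proof. by case: T. Qed.
Let fL : linear f. Proof. by case: fA. Qed.
Let gL : linear g. Proof. by case: gA. Qed.
Let g'L : linear g'. Proof. by case: g'A. Qed.

Let Lhom n : algebra_map (L n).
Proof. by move: n; rewrite /L; hom_letters. Qed.

Let Lcomm m n : m != n -> commuting (L m) (L n).
Proof. by move: m n; rewrite /L; comm_letters. Qed.

Local Notation a := (Letter 0).
Local Notation b := (Letter 1).
Local Notation c := (Letter 2).
Local Notation d := (Letter 3).
Local Notation V := (sandwich r' s).

Let bc : forall t, righteq (V t) (wmap Q L (b ∙ c)) (wmap Q L Unit).
Proof. by move=> t h C; apply: cup23 => // x; apply: (antipodal_cup T). Qed.
Let ab : forall t, lefteq (V t) (wmap Q L (a ∙ b)) (wmap Q L Unit).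
Proof. by move=> t h C; apply: cap12. Qed.
Let cd : lefteq (V r) (wmap Q L (c ∙ d)) (wmap Q L Unit).
Proof. by move=> h C; apply: cap34 => // x; apply: (antipodal_cap T). Qed.

Let V_abc t : V t (Phi3V Q L a b c) = transport * t.
Proof.
have := @sandwich_ten3_123 _ _ N g' f g r' s t 1 (inv Phi) g'L fL gL.
have [_ [slot1 _]] := @slot3_algebra_map k N.
by rewrite mulr1 [slot3 _]slot1 mul1r => <-.
Qed.

(** Coassociativity on the letters [a b c], evaluated at both ends: in [a ∙ (b ∙ c)] the cup removes
    [b c] and leaves [g' h] outermost, in [a ∙ b ∙ c] the cap removes [a b] and leaves [g h]. *)
Lemma transport_intertwine h : transport * g h = g' h * transport.
Proof.
have i := @Phi3V_intertwine _ _ Q _ L Lhom Lcomm a b c isT h.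
have := congr1 (V 1) i.
have VL := sandwich_linear r' s 1.
have -> : V 1 (Phi3V Q L a b c * wmap Q L (a ∙ (b ∙ c)) h) = g' h * transport.
  have -> : righteq (V 1) (wmap Q L (a ∙ (b ∙ c))) (wmap Q L (a ∙ Unit)).
    by apply: righteq_node.
  by rewrite wmap_unitr // sandwich_mul_slot1 V_abc mulr1.
have -> : lefteq (V 1) (wmap Q L (a ∙ b ∙ c)) (wmap Q L (Unit ∙ c)).
  by apply: lefteq_node.
by rewrite wmap_unitl // [RHS](@sandwich_ten3_123 _ _ N g' f g) // mulr1.
Qed.

(** Two contractions of the pentagon on [a b c d]. Removing [c d] and [a b] by the caps leaves
    [Phi3V a b c], that is [transport * r]; removing [b c] by the cup leaves [Phi3 b c d], that is
    [r'] times the zigzag, which is 1. *)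
Lemma transport_cap : transport * r = r'.
Proof.
have VL := sandwich_linear r' s r.
rewrite -V_abc -[RHS]mulr1 -(antipodal_zig T) -(@sandwich_ten3_234 _ _ N f g f r' s r Phi) //.
transitivity (V r (Phi3 Q L b c d * Phi3 Q L a (b ∙ c) d)).
  rewrite -(pentagon_WTZ Q Lhom Lcomm) // -mulrA.
  transitivity (V r (Phi3 Q L a b Unit * (Phi3 Q L (a ∙ b) c d * Phi3V Q L a b c))); last first.
    have e : lefteq (V r) (ten3 Q L a b (c ∙ d)) (ten3 Q L a b Unit).
      by apply: lefteq_ten3.
    by rewrite e.
  rewrite Phi3_unit3 // mul1r.
  have -> : lefteq (V r) (ten3 Q L (a ∙ b) c d) (ten3 Q L Unit c d).
    by apply: lefteq_ten3.
  by rewrite [ten3 _ _ _ _ _ _](Phi3_unit1 Q Lhom Lcomm) // mul1r.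
have -> : righteq (V r) (ten3 Q L a (b ∙ c) d) (ten3 Q L a Unit d).
  by apply: righteq_ten3.
by rewrite [ten3 _ _ _ _ _ _](Phi3_unit2 Q Lhom Lcomm) // mulr1.
Qed.

End Unique.

(** Multiply the zag identity by [u] on the left: moving [u] inwards turns [g] into [g'], and then
    [u * r] into [r']. *)
Lemma transport_unique (N : pzAlgType k) (f g g' : H -> N) (r s r' u : N) :
  antipodal Q f g r s -> linear g' -> (forall h, u * g h = g' h * u) -> u * r = r' ->
  u = transport f g g' s r'.
Proof.
case=> [[fL _] [gL _ _]] _ _ _ zag g'L ug <-.
rewrite -[LHS]mulr1 -zag (@sand3_mull _ _ _ _ _ g g' f g u r s) //.
Qed.

(** Moving one comparison element into the sum that defines the other turns the product into the zag
    element of a single antipode, which is 1. *)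
Lemma transport_inv (N : pzAlgType k) (f g g' : H -> N) (r s r' s' : N) :
  antipodal Q f g r s -> antipodal Q f g' r' s' ->
  mutual_inverse (transport f g g' s r') (transport f g' g s' r).
Proof.
move=> T T'; have [[fL _] [gL _ _]] := (antipodal_map T, antipodal_antimap T).
case: (antipodal_antimap T') => g'L _ _; split.
  rewrite /transport (@sand3_mull _ _ _ _ _ g g' f g' _ r s') //; last first.
    exact: (transport_intertwine T (antipodal_antimap T') (antipodal_cap T')).
  rewrite (transport_cap T (antipodal_antimap T') (antipodal_cap T')).
  exact: (antipodal_zag T').
rewrite /transport (@sand3_mull _ _ _ _ _ g' g f g _ r' s) //; last first.
  exact: (transport_intertwine T' (antipodal_antimap T) (antipodal_cap T)).
rewrite (transport_cap T' (antipodal_antimap T) (antipodal_cap T)).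
exact: (antipodal_zag T).
Qed.
End Transport.

(** * Products of antipodes *)

Section Sand4.
Variables (k : fieldType) (N : pzAlgType k) (H : lmodType k).
Variables (p q u v : H -> N).
Hypotheses (pL : linear p) (qL : linear q) (uL : linear u) (vL : linear v).

(* Arguments are listed in the order of the tensor legs: gamma is
   [S A2 alpha A3 ⊗ S A1 alpha A4], hence the exchange of [p] and [q]. *)
Definition sand4 r : H ⊗ H ⊗ H ⊗ H -> N :=
  tlift (fun a => tlift (fun b => tlift (fun c d => q b * p a * r * u c * v d))).
Definition sand4' s : H ⊗ H ⊗ H ⊗ H -> N :=
  tlift (fun a => tlift (fun b => tlift (fun c d => p a * q b * s * v d * u c))).

Let bilin_c w : bilin (fun c d => w * u c * v d).
Proof. by bilin_tac. Qed.
Let bilin_b p0 r : bilin (fun b => tlift (fun c d => q b * p0 * r * u c * v d)).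
Proof. by split=> ? /=; [linear_tac | apply: tlift_linear]. Qed.
Let bilin_a r : bilin (fun a => tlift (fun b => tlift (fun c d => q b * p a * r * u c * v d))).
Proof. by split=> ? /=; [linear_tac | apply: tlift_linear]. Qed.
Let bilin_c' w : bilin (fun c d => w * v d * u c).
Proof. by bilin_tac. Qed.
Let bilin_b' p0 s : bilin (fun b => tlift (fun c d => p0 * q b * s * v d * u c)).
Proof. by split=> ? /=; [linear_tac | apply: tlift_linear]. Qed.
Let bilin_a' s : bilin (fun a => tlift (fun b => tlift (fun c d => p a * q b * s * v d * u c))).
Proof. by split=> ? /=; [linear_tac | apply: tlift_linear]. Qed.

Lemma sand4_linear r : linear (sand4 r). Proof. exact/tlift_linear. Qed.
Lemma sand4'_linear r : linear (sand4' r). Proof. exact/tlift_linear. Qed.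
Lemma sand4_pure r a b c d : sand4 r (a ⊗ b ⊗ c ⊗ d) = q b * p a * r * u c * v d.
Proof. by rewrite /sand4 !tlift_pure. Qed.
Lemma sand4'_pure s a b c d : sand4' s (a ⊗ b ⊗ c ⊗ d) = p a * q b * s * v d * u c.
Proof. by rewrite /sand4' !tlift_pure. Qed.

Lemma sand4_mulr r x X : (forall c, x * u c = u c * x) -> (forall c, x * v c = v c * x) ->
  sand4 r X * x = sand4 (r * x) X.
Proof.
move=> xu xv; move: X; apply: linear_tensor_ext4 => [||a b c d].
- by apply: linear_mulr; apply: sand4_linear.
- exact: sand4_linear.
- by rewrite !sand4_pure -!mulrA -xv [u c * (x * _)]mulrA -xu !mulrA.
Qed.

Lemma sand4_mull r x X : (forall c, x * p c = p c * x) -> (forall c, x * q c = q c * x) ->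
  x * sand4 r X = sand4 (x * r) X.
Proof.
move=> xp xq; move: X; apply: linear_tensor_ext4 => [||a b c d].
- by apply: linear_mull; apply: sand4_linear.
- exact: sand4_linear.
- by rewrite !sand4_pure !mulrA xq -(mulrA (q b)) xp !mulrA.
Qed.

End Sand4.

Section AbsorbA.
Variables (k : fieldType) (H : pzAlgType k) (N : pzAlgType k).
Variables (p q u v : H -> N).
Hypotheses (pL : linear p) (qL : linear q) (uL : linear u) (vL : linear v).

Lemma absorbA12 r s t A C :
  sandwich (sand4 p q u v r A) s t C
  = sandwich r s t (ten2 (at1 p) (ten2 (at1 q) (ten2 (at2 u) (at2 v))) A * C).
Proof.
have p1 := at1_linear pL; have q1 := at1_linear qL.
have u2 := at2_linear uL; have v2 := at2_linear vL.
have uv := ten2_linear u2 v2; have quv := ten2_linear q1 uv.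
move: A; apply: linear_tensor_ext4 => [||a b c d].
- by apply: (comp_linear (sandwich_linear1 s t C)); apply: sand4_linear.
- apply: (comp_linear (sandwich_linear r s t)); apply: linear_mulr.
  exact: ten2_linear.
rewrite !ten2_pure // sand4_pure //.
move: C; apply: quad_ext => [||x y z w].
- exact: sandwich_linear.
- by apply: (comp_linear (sandwich_linear r s t)); apply: mull_linear.
- by rewrite !quadM !sandwich_pure !mulr1 !mul1r !fromopM !toopK !mulrA.
Qed.

Lemma absorbA34 r s t A C :
  sandwich r s (sand4 p q u v t A) C
  = sandwich r s t (ten2 (at3 p) (ten2 (at3 q) (ten2 (at4 u) (at4 v))) A * C).
Proof.
have p1 := at3_linear pL; have q1 := at3_linear qL.
have u2 := at4_linear uL; have v2 := at4_linear vL.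
have uv := ten2_linear u2 v2; have quv := ten2_linear q1 uv.
move: A; apply: linear_tensor_ext4 => [||a b c d].
- by apply: (comp_linear (sandwich_linear3 r s C)); apply: sand4_linear.
- apply: (comp_linear (sandwich_linear r s t)); apply: linear_mulr.
  exact: ten2_linear.
rewrite !ten2_pure // sand4_pure //.
move: C; apply: quad_ext => [||x y z w].
- exact: sandwich_linear.
- by apply: (comp_linear (sandwich_linear r s t)); apply: mull_linear.
- by rewrite !quadM !sandwich_pure !mulr1 !mul1r !fromopM !toopK !mulrA.
Qed.

Lemma absorbA23 r s t A C :
  sandwich r (sand4' p q u v s A) t C
  = sandwich r s t (C * ten2 (at2 p) (ten2 (at2 q) (ten2 (at3 u) (at3 v))) A).
Proof.
have p1 := at2_linear pL; have q1 := at2_linear qL.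
have u2 := at3_linear uL; have v2 := at3_linear vL.
have uv := ten2_linear u2 v2; have quv := ten2_linear q1 uv.
move: A; apply: linear_tensor_ext4 => [||a b c d].
- by apply: (comp_linear (sandwich_linear2 r t C)); apply: sand4'_linear.
- apply: (comp_linear (sandwich_linear r s t)); apply: linear_mull.
  exact: ten2_linear.
rewrite !ten2_pure // sand4'_pure //.
move: C; apply: quad_ext => [||x y z w].
- exact: sandwich_linear.
- by apply: (comp_linear (sandwich_linear r s t)); apply: mulr_linear.
- by rewrite !quadM !sandwich_pure !mulr1 !mul1r !fromopM !toopK !mulrA.
Qed.

End AbsorbA.

(** * The Drinfeld element A and its inverse as rebracketings *)

Section DrinfeldElements.
Variables (k : fieldType) (H : pzAlgType k) (Q : quasi_hopf H).
Local Notation D := (comul Q).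
Local Notation Phi := (reass Q).

(* The inverse of [drinfeld_A Q]. *)
Definition drinfeld_B : H ⊗ H ⊗ H ⊗ H :=
  tfirst D Phi * tassoc3 (inv Phi ⊗ (1 : H)).

Variables (E : pzAlgType k) (L : nat -> H -> E).
Hypothesis Lhom : forall n, algebra_map (L n).
Hypothesis Lcomm : forall m n : nat, m != n -> commuting (L m) (L n).

Lemma ten4_hom x y z w : wf (x ∙ (y ∙ (z ∙ w))) ->
  algebra_map (ten2 (wmap Q L x) (ten3 Q L y z w)).
Proof.
rewrite wf_node => /and3P[wx wyzw]; rewrite !wdisjr => /and3P[xy xz xw].
apply: ten2_algebra_map.
- exact: wmap_hom.
- exact: ten3_hom.
apply: commuting_ten2r; try exact: wmap_linear; try exact: wmap_comm.
  by apply: ten2_linear; apply: wmap_linear.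
by apply: commuting_ten2r; try exact: wmap_linear; try exact: wmap_comm.
Qed.

Lemma ten4_tassoc3 x y z w X : wf w ->
  ten2 (wmap Q L x) (ten3 Q L y z w) (tassoc3 (X ⊗ (1 : H))) = ten3 Q L x y z X.
Proof.
move=> /(wmap_hom Q Lhom Lcomm) [_ [w1 _]]; have wL := @wmap_linear _ _ Q _ L Lhom.
have l1 := ten2_linear (wL z) (wL w); have l2 := ten2_linear (wL y) (wL z).
have l3 := ten2_linear l2 (wL w).
rewrite /tassoc3 /ten3 ten2_tmap //; last first.
- exact: tassoc_linear.
- exact: ten2_linear.
have -> : (fun b => ten2 (wmap Q L y) (ten2 (wmap Q L z) (wmap Q L w)) (tassoc b))
    = ten2 (ten2 (wmap Q L y) (wmap Q L z)) (wmap Q L w).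
  by apply: funext => b; apply: ten2_tassoc.
rewrite ten2_tassoc // ten2_pure //; last exact: ten2_linear.
by rewrite w1 mulr1.
Qed.

Lemma ten4_A x y z w : wf (x ∙ (y ∙ (z ∙ w))) ->
  ten2 (wmap Q L x) (ten3 Q L y z w) (drinfeld_A Q)
  = Phi3 Q L x y z * Phi3V Q L (x ∙ y) z w.
Proof.
move=> wxyzw; have [_ [_ ->]] := ten4_hom wxyzw.
rewrite ten4_tassoc3; last first.
  by move: wxyzw; rewrite !wf_node => /and3P[_ /and3P[_ /and3P[]]].
by rewrite /ten3 ten2_comulL //; apply: ten2_linear; apply: wmap_linear.
Qed.

Lemma ten4_B x y z w : wf (x ∙ (y ∙ (z ∙ w))) ->
  ten2 (wmap Q L x) (ten3 Q L y z w) drinfeld_B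
  = Phi3 Q L (x ∙ y) z w * Phi3V Q L x y z.
Proof.
move=> wxyzw; have [_ [_ ->]] := ten4_hom wxyzw.
rewrite ten4_tassoc3; last first.
  by move: wxyzw; rewrite !wf_node => /and3P[_ /and3P[_ /and3P[]]].
by rewrite /ten3 ten2_comulL //; apply: ten2_linear; apply: wmap_linear.
Qed.

Local Notation a := (Letter 0).
Local Notation b := (Letter 1).
Local Notation c := (Letter 2).
Local Notation d := (Letter 3).

Lemma A_intertwine h : Phi3 Q L a b c * Phi3V Q L (a ∙ b) c d * wmap Q L (a ∙ b ∙ (c ∙ d)) h
  = wmap Q L (a ∙ (b ∙ c) ∙ d) h * (Phi3 Q L a b c * Phi3V Q L (a ∙ b) c d).
Proof.
rewrite -mulrA (Phi3V_intertwine Q Lhom Lcomm (x := a ∙ b)) // !mulrA; congr (_ * _).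
by apply: intertwine_node => //; [apply: Phi3_intertwine | apply: ten3_comm].
Qed.

Lemma B_intertwine h : Phi3 Q L (a ∙ b) c d * Phi3V Q L a b c * wmap Q L (a ∙ (b ∙ c) ∙ d) h
  = wmap Q L (a ∙ b ∙ (c ∙ d)) h * (Phi3 Q L (a ∙ b) c d * Phi3V Q L a b c).
Proof.
rewrite -mulrA; have -> : Phi3V Q L a b c * wmap Q L (a ∙ (b ∙ c) ∙ d) h
    = wmap Q L (a ∙ b ∙ c ∙ d) h * Phi3V Q L a b c.
  by apply: intertwine_node => //; [apply: Phi3V_intertwine | apply: ten3_comm].
by rewrite !mulrA (Phi3_intertwine Q Lhom Lcomm (x := a ∙ b)).
Qed.

End DrinfeldElements.

Section AntipodalTransfer.
Variables (k : fieldType) (H : pzAlgType k) (Q : quasi_hopf H).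
Local Notation S := (antipode Q).
Local Notation al := (qalpha Q).
Local Notation be := (qbeta Q).

Lemma antipode_linear : linear S.
Proof. by case: (antipode_antimap Q). Qed.

Lemma antipodal_id : antipodal Q id S al be.
Proof.
split; [exact: id_algebra_map | exact: antipode_antimap | exact: antipode_alpha
  | exact: antipode_beta | exact: antipode_reass | exact: antipode_reass_inv].
Qed.

Lemma antipodal_comp (M N : pzAlgType k) (j : M -> N) (f g : H -> M) r s :
  algebra_map j -> antipodal Q f g r s ->
  antipodal Q (fun h => j (f h)) (fun h => j (g h)) (j r) (j s).
Proof.
move=> jA [fA gA cap cup zig zag]; have [jL [j1 jM]] := jA.
have [fL _] := fA; have [gL g1 gM] := gA.
have jfL := comp_linear jL fL; have jgL := comp_linear jL gL.
have j2 (p q : H -> M) t X : linear p -> linear q ->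
    sand2 (fun h => j (p h)) (fun h => j (q h)) (j t) X = j (sand2 p q t X).
  move=> pL qL; have jpL := comp_linear jL pL; have jqL := comp_linear jL qL.
  move: X; apply: tensor_ext => [||a b].
  - exact: sand2_linear.
  - by apply: (comp_linear jL); apply: sand2_linear.
  - by rewrite !sand2_pure // !jM.
have j3 (p q u : H -> M) t v X : linear p -> linear q -> linear u ->
    sand3 (fun h => j (p h)) (fun h => j (q h)) (fun h => j (u h)) (j t) (j v) X
    = j (sand3 p q u t v X).
  move=> pL qL uL; have jpL := comp_linear jL pL; have jqL := comp_linear jL qL.
  have juL := comp_linear jL uL.
  move: X; apply: linear_tensor_ext3 => [||a b c].
  - exact: sand3_linear.
  - by apply: (comp_linear jL); apply: sand3_linear.
  - by rewrite !sand3_pure // !jM.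
split.
- exact: comp_algebra_map.
- by split=> // [|x y]; rewrite ?g1 // gM jM.
- by move=> h; rewrite j2 // cap (linfZ jL).
- by move=> h; rewrite j2 // cup (linfZ jL).
- by rewrite j3 // zig.
- by rewrite j3 // zag.
Qed.

End AntipodalTransfer.

Section SlotComul.
Variables (k : fieldType) (H : pzAlgType k) (Q : quasi_bialgebra H) (N : pzAlgType k).
Local Notation D := (comul Q).
Variables p q : H -> N.
Hypotheses (pL : linear p) (qL : linear q) (pq : commuting p q).

Lemma at1_comul h : at1 (fun h => ten2 p q (D h)) h = ten2 (at1 p) (at1 q) (D h).
Proof.
rewrite /at1; have tL : linear (fun x => slot1 (toop (ten2 p q x))).
  have l := ten2_linear pL qL; have l' : linear (fun x => toop (ten2 p q x)) by [].
  exact: (comp_linear (@slot1_linear k N) l').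
have p1 := at1_linear pL; have q1 := at1_linear qL.
move: (D h); apply: tensor_ext => // [|a b]; first exact: ten2_linear.
by rewrite !ten2_pure // quadM !mulr1 -toopM pq.
Qed.

Lemma at2_comul h : at2 (fun h => ten2 p q (D h)) h = ten2 (at2 p) (at2 q) (D h).
Proof.
rewrite /at2; have tL : linear (fun x => slot2 (ten2 p q x)).
  exact: (comp_linear (@slot2_linear k N) (ten2_linear pL qL)).
have p1 := at2_linear pL; have q1 := at2_linear qL.
move: (D h); apply: tensor_ext => // [|a b]; first exact: ten2_linear.
by rewrite !ten2_pure // quadM !mulr1.
Qed.

Lemma at3_comul h : at3 (fun h => ten2 p q (D h)) h = ten2 (at3 p) (at3 q) (D h).
Proof.
rewrite /at3; have tL : linear (fun x => slot3 (toop (ten2 p q x))).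
  have l := ten2_linear pL qL; have l' : linear (fun x => toop (ten2 p q x)) by [].
  exact: (comp_linear (@slot3_linear k N) l').
have p1 := at3_linear pL; have q1 := at3_linear qL.
move: (D h); apply: tensor_ext => // [|a b]; first exact: ten2_linear.
by rewrite !ten2_pure // quadM !mulr1 -toopM pq.
Qed.

Lemma at4_comul h : at4 (fun h => ten2 p q (D h)) h = ten2 (at4 p) (at4 q) (D h).
Proof.
rewrite /at4; have tL : linear (fun x => slot4 (ten2 p q x)).
  exact: (comp_linear (@slot4_linear k N) (ten2_linear pL qL)).
have p1 := at4_linear pL; have q1 := at4_linear qL.
move: (D h); apply: tensor_ext => // [|a b]; first exact: ten2_linear.
by rewrite !ten2_pure // quadM !mulr1.
Qed.
End SlotComul.

Section SandwichValues.
Variables (k : fieldType) (N : pzAlgType k) (H : pzAlgType k).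
Variables p q : H -> N.
Hypotheses (pL : linear p) (qL : linear q).

Lemma sandwich_ten2_12 r s X :
  sandwich r s 1 (ten2 (at1 p) (at2 q) X) = sand2 p q r X * s.
Proof.
have p1 := at1_linear pL; have q2 := at2_linear qL.
move: X; apply: tensor_ext => [||a b].
- by apply: (comp_linear (sandwich_linear r s 1)); apply: ten2_linear.
- by apply: linear_mulr; apply: sand2_linear.
- by rewrite ten2_pure // quadM sandwich_pure sand2_pure // !mulr1 mul1r toopK.
Qed.

Lemma sandwich_ten2_23 r s t X :
  sandwich r s t (ten2 (at2 p) (at3 q) X) = r * sand2 p q s X * t.
Proof.
have p1 := at2_linear pL; have q2 := at3_linear qL.
move: X; apply: tensor_ext => [||a b].
- by apply: (comp_linear (sandwich_linear r s t)); apply: ten2_linear.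
- by apply: linear_mulr; apply: linear_mull; apply: sand2_linear.
- by rewrite ten2_pure // quadM sandwich_pure sand2_pure // !mulr1 !mul1r toopK !mulrA.
Qed.
End SandwichValues.

(** * The product of two antipodes with commuting values *)

Section Product.
Variables (k : fieldType) (H : pzAlgType k) (Q : quasi_hopf H) (N : pzAlgType k).
Local Notation D := (comul Q).
Local Notation eps := (counit Q).
Local Notation Phi := (reass Q).
Local Notation S := (antipode Q).
Local Notation al := (qalpha Q).
Local Notation be := (qbeta Q).
Variables j1 j2 : H -> N.
Hypotheses (j1A : algebra_map j1) (j2A : algebra_map j2) (jj : commuting j1 j2).

Definition j1S (h : H) : N := j1 (S h).
Definition j2S (h : H) : N := j2 (S h).

Definition prod_map (h : H) : N := ten2 j1 j2 (D h).
(** An antipode reverses the coproduct, hence the exchange of [j1] and [j2]. When these are the two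
    embeddings of H into H ⊗ H, this is (S ⊗ S) Delta^cop and [prod_cap] is gamma. *)
Definition prod_antimap (h : H) : N := ten2 j2S j1S (D h).
Definition prod_cap : N := sand4 j2S j1S j1 j2 (j1 al * j2 al) (drinfeld_A Q).
Definition prod_cup : N := sand4' j1 j2 j2S j1S (j1 be * j2 be) (drinfeld_B Q).

Let j1L : linear j1. Proof. by case: j1A. Qed.
Let j2L : linear j2. Proof. by case: j2A. Qed.
Let SL := @antipode_linear _ _ Q.
Let j1SL : linear j1S. Proof. exact: comp_linear j1L SL. Qed.
Let j2SL : linear j2S. Proof. exact: comp_linear j2L SL. Qed.
Let j1SA : algebra_antimap j1S.
Proof. by case: (antipodal_comp j1A (antipodal_id Q)). Qed.
Let j2SA : algebra_antimap j2S.
Proof. by case: (antipodal_comp j2A (antipodal_id Q)). Qed.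
Let cSS : commuting j1S j2S. Proof. by move=> a b; apply: jj. Qed.

Let cap1 h : sand2 j1S j1 (j1 al) (D h) = eps h *: j1 al.
Proof. by case: (antipodal_comp j1A (antipodal_id Q)) => _ _ ->. Qed.
Let cap2 h : sand2 j2S j2 (j2 al) (D h) = eps h *: j2 al.
Proof. by case: (antipodal_comp j2A (antipodal_id Q)) => _ _ ->. Qed.
Let cup1 h : sand2 j1 j1S (j1 be) (D h) = eps h *: j1 be.
Proof. by case: (antipodal_comp j1A (antipodal_id Q)) => _ _ _ ->. Qed.
Let cup2 h : sand2 j2 j2S (j2 be) (D h) = eps h *: j2 be.
Proof. by case: (antipodal_comp j2A (antipodal_id Q)) => _ _ _ ->. Qed.

Lemma sand2_mulr (p q : H -> N) r x X : linear p -> linear q ->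
  (forall c, x * q c = q c * x) -> sand2 p q r X * x = sand2 p q (r * x) X.
Proof.
move=> pL qL xq; move: X; apply: tensor_ext => [||a b].
- by apply: linear_mulr; apply: sand2_linear.
- exact: sand2_linear.
- by rewrite !sand2_pure // -!mulrA xq.
Qed.

Lemma sand2_mull (p q : H -> N) r x X : linear p -> linear q ->
  (forall c, x * p c = p c * x) -> x * sand2 p q r X = sand2 p q (x * r) X.
Proof.
move=> pL qL xp; move: X; apply: tensor_ext => [||a b].
- by apply: linear_mull; apply: sand2_linear.
- exact: sand2_linear.
- by rewrite !sand2_pure // !mulrA xp.
Qed.

Local Notation al12 := (j1 al * j2 al).
Local Notation be12 := (j1 be * j2 be).

Let cap1' h : sand2 j1S j1 al12 (D h) = eps h *: al12.
Proof. by rewrite -sand2_mulr // ?cap1 ?pzAl // => c; rewrite jj. Qed.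
Let cap2' h : sand2 j2S j2 al12 (D h) = eps h *: al12.
Proof. by rewrite -sand2_mull // ?cap2 ?pzAr // => c; apply: jj. Qed.
Let cup1' h : sand2 j1 j1S be12 (D h) = eps h *: be12.
Proof. by rewrite -sand2_mulr // ?cup1 ?pzAl // => c; rewrite /j1S jj. Qed.
Let cup2' h : sand2 j2 j2S be12 (D h) = eps h *: be12.
Proof. by rewrite -sand2_mull // ?cup2 ?pzAr // => c; apply: jj. Qed.

(** The zag identity and the cap use slots 1, 2, 3, the zig identity and the cup slots 2, 3, 4. Each
    slot holds one letter for each of the two antipodes, so six letters suffice for either
    alphabet. *)
Let L1 := letter Q [:: at1 j2S; at1 j1S; at2 j1; at2 j2; at3 j2S; at3 j1S].
Let L2 := letter Q [:: at2 j1; at2 j2; at3 j2S; at3 j1S; at4 j1; at4 j2].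

Let L1hom n : algebra_map (L1 n).
Proof. by move: n; rewrite /L1; hom_letters. Qed.
Let L2hom n : algebra_map (L2 n).
Proof. by move: n; rewrite /L2; hom_letters. Qed.
Let L1comm m n : m != n -> commuting (L1 m) (L1 n).
Proof. by move: m n; rewrite /L1; comm_letters. Qed.
Let L2comm m n : m != n -> commuting (L2 m) (L2 n).
Proof. by move: m n; rewrite /L2; comm_letters. Qed.

Local Notation a := (Letter 0).
Local Notation b := (Letter 1).
Local Notation c := (Letter 2).
Local Notation d := (Letter 3).
Local Notation e := (Letter 4).
Local Notation f := (Letter 5).

Lemma prod_map_algebra_map : algebra_map prod_map.
Proof. exact: (comp_algebra_map (ten2_algebra_map j1A j2A jj) (comul_algebra_map Q)). Qed.

Lemma prod_antimap_algebra_antimap : algebra_antimap prod_antimap.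
Proof.
have [dL [d1 dM]] := comul_algebra_map Q; have tL := ten2_linear j2SL j1SL.
have [_ s11 s1M] := j1SA; have [_ s21 s2M] := j2SA.
have t1 : ten2 j2S j1S 1 = 1 by rewrite -pure1 ten2_pure // s11 s21 mulr1.
have tM : forall x y, ten2 j2S j1S (x * y) = ten2 j2S j1S y * ten2 j2S j1S x.
  apply: (@tensor_extM k H H N^c) => // x y x' y'.
  rewrite pureM !ten2_pure // s1M s2M.
  rewrite -[RHS]/((j2S x' * j1S y') * (j2S x * j1S y)).
  by rewrite !mulrA -(mulrA (j2S x')) -cSS !mulrA.
split; first exact: comp_linear tL dL.
- by rewrite /prod_antimap d1.
- by move=> x y; rewrite /prod_antimap dM tM.
Qed.

Let pmL : linear prod_map. Proof. by case: prod_map_algebra_map. Qed.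
Let paL : linear prod_antimap. Proof. by case: prod_antimap_algebra_antimap. Qed.

Let at1E : at1 prod_antimap = wmap Q L1 (a ∙ b).
Proof. by apply: funext => h; apply: at1_comul => // x y; rewrite cSS. Qed.
Let at2E : at2 prod_map = wmap Q L1 (c ∙ d).
Proof. by apply: funext => h; apply: at2_comul. Qed.
Let at3E : at3 prod_antimap = wmap Q L1 (e ∙ f).
Proof. by apply: funext => h; apply: at3_comul => // x y; rewrite cSS. Qed.
Let at2E' : at2 prod_map = wmap Q L2 (a ∙ b).
Proof. by apply: funext => h; apply: at2_comul. Qed.
Let at3E' : at3 prod_antimap = wmap Q L2 (c ∙ d).
Proof. by apply: funext => h; apply: at3_comul => // x y; rewrite cSS. Qed.
Let at4E' : at4 prod_map = wmap Q L2 (e ∙ f).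
Proof. by apply: funext => h; apply: at4_comul. Qed.

Let left_bc s t : lefteq (sandwich al12 s t) (wmap Q L1 (b ∙ c)) (wmap Q L1 Unit).
Proof. by move=> h C; apply: cap12. Qed.
Let left_ad s t : lefteq (sandwich al12 s t) (wmap Q L1 (a ∙ d)) (wmap Q L1 Unit).
Proof. by move=> h C; apply: cap12. Qed.
Let right_de r t : righteq (sandwich r be12 t) (wmap Q L1 (d ∙ e)) (wmap Q L1 Unit).
Proof. by move=> h C; apply: cup23. Qed.
Let right_cf r t : righteq (sandwich r be12 t) (wmap Q L1 (c ∙ f)) (wmap Q L1 Unit).
Proof. by move=> h C; apply: cup23. Qed.
Let left_de r s : lefteq (sandwich r s al12) (wmap Q L2 (d ∙ e)) (wmap Q L2 Unit).
Proof. by move=> h C; apply: cap34. Qed.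
Let left_cf r s : lefteq (sandwich r s al12) (wmap Q L2 (c ∙ f)) (wmap Q L2 Unit).
Proof. by move=> h C; apply: cap34. Qed.
Let right_bc r t : righteq (sandwich r be12 t) (wmap Q L2 (b ∙ c)) (wmap Q L2 Unit).
Proof. by move=> h C; apply: cup23. Qed.
Let right_ad r t : righteq (sandwich r be12 t) (wmap Q L2 (a ∙ d)) (wmap Q L2 Unit).
Proof. by move=> h C; apply: cup23. Qed.

Let A1 : ten2 (at1 j2S) (ten2 (at1 j1S) (ten2 (at2 j1) (at2 j2))) (drinfeld_A Q)
  = Phi3 Q L1 a b c * Phi3V Q L1 (a ∙ b) c d.
Proof. exact: (@ten4_A _ _ Q _ L1 L1hom L1comm a b c d isT). Qed.
Let B1 : ten2 (at2 j1) (ten2 (at2 j2) (ten2 (at3 j2S) (at3 j1S))) (drinfeld_B Q)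
  = Phi3 Q L1 (c ∙ d) e f * Phi3V Q L1 c d e.
Proof. exact: (@ten4_B _ _ Q _ L1 L1hom L1comm c d e f isT). Qed.
Let A2 : ten2 (at3 j2S) (ten2 (at3 j1S) (ten2 (at4 j1) (at4 j2))) (drinfeld_A Q)
  = Phi3 Q L2 c d e * Phi3V Q L2 (c ∙ d) e f.
Proof. exact: (@ten4_A _ _ Q _ L2 L2hom L2comm c d e f isT). Qed.
Let B2 : ten2 (at2 j1) (ten2 (at2 j2) (ten2 (at3 j2S) (at3 j1S))) (drinfeld_B Q)
  = Phi3 Q L2 (a ∙ b) c d * Phi3V Q L2 a b c.
Proof. exact: (@ten4_B _ _ Q _ L2 L2hom L2comm a b c d isT). Qed.

(** [drinfeld_A] carries the coproducts from the bracketing (ab)(cd) to (a(bc))d. There alpha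
    removes the inner pair [b c], which belongs to [j1], and then the outer pair [a d], which
    belongs to [j2]. *)
Let prod_cap_inv h : sand2 prod_antimap prod_map prod_cap (D h) = eps h *: prod_cap.
Proof.
have VL := sandwich_linear al12 1 1.
transitivity (sandwich prod_cap 1 1 (ten2 (at1 prod_antimap) (at2 prod_map) (D h))).
  by rewrite sandwich_ten2_12 // mulr1.
rewrite absorbA12 // A1 at1E at2E.
have /= -> := A_intertwine Q L1hom L1comm h.
have -> : lefteq (sandwich al12 1 1) (wmap Q L1 (a ∙ (b ∙ c) ∙ d)) (wmap Q L1 Unit).
  move=> x C; transitivity (sandwich al12 1 1 (wmap Q L1 (a ∙ Unit ∙ d) x * C)).
    have -> // : lefteq (sandwich al12 1 1) (wmap Q L1 (a ∙ (b ∙ c) ∙ d))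
      (wmap Q L1 (a ∙ Unit ∙ d)).
    by apply: lefteq_node => //; apply: lefteq_node.
  by rewrite -(left_ad 1 1 x C) (eq_wmap_node (wmap_unitr Q L1hom a) (erefl (wmap Q L1 d))).
rewrite -pzAl mul1r (linfZ VL); congr (_ *: _).
rewrite -A1 -[X in sandwich _ _ _ X]mulr1 -absorbA12 //.
by rewrite sandwich_pure !mulr1 fromop1 mul1r.
Qed.

(** The mirror argument: [drinfeld_B] undoes the rebracketing by [drinfeld_A], so the nested
    bracketing now stands at the right end, within reach of beta. *)
Let prod_cup_inv h : sand2 prod_map prod_antimap prod_cup (D h) = eps h *: prod_cup.
Proof.
have VL := sandwich_linear 1 be12 1.
transitivity (sandwich 1 prod_cup 1 (ten2 (at2 prod_map) (at3 prod_antimap) (D h))).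
  by rewrite sandwich_ten2_23 // mulr1 mul1r.
rewrite absorbA23 // B2 at2E' at3E'.
have /= <- := B_intertwine Q L2hom L2comm h.
have -> : righteq (sandwich 1 be12 1) (wmap Q L2 (a ∙ (b ∙ c) ∙ d)) (wmap Q L2 Unit).
  move=> x C; transitivity (sandwich 1 be12 1 (C * wmap Q L2 (a ∙ Unit ∙ d) x)).
    have -> // : righteq (sandwich 1 be12 1) (wmap Q L2 (a ∙ (b ∙ c) ∙ d))
      (wmap Q L2 (a ∙ Unit ∙ d)).
    by apply: righteq_node => //; apply: righteq_node.
  by rewrite -(right_ad 1 1 x C) (eq_wmap_node (wmap_unitr Q L2hom a) (erefl (wmap Q L2 d))).
rewrite -pzAr mulr1 (linfZ VL); congr (_ *: _).
rewrite -B2 -[X in sandwich _ _ _ X]mul1r -absorbA23 //.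
by rewrite sandwich_pure !(fromop1, mulr1, mul1r).
Qed.

Let zig1 : sand3 j1 j1S j1 (j1 be) (j1 al) Phi = 1.
Proof. by case: (antipodal_comp j1A (antipodal_id Q)). Qed.
Let zig2 : sand3 j2 j2S j2 (j2 be) (j2 al) Phi = 1.
Proof. by case: (antipodal_comp j2A (antipodal_id Q)). Qed.
Let zag1 : sand3 j1S j1 j1S (j1 al) (j1 be) (inv Phi) = 1.
Proof. by case: (antipodal_comp j1A (antipodal_id Q)). Qed.
Let zag2 : sand3 j2S j2 j2S (j2 al) (j2 be) (inv Phi) = 1.
Proof. by case: (antipodal_comp j2A (antipodal_id Q)). Qed.

(* A word in elements x_i of one algebra and y_i of another, commuting with it,
   splits as the product of the two subwords. *)
Let split5 x1 x2 x3 x4 x5 y1 y2 y3 y4 y5 :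
  j2 y1 * j1 x1 * (j1 x2 * j2 y2) * (j1 x3 * j2 y3) * (j1 x4 * j2 y4) * (j2 y5 * j1 x5)
  = j1 (x1 * x2 * x3 * x4 * x5) * j2 (y1 * y2 * y3 * y4 * y5).
Proof.
have [_ [_ j1M]] := j1A; have [_ [_ j2M]] := j2A.
have J x y x' y' : j1 x * j2 y * (j1 x' * j2 y') = j1 (x * x') * j2 (y * y').
  by rewrite j1M j2M !mulrA -(mulrA (j1 x)) -jj !mulrA.
by rewrite -!jj !J.
Qed.

Let sandwich_zig X Y :
  sandwich 1 be12 al12 (ten3 Q L2 b c f X * ten3 Q L2 a d e Y)
  = sand3 j1 j1S j1 (j1 be) (j1 al) Y * sand3 j2 j2S j2 (j2 be) (j2 al) X.
Proof.
have VL := sandwich_linear 1 be12 al12.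
have wL := @wmap_linear _ _ Q _ L2 L2hom; have tL := ten3_linear Q L2hom.
move: X; apply: linear_tensor_ext3 => [||x1 x2 x3].
- by apply: (comp_linear VL); apply: linear_mulr; apply: tL.
- exact: (linear_mull _ (sand3_linear j2L j2SL j2L _ _)).
move: Y; apply: linear_tensor_ext3 => [||y1 y2 y3].
- by apply: (comp_linear VL); apply: linear_mull; apply: tL.
- exact: (linear_mulr _ (sand3_linear j1L j1SL j1L _ _)).
rewrite /ten3 !ten2_pure //; try exact: ten2_linear.
rewrite !sand3_pure // !quadM sandwich_pure !fromopM !(mulr1, mul1r).
have := split5 y1 be (S y2) al y3 x1 be (S x2) al x3.
have [_ [_ j1M]] := j1A; have [_ [_ j2M]] := j2A.
by rewrite !j1M !j2M /j1S /j2S !mulrA => <-.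
Qed.

Let prod_zig : sand3 prod_map prod_antimap prod_map prod_cup prod_cap Phi = 1.
Proof.
rewrite -[LHS]mul1r -sandwich_ten3_234 // absorbA23 // absorbA34 // B2 A2 at2E' at3E' at4E'.
rewrite mulrA -[LHS]/(sandwich 1 be12 al12 (Phi3 Q L2 c d e * Phi3V Q L2 (c ∙ d) e f
  * Phi3 Q L2 (a ∙ b) (c ∙ d) (e ∙ f) * (Phi3 Q L2 (a ∙ b) c d * Phi3V Q L2 a b c))).
rewrite (zig_contract L2hom L2comm (sandwich_linear 1 be12 al12) (left_de _ _)
  (left_cf _ _) (right_bc _ _) (right_ad _ _)).
by rewrite sandwich_zig zig1 zig2 mulr1.
Qed.

Let split5' x1 x2 x3 x4 x5 y1 y2 y3 y4 y5 :
  j1 x1 * j2 y1 * (j1 x2 * j2 y2) * (j2 y3 * j1 x3) * (j1 x4 * j2 y4) * (j1 x5 * j2 y5)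
  = j1 (x1 * x2 * x3 * x4 * x5) * j2 (y1 * y2 * y3 * y4 * y5).
Proof. by rewrite -split5 !jj. Qed.

Let sandwich_zag X Y :
  sandwich al12 be12 1 (ten3 Q L1 a d e X * ten3 Q L1 b c f Y)
  = sand3 j1S j1 j1S (j1 al) (j1 be) Y * sand3 j2S j2 j2S (j2 al) (j2 be) X.
Proof.
have VL := sandwich_linear al12 be12 1.
have wL := @wmap_linear _ _ Q _ L1 L1hom; have tL := ten3_linear Q L1hom.
move: X; apply: linear_tensor_ext3 => [||x1 x2 x3].
- by apply: (comp_linear VL); apply: linear_mulr; apply: tL.
- exact: (linear_mull _ (sand3_linear j2SL j2L j2SL _ _)).
move: Y; apply: linear_tensor_ext3 => [||y1 y2 y3].
- by apply: (comp_linear VL); apply: linear_mull; apply: tL.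
- exact: (linear_mulr _ (sand3_linear j1SL j1L j1SL _ _)).
rewrite /ten3 !ten2_pure //; try exact: ten2_linear.
rewrite !sand3_pure // !quadM sandwich_pure !fromopM !(mulr1, mul1r).
have := split5' (S y1) al y2 be (S y3) (S x1) al x2 be (S x3).
have [_ [_ j1M]] := j1A; have [_ [_ j2M]] := j2A.
by rewrite !j1M !j2M /j1S /j2S !mulrA => <-.
Qed.

Let prod_zag :
  sand3 prod_antimap prod_map prod_antimap prod_cap prod_cup (inv Phi) = 1.
Proof.
have [_ [slot1 _]] := @slot3_algebra_map k N.
transitivity (sandwich prod_cap prod_cup 1
    (ten2 (at1 prod_antimap) (ten2 (at2 prod_map) (at3 prod_antimap)) (inv Phi))).
  have := @sandwich_ten3_123 _ _ N _ _ _ prod_cap prod_cup 1 1 (inv Phi) paL pmL paL.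
  by rewrite !mulr1 [slot3 _]slot1 mul1r => <-.
rewrite absorbA23 // absorbA12 // A1 B1 at1E at2E at3E.
rewrite mulrA -[LHS]/(sandwich al12 be12 1 (Phi3 Q L1 a b c * Phi3V Q L1 (a ∙ b) c d
  * Phi3V Q L1 (a ∙ b) (c ∙ d) (e ∙ f) * (Phi3 Q L1 (c ∙ d) e f * Phi3V Q L1 c d e))).
rewrite (zag_contract L1hom L1comm (sandwich_linear al12 be12 1) (left_bc _ _)
  (left_ad _ _) (right_de _ _) (right_cf _ _)).
by rewrite sandwich_zag zag1 zag2 mulr1.
Qed.

Theorem antipodal_prod : antipodal Q prod_map prod_antimap prod_cap prod_cup.
Proof.
split=> //; [exact: prod_map_algebra_map | exact: prod_antimap_algebra_antimap].
Qed.

End Product.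

(** * Associativity of the product of antipodes *)

Section PairAlgebra.
Variables (k : fieldType) (N : pzAlgType k).

(** The analogue of [quad_alg] for expressions [x r y] with a single insertion: comparing alphas
    involves no beta. *)
Definition pair_alg : pzAlgType k := (N^c ⊗ N)%type.
Definition pair_elt (x : N^c) (y : N) : pair_alg := x ⊗ y.

Lemma pair_eltM x y x' y' : pair_elt x y * pair_elt x' y' = pair_elt (x * x') (y * y').
Proof. by rewrite /pair_elt pureM. Qed.

Lemma pair_ext (D : lmodType k) (f g : pair_alg -> D) : linear f -> linear g ->
  (forall x y, f (pair_elt x y) = g (pair_elt x y)) -> f =1 g.
Proof. exact: tensor_ext. Qed.

Definition pair1 (x : N^c) : pair_alg := pair_elt x 1.
Definition pair2 (y : N) : pair_alg := pair_elt 1 y.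

Lemma pair1_algebra_map : algebra_map pair1.
Proof. exact: pure1r_algebra_map. Qed.
Lemma pair2_algebra_map : algebra_map pair2.
Proof. exact: pure1l_algebra_map. Qed.
Lemma pair1_linear : linear pair1. Proof. by case: pair1_algebra_map. Qed.
Lemma pair2_linear : linear pair2. Proof. by case: pair2_algebra_map. Qed.

Definition sandwich_pair (r : N) : pair_alg -> N := sandwich2 r.
Lemma sandwich_pair_linear r : linear (sandwich_pair r).
Proof. exact: sandwich2_linear. Qed.
Lemma sandwich_pairE r x y : sandwich_pair r (pair_elt x y) = fromop x * r * y.
Proof. exact: sandwich2_pure. Qed.
Lemma sandwich_pair1 (r : N) : sandwich_pair r 1 = r.
Proof. by rewrite [LHS]sandwich_pairE fromop1 mulr1 mul1r. Qed.
Lemma sandwich_pair_linear1 C : linear (fun r => sandwich_pair r C).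
Proof.
apply: linear_tlift => x y /=; rewrite /sand_xy; linear_tac.
Qed.

Lemma sandwich_pair_mul1 r C y : sandwich_pair r (C * pair1 (toop y)) = y * sandwich_pair r C.
Proof.
move: C; apply: pair_ext => [||x z].
- by apply: (comp_linear (sandwich_pair_linear r)); apply: mulr_linear.
- by apply: linear_mull; apply: sandwich_pair_linear.
- by rewrite pair_eltM !sandwich_pairE mulr1 fromopM toopK !mulrA.
Qed.

Lemma sandwich_pair_mul2 r C y : sandwich_pair r (C * pair2 y) = sandwich_pair r C * y.
Proof.
move: C; apply: pair_ext => [||x z].
- by apply: (comp_linear (sandwich_pair_linear r)); apply: mulr_linear.
- by apply: linear_mulr; apply: sandwich_pair_linear.
- by rewrite pair_eltM !sandwich_pairE mulr1 !mulrA.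
Qed.

Variable H : pzAlgType k.
Implicit Types p q u v : H -> N.

Definition in1 p : H -> pair_alg := fun h => pair1 (toop (p h)).
Definition in2 p : H -> pair_alg := fun h => pair2 (p h).

Lemma in1_map p : algebra_antimap p -> algebra_map (in1 p).
Proof. by move/antimap_toop; apply: comp_algebra_map pair1_algebra_map. Qed.
Lemma in2_map p : algebra_map p -> algebra_map (in2 p).
Proof. exact: comp_algebra_map pair2_algebra_map. Qed.
Lemma in1_linear p : linear p -> linear (in1 p).
Proof. by move=> pL; apply: (comp_linear pair1_linear). Qed.
Lemma in2_linear p : linear p -> linear (in2 p).
Proof. by move=> pL; apply: (comp_linear pair2_linear). Qed.

Lemma in12_comm p q : commuting (in1 p) (in2 q).
Proof. by move=> a b; rewrite !pair_eltM !mul1r !mulr1. Qed.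
Lemma in1_comm p q : commuting p q -> commuting (in1 p) (in1 q).
Proof. by move=> pq a b; rewrite !pair_eltM !mul1r -!toopM pq. Qed.
Lemma in2_comm p q : commuting p q -> commuting (in2 p) (in2 q).
Proof. by move=> pq a b; rewrite !pair_eltM !mul1r pq. Qed.

Lemma sandwich_pair_sand4 p q u v r A C :
  linear p -> linear q -> linear u -> linear v ->
  sandwich_pair (sand4 p q u v r A) C
  = sandwich_pair r (ten2 (in1 p) (ten2 (in1 q) (ten2 (in2 u) (in2 v))) A * C).
Proof.
move=> pL qL uL vL; have p1 := in1_linear pL; have q1 := in1_linear qL.
have u2 := in2_linear uL; have v2 := in2_linear vL.
have uv := ten2_linear u2 v2; have quv := ten2_linear q1 uv.
move: A; apply: linear_tensor_ext4 => [||a b c d].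
- by apply: (comp_linear (sandwich_pair_linear1 C)); apply: sand4_linear.
- apply: (comp_linear (sandwich_pair_linear r)); apply: linear_mulr.
  exact: ten2_linear.
rewrite !ten2_pure // sand4_pure //.
move: C; apply: pair_ext => [||x y].
- exact: sandwich_pair_linear.
- by apply: (comp_linear (sandwich_pair_linear r)); apply: mull_linear.
- by rewrite !pair_eltM !sandwich_pairE !mulr1 !mul1r !fromopM !toopK !mulrA.
Qed.

Lemma sandwich_pair_cap p q r X C : linear p -> linear q ->
  sandwich_pair r (ten2 (in1 p) (in2 q) X * C) = sandwich_pair (sand2 p q r X) C.
Proof.
move=> pL qL; have p1 := in1_linear pL; have q2 := in2_linear qL.
move: X; apply: tensor_ext => [||a b].
- apply: (comp_linear (sandwich_pair_linear r)); apply: linear_mulr.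
  exact: ten2_linear.
- by apply: (comp_linear (sandwich_pair_linear1 C)); apply: sand2_linear.
rewrite !ten2_pure // sand2_pure //.
move: C; apply: pair_ext => [||x y].
- by apply: (comp_linear (sandwich_pair_linear r)); apply: mull_linear.
- exact: sandwich_pair_linear.
- by rewrite !pair_eltM !sandwich_pairE !mulr1 !mul1r !fromopM !toopK !mulrA.
Qed.

End PairAlgebra.

Lemma ten2_toop (k : fieldType) (N : pzAlgType k) (A B : lmodType k)
    (p : A -> N) (q : B -> N) X : linear p -> linear q -> commuting p q ->
  ten2 (fun a => toop (p a)) (fun b => toop (q b)) X = toop (ten2 p q X).
Proof.
move=> pL qL pq; have pL' : linear (fun a => toop (p a)) by [].
have qL' : linear (fun a => toop (q a)) by [].
have l := ten2_linear pL qL; have l' : linear (fun X => toop (ten2 p q X)) by [].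
move: X; apply: tensor_ext => // [|a b]; first exact: ten2_linear.
by rewrite !ten2_pure //; apply: (esym (pq a b)).
Qed.

Lemma algebra_map_ten2 (k : fieldType) (E E' : pzAlgType k) (A B : lmodType k)
    (j : E -> E') (u : A -> E) (v : B -> E) X :
  algebra_map j -> linear u -> linear v ->
  j (ten2 u v X) = ten2 (fun a => j (u a)) (fun b => j (v b)) X.
Proof.
move=> [jL [_ jM]] uL vL; have juL := comp_linear jL uL; have jvL := comp_linear jL vL.
move: X; apply: tensor_ext => [||a b].
- by apply: (comp_linear jL); apply: ten2_linear.
- exact: ten2_linear.
- by rewrite !ten2_pure.
Qed.

Lemma algebra_map_sand4 (k : fieldType) (E E' : pzAlgType k) (A : lmodType k)
    (j : E -> E') (p q u v : A -> E) r X :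
  algebra_map j -> linear p -> linear q -> linear u -> linear v ->
  j (sand4 p q u v r X) = sand4 (fun a => j (p a)) (fun a => j (q a))
    (fun a => j (u a)) (fun a => j (v a)) (j r) X.
Proof.
move=> [jL [_ jM]] pL qL uL vL; have jpL := comp_linear jL pL.
have jqL := comp_linear jL qL; have juL := comp_linear jL uL.
have jvL := comp_linear jL vL.
move: X; apply: linear_tensor_ext4 => [||a b c d].
- by apply: (comp_linear jL); apply: sand4_linear.
- exact: sand4_linear.
- by rewrite !sand4_pure // !jM.
Qed.

Section Associativity.
Variables (k : fieldType) (H : pzAlgType k) (Q : quasi_hopf H) (N : pzAlgType k).
Local Notation D := (comul Q).
Local Notation Phi := (reass Q).
Local Notation S := (antipode Q).
Local Notation al := (qalpha Q).
Variables j1 j2 j3 : H -> N.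
Hypotheses (j1A : algebra_map j1) (j2A : algebra_map j2) (j3A : algebra_map j3).
Hypotheses (j12 : commuting j1 j2) (j13 : commuting j1 j3) (j23 : commuting j2 j3).

Local Notation j1S := (fun h => j1 (S h)).
Local Notation j2S := (fun h => j2 (S h)).
Local Notation j3S := (fun h => j3 (S h)).

Let j1L : linear j1. Proof. by case: j1A. Qed.
Let j2L : linear j2. Proof. by case: j2A. Qed.
Let j3L : linear j3. Proof. by case: j3A. Qed.
Let SL := @antipode_linear _ _ Q.
Let j1SL : linear j1S. Proof. exact: comp_linear j1L SL. Qed.
Let j2SL : linear j2S. Proof. exact: comp_linear j2L SL. Qed.
Let j3SL : linear j3S. Proof. exact: comp_linear j3L SL. Qed.
Let j1SA : algebra_antimap j1S.
Proof. by case: (antipodal_comp j1A (antipodal_id Q)). Qed.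
Let j2SA : algebra_antimap j2S.
Proof. by case: (antipodal_comp j2A (antipodal_id Q)). Qed.
Let j3SA : algebra_antimap j3S.
Proof. by case: (antipodal_comp j3A (antipodal_id Q)). Qed.
Let S12 : commuting j1S j2S. Proof. by move=> a b; apply: j12. Qed.
Let S13 : commuting j1S j3S. Proof. by move=> a b; apply: j13. Qed.
Let S23 : commuting j2S j3S. Proof. by move=> a b; apply: j23. Qed.

Local Notation f12 := (prod_map Q j1 j2).
Local Notation f23 := (prod_map Q j2 j3).
Local Notation g12 := (prod_antimap Q j1 j2).
Local Notation g23 := (prod_antimap Q j2 j3).
Local Notation rho12 := (prod_cap Q j1 j2).
Local Notation rho23 := (prod_cap Q j2 j3).

Let f12L : linear f12. Proof. by case: (prod_map_algebra_map Q j1A j2A j12). Qed.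
Let f23L : linear f23. Proof. by case: (prod_map_algebra_map Q j2A j3A j23). Qed.
Let g12L : linear g12. Proof. by case: (prod_antimap_algebra_antimap Q j1A j2A j12). Qed.
Let g23L : linear g23. Proof. by case: (prod_antimap_algebra_antimap Q j2A j3A j23). Qed.

(** The formula of [prod_cap] for the factors [f12] and [j3]. It is spelled out because the antipode
    along [f12] is [g12] with alpha [rho12], not the composite of [f12] with S; similarly for [f23]
    below. *)
Definition prod_cap_left : N := sand4 j3S g12 f12 j3 (rho12 * j3 al) (drinfeld_A Q).
Definition prod_cap_right : N := sand4 g23 j1S j1 f23 (j1 al * rho23) (drinfeld_A Q).

Local Notation al123 := (j1 al * j2 al * j3 al).

(** The antipode letters come in reverse order, so the pairs are nested: [c d] belongs to [j1],
    [b e] to [j2] and [a f] to [j3]. *)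
Let L := letter Q [:: in1 j3S; in1 j2S; in1 j1S; in2 j1; in2 j2; in2 j3].

Ltac comm_pair := match goal with
  | |- commuting (in1 _) (in2 _) => exact: in12_comm
  | |- commuting (in2 _) (in1 _) => apply: commutingC; exact: in12_comm
  | |- commuting (in1 _) (in1 _) => apply: in1_comm;
      first [assumption | refine (commutingC _); assumption]
  | |- commuting (in2 _) (in2 _) => apply: in2_comm;
      first [assumption | refine (commutingC _); assumption] end.

Let Lhom n : algebra_map (L n).
Proof.
move: n; rewrite /L /letter; case=> [|[|[|[|[|[|n]]]]]] /=;
  rewrite ?nth_nil; first
  [ exact: unit_letter_algebra_map | by apply: in1_map | by apply: in2_map ].
Qed.

Let Lcomm m n : m != n -> commuting (L m) (L n).
Proof.
move: m n; rewrite /L /letter.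
case=> [|[|[|[|[|[|m]]]]]] [|[|[|[|[|[|n]]]]]] //= ?; rewrite ?nth_nil; first
  [ exact: commuting_unit_letter | exact: (commutingC (commuting_unit_letter _ _))
  | comm_pair ].
Qed.

Local Notation a := (Letter 0).
Local Notation b := (Letter 1).
Local Notation c := (Letter 2).
Local Notation d := (Letter 3).
Local Notation e := (Letter 4).
Local Notation f := (Letter 5).

Let in2_f12 : in2 f12 = wmap Q L (d ∙ e).
Proof. by apply: funext => h; apply: (algebra_map_ten2 _ (pair2_algebra_map N)). Qed.
Let in2_f23 : in2 f23 = wmap Q L (e ∙ f).
Proof. by apply: funext => h; apply: (algebra_map_ten2 _ (pair2_algebra_map N)). Qed.
Let in1_g12 : in1 g12 = wmap Q L (b ∙ c).
Proof.
apply: funext => h; rewrite /in1 -[LHS]/(pair1 (toop (ten2 j2S j1S (D h)))).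
rewrite -ten2_toop //; last exact: commutingC.
by rewrite (algebra_map_ten2 _ (pair1_algebra_map N)).
Qed.
Let in1_g23 : in1 g23 = wmap Q L (a ∙ b).
Proof.
apply: funext => h; rewrite /in1 -[LHS]/(pair1 (toop (ten2 j3S j2S (D h)))).
rewrite -ten2_toop //; last exact: commutingC.
by rewrite (algebra_map_ten2 _ (pair1_algebra_map N)).
Qed.

Let V := sandwich_pair al123.
Let VL : linear V. Proof. exact: sandwich_pair_linear. Qed.

Let left_cd : lefteq V (wmap Q L (c ∙ d)) (wmap Q L Unit).
Proof.
move=> h C; rewrite [wmap Q L (c ∙ d) h]/= /V [LHS]sandwich_pair_cap //.
rewrite -sand2_mulr //; last by move=> x; rewrite j13.
rewrite -sand2_mulr //; last by move=> x; rewrite j12.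
have [_ _ -> _ _ _] := antipodal_comp j1A (antipodal_id Q).
by rewrite -!pzAl (linfZ (sandwich_pair_linear1 C)) mul1r (linfZ (sandwich_pair_linear _)).
Qed.

Let prod_cap_leftE : prod_cap_left = V (Phi3 Q L b c d * Phi3V Q L (b ∙ c) d e
  * (Phi3 Q L a (b ∙ c) (d ∙ e) * Phi3V Q L (a ∙ (b ∙ c)) (d ∙ e) f)).
Proof.
rewrite -[LHS]sandwich_pair1 sandwich_pair_sand4 // mulr1 in2_f12 in1_g12.
rewrite sand4_mulr //; try by move=> ?; rewrite ?j13 ?j23.
rewrite [LHS]sandwich_pair_sand4 //.
by congr (V (_ * _)); [exact: (ten4_A Q Lhom Lcomm (x := b) (y := c) (z := d) (w := e))
  | exact: (ten4_A Q Lhom Lcomm (x := a) (y := b ∙ c) (z := d ∙ e) (w := f))].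
Qed.

Let prod_cap_rightE : prod_cap_right = V (Phi3 Q L a b e * Phi3V Q L (a ∙ b) e f
  * (Phi3 Q L (a ∙ b) c d * Phi3V Q L (a ∙ b ∙ c) d (e ∙ f))).
Proof.
rewrite -[LHS]sandwich_pair1 sandwich_pair_sand4 // mulr1 in2_f23 in1_g23.
rewrite sand4_mull //; try by move=> ?; rewrite ?j13 ?j12.
rewrite mulrA [LHS]sandwich_pair_sand4 //.
by congr (V (_ * _)); [exact: (ten4_A Q Lhom Lcomm (x := a) (y := b) (z := e) (w := f))
  | exact: (ten4_A Q Lhom Lcomm (x := a ∙ b) (y := c) (z := d) (w := e ∙ f))].
Qed.

(** [assoc_contract] with its last two factors pulled out. Each of them lies in a single slot and
    stands at the right end of the word, so it becomes an outermost factor of the value, on the left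
    for slot 1 and on the right for slot 2. *)
Lemma prod_cap_assoc : prod_cap_left
  = ten2 j3S (ten2 j2S j1S) (inv Phi) * prod_cap_right * ten2 j1 (ten2 j2 j3) Phi.
Proof.
rewrite prod_cap_leftE -(assoc_contract Lhom Lcomm VL left_cd) mulrA.
have -> : Phi3 Q L d e f = pair2 (ten2 j1 (ten2 j2 j3) Phi).
  rewrite [RHS](algebra_map_ten2 _ (pair2_algebra_map N)) //; last exact: ten2_linear.
  congr (ten2 _ _ Phi); apply: funext => x.
  by rewrite [RHS](algebra_map_ten2 _ (pair2_algebra_map N)).
rewrite [LHS]sandwich_pair_mul2; congr (_ * _).
have -> : Phi3V Q L a b c = pair1 (toop (ten2 j3S (ten2 j2S j1S) (inv Phi))).
  have c21 := commutingC S12; have l21 := ten2_linear j2SL j1SL.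
  rewrite -ten2_toop //; last first.
    by apply: commuting_ten2r => //; apply: commutingC.
  rewrite [RHS](algebra_map_ten2 _ (pair1_algebra_map N)) //.
  congr (ten2 _ _ (inv Phi)); apply: funext => x.
  rewrite -ten2_toop //.
  by rewrite [RHS](algebra_map_ten2 _ (pair1_algebra_map N)).
by rewrite [LHS]sandwich_pair_mul1 prod_cap_rightE.
Qed.

End Associativity.

(** * The Drinfeld twist *)

Section Twist.
Variables (k : fieldType) (H : pzAlgType k) (Q : quasi_hopf H).
Local Notation D := (comul Q).
Local Notation S := (antipode Q).
Local Notation al := (qalpha Q).
Local Notation be := (qbeta Q).
Local Notation twist := (drinfeld_twist Q).

Definition tens_l (h : H) : H ⊗ H := h ⊗ 1.
Definition tens_r (h : H) : H ⊗ H := 1 ⊗ h.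

Lemma tens_l_map : algebra_map tens_l. Proof. exact: pure1r_algebra_map. Qed.
Lemma tens_r_map : algebra_map tens_r. Proof. exact: pure1l_algebra_map. Qed.
Lemma tens_lr_comm : commuting tens_l tens_r.
Proof. by move=> a b; rewrite !pureM !mul1r !mulr1. Qed.
Let lL : linear tens_l. Proof. by case: tens_l_map. Qed.
Let rL : linear tens_r. Proof. by case: tens_r_map. Qed.

Let SL := @antipode_linear _ _ Q.
Let DA := comul_algebra_map Q.
Let DL : linear D. Proof. by case: DA. Qed.

Local Notation g2 := (prod_antimap Q tens_l tens_r).
Local Notation gam := (prod_cap Q tens_l tens_r).

Lemma antipodal_comul : antipodal Q D (fun h => D (S h)) (D al) (D be).
Proof. exact: antipodal_comp DA (antipodal_id Q). Qed.

Lemma prod_map_comul : prod_map Q tens_l tens_r = D.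
Proof.
apply: funext => h; rewrite /prod_map; move: (D h); apply: tensor_ext => [||a b].
- exact: ten2_linear.
- by [].
- by rewrite ten2_pure // pureM mulr1 mul1r.
Qed.

Lemma antipodal_comul_prod : antipodal Q D g2 gam (prod_cup Q tens_l tens_r).
Proof.
rewrite -[X in antipodal _ X]prod_map_comul.
exact: antipodal_prod tens_l_map tens_r_map tens_lr_comm.
Qed.

Lemma prod_antimap_comul h : g2 h = tmap S S (tswap (D h)).
Proof.
have SrL : linear (j2S Q tens_r) by apply: comp_linear rL SL.
have SlL : linear (j1S Q tens_l) by apply: comp_linear lL SL.
rewrite /prod_antimap; move: (D h); apply: tensor_ext => [||a b].
- exact: ten2_linear.
- by apply: comp_linear; [apply: tmap_linear | apply: tswap_linear].
- by rewrite ten2_pure // tswap_pure tmap_pure // pureM mulr1 mul1r.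
Qed.

Lemma drinfeld_gammaE : drinfeld_gamma Q = gam.
Proof.
rewrite /drinfeld_gamma /prod_cap /sand4; congr (tlift _ _); apply: funext => A1.
apply: funext => A234; congr (tlift _ _); apply: funext => A2; apply: funext => A34.
congr (tlift _ _); apply: funext => A3; apply: funext => A4.
by rewrite /j1S /j2S /tens_l /tens_r !pureM !(mulr1, mul1r).
Qed.

(** Splitting Delta(x2 beta S(x3)) by multiplicativity exhibits f as the comparison element from the
    antipode Delta S to the product antipode, with gamma as the new alpha. *)
Lemma drinfeld_twistE : twist = transport Q D (fun h => D (S h)) g2 (D be) gam.
Proof.
have [_ [_ DM]] := DA.
rewrite /drinfeld_twist /transport /sand3 drinfeld_gammaE.
congr (tlift _ _); apply: funext => x1; apply: funext => x23.
congr (tlift _ _); apply: funext => x2; apply: funext => x3.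
by rewrite !DM prod_antimap_comul !mulrA.
Qed.

Lemma drinfeld_twist_invertible : invertible twist.
Proof.
rewrite drinfeld_twistE; eexists.
exact: transport_inv antipodal_comul antipodal_comul_prod.
Qed.

Lemma drinfeld_twist_antipode h : twist * D (S h) = g2 h * twist.
Proof.
rewrite drinfeld_twistE; have [_ gA cap _ _ _] := antipodal_comul_prod.
exact: (transport_intertwine antipodal_comul gA cap).
Qed.

Lemma drinfeld_twist_alpha : twist * D al = gam.
Proof.
rewrite drinfeld_twistE; have [_ gA cap _ _ _] := antipodal_comul_prod.
exact: (transport_cap antipodal_comul gA cap).
Qed.

End Twist.

(* The cocycle identity, in an algebra N with commuting maps j1, j2, j3 from H:
   both sides intertwine the same two antipodes along [h |-> j1(h1) j2(h2) j3(h3)]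
   and move the first alpha to the second, so they agree by uniqueness. *)
Section Cocycle.
Variables (k : fieldType) (H : pzAlgType k) (Q : quasi_hopf H) (N : pzAlgType k).
Local Notation D := (comul Q).
Local Notation Phi := (reass Q).
Local Notation S := (antipode Q).
Local Notation al := (qalpha Q).
Local Notation be := (qbeta Q).
Local Notation twist := (drinfeld_twist Q).
Variables j1 j2 j3 : H -> N.
Hypotheses (j1A : algebra_map j1) (j2A : algebra_map j2) (j3A : algebra_map j3).
Hypotheses (j12 : commuting j1 j2) (j13 : commuting j1 j3) (j23 : commuting j2 j3).

Local Notation j1S := (fun h => j1 (S h)).
Local Notation j2S := (fun h => j2 (S h)).
Local Notation j3S := (fun h => j3 (S h)).
Local Notation f12 := (prod_map Q j1 j2).
Local Notation f23 := (prod_map Q j2 j3).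
Local Notation g12 := (prod_antimap Q j1 j2).
Local Notation g23 := (prod_antimap Q j2 j3).

Let SL := @antipode_linear _ _ Q.
Let DA := comul_algebra_map Q.
Let DL : linear D. Proof. by case: DA. Qed.
Let j1L : linear j1. Proof. by case: j1A. Qed.
Let j2L : linear j2. Proof. by case: j2A. Qed.
Let j3L : linear j3. Proof. by case: j3A. Qed.
Let j1SL : linear j1S. Proof. exact: comp_linear j1L SL. Qed.
Let j2SL : linear j2S. Proof. exact: comp_linear j2L SL. Qed.
Let j3SL : linear j3S. Proof. exact: comp_linear j3L SL. Qed.

Let f12A := prod_map_algebra_map Q j1A j2A j12.
Let f23A := prod_map_algebra_map Q j2A j3A j23.
Let f12L : linear f12. Proof. by case: f12A. Qed.
Let f23L : linear f23. Proof. by case: f23A. Qed.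
Let g12L : linear g12. Proof. by case: (prod_antimap_algebra_antimap Q j1A j2A j12). Qed.
Let g23L : linear g23. Proof. by case: (prod_antimap_algebra_antimap Q j2A j3A j23). Qed.

(** When [j1], [j2], [j3] are the three embeddings into the third tensor power of H, the four maps
    send f to f ⊗ 1, 1 ⊗ f, (Delta ⊗ id)(f) and (id ⊗ Delta)(f). *)
Let phi12 := ten2 j1 j2.
Let phi23 := ten2 j2 j3.
Let phi12_3 := ten2 f12 j3.
Let phi1_23 := ten2 j1 f23.

Let phi12A : algebra_map phi12. Proof. exact: ten2_algebra_map. Qed.
Let phi23A : algebra_map phi23. Proof. exact: ten2_algebra_map. Qed.
Let f12_3 : commuting f12 j3.
Proof. by apply: commutingC => a h; apply: intertwine_ten2 => // x; rewrite ?j13 ?j23. Qed.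
Let f1_23 : commuting j1 f23.
Proof. by move=> a h; apply: intertwine_ten2. Qed.
Let phi12_3A : algebra_map phi12_3. Proof. exact: ten2_algebra_map. Qed.
Let phi1_23A : algebra_map phi1_23. Proof. exact: ten2_algebra_map. Qed.

Local Notation G := (ten2 j3S (ten2 j2S j1S)).
Local Notation F := (ten2 j1 (ten2 j2 j3)).

Lemma prod_antimap_nat (i1 i2 : H -> N) h : algebra_map i1 -> algebra_map i2 ->
  commuting i1 i2 ->
  ten2 i1 i2 (prod_antimap Q (@tens_l k H) (@tens_r k H) h) = prod_antimap Q i1 i2 h.
Proof.
move=> i1A i2A i12; have [i1L [i11 _]] := i1A; have [i2L [i21 _]] := i2A.
have tA := ten2_algebra_map i1A i2A i12.
have [lL _] := tens_l_map H; have [rL _] := tens_r_map H.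
rewrite {1}/prod_antimap (algebra_map_ten2 _ tA); last 2 first.
- exact: (comp_linear rL SL).
- exact: (comp_linear lL SL).
congr (ten2 _ _ _); apply: funext => x.
  by rewrite /j2S /tens_r ten2_pure // i11 mul1r.
by rewrite /j1S /tens_l ten2_pure // i21 mulr1.
Qed.

Lemma prod_cap_nat (i1 i2 : H -> N) : algebra_map i1 -> algebra_map i2 ->
  commuting i1 i2 ->
  ten2 i1 i2 (prod_cap Q (@tens_l k H) (@tens_r k H)) =
  sand4 (fun h => i2 (S h)) (fun h => i1 (S h)) i1 i2 (i1 al * i2 al) (drinfeld_A Q).
Proof.
move=> i1A i2A i12; have [i1L [i11 _]] := i1A; have [i2L [i21 _]] := i2A.
have tA := ten2_algebra_map i1A i2A i12; have [_ [_ tM]] := tA.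
have [lL _] := tens_l_map H; have [rL _] := tens_r_map H.
have tl x : ten2 i1 i2 (tens_l x) = i1 x by rewrite /tens_l ten2_pure // i21 mulr1.
have tr x : ten2 i1 i2 (tens_r x) = i2 x by rewrite /tens_r ten2_pure // i11 mul1r.
rewrite {1}/prod_cap (algebra_map_sand4 _ _ tA) //; last 2 first.
- exact: (comp_linear rL SL).
- exact: (comp_linear lL SL).
rewrite tM tl tr; congr (sand4 _ _ _ _ _ _); apply: funext => x;
  by rewrite /j1S /j2S ?tl ?tr.
Qed.

Lemma sand4_intertwine (p p' q q' u v : H -> N) r x X :
  linear p -> linear p' -> linear q -> linear q' -> linear u -> linear v ->
  intertwine x p p' -> intertwine x q q' ->
  x * sand4 p q u v r X = sand4 p' q' u v (x * r) X.
Proof.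
move=> pL p'L qL q'L uL vL xp xq; move: X; apply: linear_tensor_ext4 => [||a b c d].
- by apply: linear_mull; apply: sand4_linear.
- exact: sand4_linear.
- by rewrite !sand4_pure // !mulrA xq -(mulrA (q' b)) xp !mulrA.
Qed.

Let phi12M : {morph phi12 : x y / x * y}. Proof. by case: phi12A => _ []. Qed.
Let phi23M : {morph phi23 : x y / x * y}. Proof. by case: phi23A => _ []. Qed.
Let phi12_3M : {morph phi12_3 : x y / x * y}. Proof. by case: phi12_3A => _ []. Qed.
Let phi1_23M : {morph phi1_23 : x y / x * y}. Proof. by case: phi1_23A => _ []. Qed.

Let j3_phi12 x : intertwine (phi12 x) j3 j3.
Proof. by move=> h; rewrite -(@commuting_ten2r _ _ _ _ _ j3 j1 j2) //; apply: commutingC. Qed.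
Let j1_phi23 x : intertwine (phi23 x) j1 j1.
Proof. by move=> h; rewrite -(@commuting_ten2r _ _ _ _ _ j1 j2 j3). Qed.

Let f12SL : linear (fun h => f12 (S h)). Proof. exact: comp_linear f12L SL. Qed.
Let f23SL : linear (fun h => f23 (S h)). Proof. exact: comp_linear f23L SL. Qed.

Let twist12 : intertwine (phi12 twist) (fun h => f12 (S h)) g12.
Proof.
by move=> h; rewrite -[f12 _]/(phi12 _) -phi12M drinfeld_twist_antipode phi12M [phi12 (prod_antimap _ _ _ _)]prod_antimap_nat.
Qed.
Let twist23 : intertwine (phi23 twist) (fun h => f23 (S h)) g23.
Proof.
by move=> h; rewrite -[f23 _]/(phi23 _) -phi23M drinfeld_twist_antipode phi23M [phi23 (prod_antimap _ _ _ _)]prod_antimap_nat.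
Qed.

Let left_antipode h : phi12 twist * phi12_3 twist * phi12_3 (D (S h))
  = ten2 j3S g12 (D h) * (phi12 twist * phi12_3 twist).
Proof.
rewrite -mulrA -phi12_3M drinfeld_twist_antipode phi12_3M !mulrA [phi12_3 (prod_antimap _ _ _ _)]prod_antimap_nat //.
congr (_ * _); apply: intertwine_ten2 => // x.
exact: j3_phi12.
Qed.

Let left_alpha : phi12 twist * phi12_3 twist * phi12_3 (D al) = prod_cap_left Q j1 j2 j3.
Proof.
rewrite -mulrA -phi12_3M drinfeld_twist_alpha [phi12_3 _]prod_cap_nat //.
rewrite (@sand4_intertwine _ j3S _ g12) //; last by move=> x; apply: j3_phi12.
rewrite mulrA -[f12 al]/(phi12 _) -phi12M drinfeld_twist_alpha.
by rewrite /phi12 prod_cap_nat.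
Qed.

Let right_antipode h : phi23 twist * phi1_23 twist * phi1_23 (D (S h))
  = ten2 g23 j1S (D h) * (phi23 twist * phi1_23 twist).
Proof.
rewrite -mulrA -phi1_23M drinfeld_twist_antipode phi1_23M !mulrA [phi1_23 (prod_antimap _ _ _ _)]prod_antimap_nat //.
congr (_ * _); apply: intertwine_ten2 => // x.
exact: j1_phi23.
Qed.

Let right_alpha : phi23 twist * phi1_23 twist * phi1_23 (D al) = prod_cap_right Q j1 j2 j3.
Proof.
rewrite -mulrA -phi1_23M drinfeld_twist_alpha [phi1_23 _]prod_cap_nat //.
rewrite (@sand4_intertwine _ g23 _ j1S) //; last by move=> x; apply: j1_phi23.
rewrite mulrA j1_phi23 -mulrA -[f23 al]/(phi23 _) -phi23M drinfeld_twist_alpha.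
by rewrite /phi23 prod_cap_nat.
Qed.

Let F_intertwine h : F Phi * phi12_3 (D h) = phi1_23 (D h) * F Phi.
Proof.
pose L := letter Q [:: j1; j2; j3].
have Lhom n : algebra_map (L n).
  move: n; rewrite /L /letter; case=> [|[|[|n]]] //=; rewrite nth_nil.
  exact: unit_letter_algebra_map.
have Lcomm m n : m != n -> commuting (L m) (L n).
  move: m n; rewrite /L /letter; case=> [|[|[|m]]] [|[|[|n]]] //= _;
  rewrite ?nth_nil; first [ exact: commuting_unit_letter
  | exact: (commutingC (commuting_unit_letter _ _)) | exact: commutingC | by [] ].
exact: (@Phi3_intertwine _ _ Q _ L Lhom Lcomm (Letter 0) (Letter 1) (Letter 2) isT h).
Qed.

(** The maps [j1S], [j2S], [j3S] become algebra maps into the opposite of [N], where this is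
    [Phi3V_intertwine]. Reading the result back in [N] reverses both sides. *)
Let G_intertwine h : G (inv Phi) * ten2 g23 j1S (D h) = ten2 j3S g12 (D h) * G (inv Phi).
Proof.
pose L := letter Q [:: (fun h => toop (j3S h)); (fun h => toop (j2S h)); (fun h => toop (j1S h))].
have SA (i : H -> N) : algebra_map i -> algebra_map (fun h => toop (i (S h))).
  move=> iA; apply: (@antimap_toop k H N (fun h => i (S h))).
  by case: (antipodal_comp iA (antipodal_id Q)).
have SC (i j : H -> N) : commuting i j -> commuting (fun h => toop (i (S h))) (fun h => toop (j (S h))).
  by move=> ij x y; apply: (esym (ij (S x) (S y))).
have Lhom n : algebra_map (L n).
  move: n; rewrite /L /letter; case=> [|[|[|n]]] /=; [exact: SA|exact: SA|exact: SA|].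
  by rewrite nth_nil; exact: unit_letter_algebra_map.
have Lcomm m n : m != n -> commuting (L m) (L n).
  move: m n; rewrite /L /letter; case=> [|[|[|m]]] [|[|[|n]]] //= _;
  rewrite ?nth_nil; first [ exact: commuting_unit_letter
  | exact: (commutingC (commuting_unit_letter _ _)) | apply: SC; exact: commutingC
  | by apply: SC ].
have i := @Phi3V_intertwine _ _ Q _ L Lhom Lcomm (Letter 0) (Letter 1) (Letter 2) isT h.
have c12 : commuting j2S j1S by move=> x y; rewrite j12.
have c23 : commuting j3S j2S by move=> x y; rewrite j23.
have c13 : commuting j3S j1S by move=> x y; rewrite j13.
have l12 := ten2_linear j2SL j1SL.
have e12 : wmap Q L (Letter 1 ∙ Letter 2) = (fun h => toop (g12 h)).
  by apply: funext => x; apply: ten2_toop.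
have e23 : wmap Q L (Letter 0 ∙ Letter 1) = (fun h => toop (g23 h)).
  by apply: funext => x; apply: ten2_toop.
have c3 : commuting j3S g12.
  by move=> x y; apply: (@intertwine_ten2 _ _ _ _ (j3S x)) => // z; rewrite ?c23 ?c13.
have c1 : commuting g23 j1S.
  apply: commutingC => x y.
  by apply: (@intertwine_ten2 _ _ _ _ (j1S x)) => // z; rewrite -?c12 -?c13.
have e1_23 : wmap Q L (Letter 0 ∙ (Letter 1 ∙ Letter 2)) h = toop (ten2 j3S g12 (D h)).
  by rewrite -ten2_toop // -e12.
have e12_3 : wmap Q L (Letter 0 ∙ Letter 1 ∙ Letter 2) h = toop (ten2 g23 j1S (D h)).
  by rewrite -ten2_toop // -e23.
have eG : Phi3V Q L (Letter 0) (Letter 1) (Letter 2) = toop (G (inv Phi)).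
  rewrite -ten2_toop //; last exact: commuting_ten2r.
  by congr (ten2 _ _ (inv Phi)); apply: funext => x; apply: ten2_toop.
move: i; rewrite e1_23 e12_3 eG => i; exact: (esym i).
Qed.

Theorem twist_cocycle : phi12 twist * phi12_3 twist
  = G (inv Phi) * (phi23 twist * phi1_23 twist) * F Phi.
Proof.
have T := antipodal_comp (comp_algebra_map phi12_3A DA) (antipodal_id Q).
have gL : linear (fun h => ten2 j3S g12 (D h)).
  exact: (comp_linear (ten2_linear j3SL g12L) DL).
transitivity (transport Q (fun h => phi12_3 (D h)) (fun h => phi12_3 (D (S h)))
   (fun h => ten2 j3S g12 (D h)) (phi12_3 (D be)) (prod_cap_left Q j1 j2 j3)).
  exact: (transport_unique T gL left_antipode left_alpha).
(* For the right-hand side, [F Phi] passes to the bracketing 1(23), the two twists act there, and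
   [G (inv Phi)] returns to (12)3. That alpha is sent to the alpha of (12)3 is [prod_cap_assoc]. *)
apply/esym/(transport_unique T gL) => [h|].
  rewrite -mulrA F_intertwine -!mulrA (mulrA (phi1_23 twist)) (mulrA (phi23 twist)).
  rewrite (mulrA (phi23 twist)) right_antipode !mulrA G_intertwine.
  by [].
rewrite -mulrA F_intertwine !mulrA -(mulrA (G _)) -(mulrA (G _)) right_alpha.
by rewrite (prod_cap_assoc Q j1A j2A j3A).
Qed.

End Cocycle.

(** * Reversal of comodule algebras *)

(* C is H^op and [sg] is S^-1; an abstract C spares the kernel the comparison of
   nested module structures on powers of [H^c]. *)
Section Reversal.
Variables (k : fieldType) (H B C : pzAlgType k) (sg : H -> C).
Hypothesis sgA : algebra_map sg.
Let sgL : linear sg. Proof. by case: sgA. Qed.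

Lemma pure_linear_l (V W : lmodType k) (w : W) : linear (fun v : V => v ⊗ w).
Proof. by move=> c x y; rewrite pure_linl. Qed.
Lemma pure_linear_r (V W : lmodType k) (v : V) : linear (fun w : W => v ⊗ w).
Proof. by move=> c x y; rewrite pure_linr. Qed.

Let m1l (A D : pzAlgType k) := @pure1l_algebra_map k A D.
Let m1r (A D : pzAlgType k) := @pure1r_algebra_map k A D.

(** In these names the first digit counts the tensor legs and the second is the leg that receives
    the argument. Writing the reversals as products of leg embeddings makes their multiplicativity
    an instance of [ten2_algebra_map]. *)
Definition c2_2 (x : H) : C ⊗ C := 1 ⊗ sg x.
Definition c2_1 (x : H) : C ⊗ C := sg x ⊗ 1.
Definition b2_2 (x : H) : B ⊗ C := 1 ⊗ sg x.
Definition b2_1 (b : B) : B ⊗ C := b ⊗ 1.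
Definition b3_3 (x : H) : B ⊗ C ⊗ C := 1 ⊗ c2_2 x.
Definition b3_2 (x : H) : B ⊗ C ⊗ C := 1 ⊗ c2_1 x.
Definition b3_1 (b : B) : B ⊗ C ⊗ C := b ⊗ 1.
Definition b4_4 (x : H) : B ⊗ C ⊗ C ⊗ C := 1 ⊗ (1 : C) ⊗ c2_2 x.
Definition b4_3 (x : H) : B ⊗ C ⊗ C ⊗ C := 1 ⊗ (1 : C) ⊗ c2_1 x.
Definition b4_2 (x : H) : B ⊗ C ⊗ C ⊗ C := 1 ⊗ sg x ⊗ (1 : C ⊗ C).
Definition b4_1 (b : B) : B ⊗ C ⊗ C ⊗ C := b ⊗ 1.

Let c2_2A : algebra_map c2_2. Proof. exact: (comp_algebra_map (m1l _ _) sgA). Qed.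
Let c2_1A : algebra_map c2_1. Proof. exact: (comp_algebra_map (m1r _ _) sgA). Qed.
Let b2_2A : algebra_map b2_2. Proof. exact: (comp_algebra_map (m1l _ _) sgA). Qed.
Let b2_1A : algebra_map b2_1. Proof. exact: m1r. Qed.
Let b3_3A : algebra_map b3_3. Proof. exact: (comp_algebra_map (m1l _ _) c2_2A). Qed.
Let b3_2A : algebra_map b3_2. Proof. exact: (comp_algebra_map (m1l _ _) c2_1A). Qed.
Let b3_1A : algebra_map b3_1. Proof. exact: m1r. Qed.
Let b4_4A : algebra_map b4_4.
Proof. exact: (comp_algebra_map (m1l _ _) (comp_algebra_map (m1l _ _) c2_2A)). Qed.
Let b4_3A : algebra_map b4_3.
Proof. exact: (comp_algebra_map (m1l _ _) (comp_algebra_map (m1l _ _) c2_1A)). Qed.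
Let b4_2A : algebra_map b4_2.
Proof. exact: (comp_algebra_map (m1l _ _) (comp_algebra_map (m1r _ _) sgA)). Qed.
Let b4_1A : algebra_map b4_1. Proof. exact: m1r. Qed.

Definition rev2 : H ⊗ H -> C ⊗ C := ten2 c2_2 c2_1.
Definition rev_coact : H ⊗ B -> B ⊗ C := ten2 b2_2 b2_1.
Definition rev3 : H ⊗ H ⊗ B -> B ⊗ C ⊗ C := ten2 b3_3 (ten2 b3_2 b3_1).
Definition rev4 : H ⊗ H ⊗ H ⊗ B -> B ⊗ C ⊗ C ⊗ C :=
  ten2 b4_4 (ten2 b4_3 (ten2 b4_2 b4_1)).

Let lin (A D : pzAlgType k) (j : A -> D) : algebra_map j -> linear j.
Proof. by case. Qed.

Lemma rev2_map : algebra_map rev2.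
Proof.
by apply: ten2_algebra_map => // x y; rewrite !pureM !mul1r !mulr1.
Qed.

Lemma rev_coact_map : algebra_map rev_coact.
Proof.
by apply: ten2_algebra_map => // x y; rewrite !pureM !mul1r !mulr1.
Qed.

Lemma rev3_map : algebra_map rev3.
Proof.
have c21 : commuting b3_2 b3_1 by move=> x y; rewrite !pureM !mul1r !mulr1.
apply: ten2_algebra_map => //; first exact: ten2_algebra_map.
by apply: commuting_ten2r; try exact: lin; move=> x y; rewrite !pureM !mul1r !mulr1.
Qed.

Lemma rev4_map : algebra_map rev4.
Proof.
have c21 : commuting b4_2 b4_1 by move=> x y; rewrite !pureM !mul1r !mulr1.
have c3 : commuting b4_3 (ten2 b4_2 b4_1).
  by apply: commuting_ten2r; try exact: lin; move=> x y; rewrite !pureM !mul1r !mulr1.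
have A21 := ten2_algebra_map b4_2A b4_1A c21.
have A321 := ten2_algebra_map b4_3A A21 c3.
apply: ten2_algebra_map => //; apply: commuting_ten2r; try exact: lin.
  by move=> x y; rewrite !pureM !mul1r !mulr1.
by apply: commuting_ten2r; try exact: lin; move=> x y; rewrite !pureM !mul1r !mulr1.
Qed.

Lemma rev2_pure x y : rev2 (x ⊗ y) = sg y ⊗ sg x.
Proof. by rewrite [LHS]ten2_pure ?pureM ?mul1r ?mulr1 //; apply: lin. Qed.

Lemma rev_coact_pure x b : rev_coact (x ⊗ b) = b ⊗ sg x.
Proof. by rewrite [LHS]ten2_pure ?pureM ?mul1r ?mulr1 //; apply: lin. Qed.

Lemma rev3_pure x y b : rev3 (x ⊗ y ⊗ b) = b ⊗ sg y ⊗ sg x.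
Proof.
have l2 := lin b3_2A; have l1 := lin b3_1A.
rewrite [LHS]ten2_pure; [|exact: lin|exact: ten2_linear].
by rewrite ten2_pure // !pureM !(mul1r, mulr1).
Qed.

Lemma rev4_pure x y z b : rev4 (x ⊗ y ⊗ z ⊗ b) = b ⊗ sg z ⊗ sg y ⊗ sg x.
Proof.
have l3 := lin b4_3A; have l2 := lin b4_2A; have l1 := lin b4_1A.
have l21 := ten2_linear l2 l1.
rewrite [LHS]ten2_pure; [|exact: lin|exact: ten2_linear].
by rewrite ten2_pure // ten2_pure // !pureM !(mul1r, mulr1).
Qed.

Let r2L : linear rev2. Proof. exact: lin rev2_map. Qed.
Let r2'L : linear rev_coact. Proof. exact: lin rev_coact_map. Qed.
Let r3L : linear rev3. Proof. exact: lin rev3_map. Qed.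
Let r4L : linear rev4. Proof. exact: lin rev4_map. Qed.

Lemma rev3_tassoc Z b : rev3 (tassoc (Z ⊗ b)) = b ⊗ rev2 Z.
Proof.
move: Z; apply: tensor_ext => [||x y].
- by move=> c z t; rewrite pure_linl tassoc_linear r3L.
- by move=> c x y; rewrite r2L pure_linr.
- by rewrite tassoc_pure rev3_pure rev2_pure.
Qed.

Lemma rev4_tassoc_inner x Z b :
  rev4 (x ⊗ tassoc (Z ⊗ b)) = b ⊗ tassoc (rev2 Z ⊗ sg x).
Proof.
move: Z; apply: tensor_ext => [||y z].
- by move=> c z t; rewrite pure_linl tassoc_linear pure_linr r4L.
- by move=> c z t; rewrite r2L pure_linl tassoc_linear pure_linr.
- by rewrite tassoc_pure rev4_pure rev2_pure tassoc_pure.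
Qed.

Lemma rev4_tassoc_outer y Z b : rev4 (tassoc (Z ⊗ (y ⊗ b))) = b ⊗ sg y ⊗ rev2 Z.
Proof.
move: Z; apply: tensor_ext => [||x z].
- by move=> c z t; rewrite pure_linl tassoc_linear r4L.
- by move=> c z t; rewrite r2L !pure_linr.
- by rewrite tassoc_pure rev4_pure rev2_pure.
Qed.

Variables (D : H -> H ⊗ H) (D' : C -> C ⊗ C) (f fi : H ⊗ H) (lam : B -> H ⊗ B).
Hypotheses (DA : algebra_map D) (D'L : linear D') (lamA : algebra_map lam).
Hypothesis D'_rev : forall h, D' (sg h) = rev2 (f * D h * fi).
Let DL : linear D. Proof. by case: DA. Qed.
Let lamL : linear lam. Proof. by case: lamA. Qed.

Definition tens1 (A : pzAlgType k) (Z : H ⊗ H) : H ⊗ H ⊗ A := tassoc (Z ⊗ (1 : A)).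

Definition coact (b : B) : B ⊗ C := rev_coact (lam b).
Let coactL : linear coact. Proof. exact: comp_linear r2'L lamL. Qed.

Lemma conj_tassoc (A : pzAlgType k) (Z : H ⊗ H) (c : A) :
  tens1 A f * tassoc (Z ⊗ c) * tens1 A fi = tassoc ((f * Z * fi) ⊗ c).
Proof.
have [_ [_ M]] := @tassoc_algebra_map k H H A.
by rewrite -!M !pureM mul1r mulr1.
Qed.

Lemma tfirst_coact X : tfirst coact (rev_coact X) = rev3 (tmap id lam X).
Proof.
move: X; apply: tensor_ext => [||x b].
- by move=> c z t; rewrite r2'L tfirst_linear.
- by move=> c z t; rewrite tmap_linear // r3L.
rewrite rev_coact_pure tmap_pure // /tfirst tmap_pure // /coact.
move: (lam b); apply: tensor_ext => [||y b'].
- by move=> c z t; rewrite r2'L pure_linl tassoc_linear.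
- by move=> c z t; rewrite pure_linr r3L.
- by rewrite rev_coact_pure tassoc_pure rev3_pure.
Qed.

Lemma tmap_comul_rev X : tmap id D' (rev_coact X)
  = rev3 (tens1 B f * tfirst D X * tens1 B fi).
Proof.
move: X; apply: tensor_ext => [||x b].
- by move=> c z t; rewrite r2'L tmap_linear.
- move=> c z t; rewrite tfirst_linear // -r3L; congr (rev3 _).
  by rewrite mulrDr mulrDl -pzAr -pzAl.
by rewrite rev_coact_pure tmap_pure // D'_rev /tfirst tmap_pure // conj_tassoc rev3_tassoc.
Qed.

Lemma tassoc_rev X : tassoc (rev_coact X ⊗ (1 : C)) = rev3 ((1 : H) ⊗ X).
Proof.
have [sg1 _] := sgA.2.
move: X; apply: tensor_ext => [||x b].
- by move=> c z t; rewrite r2'L pure_linl tassoc_linear.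
- by move=> c z t; rewrite pure_linr r3L.
- by rewrite rev_coact_pure tassoc_pure rev3_pure sg1.
Qed.

Lemma tmap_tfirst_rev Y : tmap id (tfirst D') (rev3 Y)
  = rev4 ((1 : H) ⊗ tens1 B f * tmap id (tfirst D) Y * (1 : H) ⊗ tens1 B fi).
Proof.
have tL : linear (tfirst D' : C ⊗ C -> C ⊗ C ⊗ C) by apply: tfirst_linear.
have tL' : linear (tfirst D : H ⊗ B -> H ⊗ H ⊗ B) by apply: tfirst_linear.
move: Y; apply: linear_tensor_ext3 => [||x y b].
- by move=> c z t; rewrite r3L tmap_linear.
- move=> c z t; rewrite tmap_linear // -r4L; congr (rev4 _).
  by rewrite mulrDr mulrDl -pzAr -pzAl.
rewrite rev3_pure !tmap_pure // !pureM mul1r mulr1 /tfirst !tmap_pure //.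
by rewrite conj_tassoc rev4_tassoc_inner D'_rev.
Qed.

Lemma tmap_tmap_rev Y : tmap id (tmap id D') (rev3 Y)
  = rev4 (tens1 (H ⊗ B)%type f * tfirst D Y * tens1 (H ⊗ B)%type fi).
Proof.
have tL : linear (tmap id D' : C ⊗ C -> C ⊗ C ⊗ C) by apply: tmap_linear.
move: Y; apply: linear_tensor_ext3 => [||x y b].
- by move=> c z t; rewrite r3L tmap_linear.
- move=> c z t; rewrite tfirst_linear // -r4L; congr (rev4 _).
  by rewrite mulrDr mulrDl -pzAr -pzAl.
rewrite rev3_pure !tmap_pure // /tfirst tmap_pure //.
by rewrite conj_tassoc rev4_tassoc_outer D'_rev.
Qed.

Lemma tassoc3_rev Y : tassoc3 (rev3 Y ⊗ (1 : C)) = rev4 ((1 : H) ⊗ Y).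
Proof.
have [sg1 _] := sgA.2.
move: Y; apply: linear_tensor_ext3 => [||x y b].
- by move=> c z t; rewrite r3L pure_linl tassoc3_linear.
- by move=> c z t; rewrite pure_linr r4L.
rewrite rev3_pure rev4_pure sg1 /tassoc3 tassoc_pure tmap_pure //.
  by rewrite tassoc_pure.
exact: tassoc_linear.
Qed.

Lemma tfirst_coact3 Y : tfirst coact (rev3 Y) = rev4 (tmap id (tmap id lam) Y).
Proof.
have tL : linear (tmap id lam : H ⊗ B -> H ⊗ H ⊗ B) by apply: tmap_linear.
move: Y; apply: linear_tensor_ext3 => [||x y b].
- by move=> c z t; rewrite r3L tfirst_linear.
- by move=> c z t; rewrite tmap_linear // r4L.
rewrite rev3_pure !tmap_pure // /tfirst tmap_pure // /coact.
move: (lam b); apply: tensor_ext => [||z b'].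
- by move=> c u t; rewrite r2'L pure_linl tassoc_linear.
- by move=> c u t; rewrite !pure_linr r4L.
- by rewrite rev_coact_pure tassoc_pure rev4_pure.
Qed.

End Reversal.

Section CounitForms.
Variables (k : fieldType) (A B : pzAlgType k) (e : A -> k).
Hypothesis eA : augmentation e.
Let eL : scalar e. Proof. by case: eA. Qed.

Lemma tform_l_algebra_map : algebra_map (tform_l e : A ⊗ B -> B).
Proof.
have lL := @tform_l_linear k A B e eL; have [_ [e1 eM]] := eA; split=> //.
split; first by rewrite -pure1 tform_l_pure // e1 scale1r.
apply: tensor_extM => // a b a' b'.
by rewrite pureM !tform_l_pure // eM -pzAl -pzAr scalerA.
Qed.

Lemma tform_r_algebra_map : algebra_map (tform_r e : B ⊗ A -> B).
Proof.
have lL := @tform_r_linear k A B e eL; have [_ [e1 eM]] := eA; split=> //.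
split; first by rewrite -pure1 tform_r_pure // e1 scale1r.
apply: tensor_extM => // a b a' b'.
by rewrite pureM !tform_r_pure // eM -pzAl -pzAr scalerA.
Qed.
End CounitForms.

Section ReversalCounit.
Variables (k : fieldType) (H B C : pzAlgType k) (sg : H -> C) (e : H -> k) (e' : C -> k).
Hypotheses (sgA : algebra_map sg) (eA : augmentation e) (e'L : scalar e').
Hypothesis e'sg : forall h, e' (sg h) = e h.
Let eL : scalar e. Proof. by case: eA. Qed.
Let sgL : linear sg. Proof. by case: sgA. Qed.

Lemma rev_coact_linear : linear (rev_coact sg : H ⊗ B -> B ⊗ C).
Proof. by case: (rev_coact_map B sgA). Qed.
Lemma rev3_linear : linear (rev3 sg : H ⊗ H ⊗ B -> B ⊗ C ⊗ C).
Proof. by case: (rev3_map B sgA). Qed.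

Lemma tlift_rev_coact X : tlift (fun (h : H) (b : B) => b ⊗ sg h) X = rev_coact sg X.
Proof.
have bil : bilin (fun (h : H) (b : B) => b ⊗ sg h).
  by split=> ? c x y /=; rewrite ?sgL ?pure_linr ?pure_linl.
move: X; apply: tensor_ext => [||h b].
- exact: tlift_linear.
- exact: rev_coact_linear.
- by rewrite tlift_pure // rev_coact_pure.
Qed.

Lemma tlift_rev3 (f : H ⊗ H) (W : H ⊗ H ⊗ B) :
  tlift (fun f1 f2 : H => tlift (fun x1 : H => tlift (fun (x2 : H) (x3 : B) =>
      x3 ⊗ sg (f2 * x2) ⊗ sg (f1 * x1))) W) f = rev3 sg (tens1 B f * W).
Proof.
have bil1 f1 f2 x1 : bilin (fun (x2 : H) (x3 : B) => x3 ⊗ sg (f2 * x2) ⊗ sg (f1 * x1)).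
  by split=> ? c x y /=; rewrite ?mulrDr -?pzAr ?sgL ?(pure_linl, pure_linr).
have bil2 f1 f2 : bilin (fun x1 : H => tlift (fun (x2 : H) (x3 : B) =>
    x3 ⊗ sg (f2 * x2) ⊗ sg (f1 * x1))).
  split=> [?|?]; last exact: tlift_linear.
  move=> c x y; apply: tlift_lin_phi => x2 x3.
  by rewrite mulrDr -pzAr sgL !pure_linr.
have bil3 V : bilin (fun f1 f2 : H => tlift (fun x1 : H => tlift (fun (x2 : H) (x3 : B) =>
      x3 ⊗ sg (f2 * x2) ⊗ sg (f1 * x1))) V).
  split=> ? c x y; apply: tlift_lin_phi => x1 x23; apply: tlift_lin_phi => x2 x3.
    by rewrite mulrDl -pzAl sgL !pure_linr.
  by rewrite mulrDl -pzAl sgL pure_linl pure_linr.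
move: f; apply: tensor_ext => [||f1 f2].
- exact: tlift_linear.
- move=> c x y; rewrite /tens1 pure_linl tassoc_linear mulrDl -pzAl.
  exact: rev3_linear.
rewrite tlift_pure // /tens1 tassoc_pure.
move: W; apply: linear_tensor_ext3 => [||x1 x2 x3].
- exact: tlift_linear.
- by move=> c x y; rewrite mulrDr -pzAr; apply: rev3_linear.
- by rewrite !tlift_pure // !pureM mul1r rev3_pure.
Qed.

Lemma tform_r_rev_coact X : tform_r e' (rev_coact sg X : B ⊗ C) = tform_l e X.
Proof.
move: X; apply: tensor_ext => [||x b].
- by move=> c z t; rewrite rev_coact_linear tform_r_linear.
- exact: tform_l_linear.
- by rewrite rev_coact_pure // tform_r_pure // tform_l_pure // e'sg.
Qed.

Lemma tmap_tform_l_rev3 Y :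
  tmap id (tform_l e') (rev3 sg Y : B ⊗ C ⊗ C) = rev_coact sg (tmap id (tform_l e) Y).
Proof.
have lL := @tform_l_linear k C C e' e'L; have lL' := @tform_l_linear k H B e eL.
move: Y; apply: linear_tensor_ext3 => [||x y b].
- by move=> c z t; rewrite rev3_linear tmap_linear.
- by move=> c z t; rewrite tmap_linear // rev_coact_linear.
rewrite rev3_pure // !tmap_pure // !tform_l_pure // rev_coact_pure // e'sg.
by rewrite (linfZ (@pure_linear_l _ _ _ (sg x))) (linfZ (@pure_linear_r _ _ _ b)).
Qed.

Lemma tmap_tform_r_rev3 Y :
  tmap id (tform_r e') (rev3 sg Y : B ⊗ C ⊗ C) = rev_coact sg (tform_l e Y).
Proof.
have lL := @tform_r_linear k C C e' e'L; have lL' := @tform_l_linear k H (H ⊗ B)%type e eL.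
move: Y; apply: linear_tensor_ext3 => [||x y b].
- by move=> c z t; rewrite rev3_linear tmap_linear.
- by move=> c z t; rewrite lL' rev_coact_linear.
rewrite rev3_pure // !tmap_pure // tform_r_pure // tform_l_pure // e'sg.
by rewrite (linfZ rev_coact_linear) rev_coact_pure // (linfZ (@pure_linear_r _ _ _ b)).
Qed.

Lemma tmap_tform_l_tens1 f : tmap id (tform_l e) (tens1 B f) = tform_r e f ⊗ 1.
Proof.
have lL' := @tform_l_linear k H B e eL.
move: f; apply: tensor_ext => [||x y].
- by move=> c z t; rewrite /tens1 pure_linl tassoc_linear tmap_linear.
- by move=> c z t; rewrite tform_r_linear // pure_linl.
- rewrite /tens1 tassoc_pure tmap_pure // tform_l_pure // tform_r_pure //.
  by rewrite (linfZ (@pure_linear_l _ _ _ (1 : B))) (linfZ (@pure_linear_r _ _ _ x)).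
Qed.

Lemma tform_l_tens1 f : tform_l e (tens1 B f) = tform_l e f ⊗ 1.
Proof.
have lL' := @tform_l_linear k H (H ⊗ B)%type e eL.
move: f; apply: tensor_ext => [||x y].
- by move=> c z t; rewrite /tens1 pure_linl tassoc_linear lL'.
- by move=> c z t; rewrite tform_l_linear // pure_linl.
- rewrite /tens1 tassoc_pure !tform_l_pure //.
  by rewrite (linfZ (@pure_linear_l _ _ _ (1 : B))).
Qed.
End ReversalCounit.

(** * Counits of the Drinfeld twist *)

Section TwistCounit.
Variables (k : fieldType) (H : pzAlgType k) (Q : quasi_hopf H).
Local Notation D := (comul Q).
Local Notation eps := (counit Q).
Local Notation S := (antipode Q).
Local Notation al := (qalpha Q).
Local Notation twist := (drinfeld_twist Q).

(* An algebra map contracting one leg of [H ⊗ H] with the counit sends the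
   twist to an element that conjugates [S] to itself and fixes [alpha], hence
   to [1]. *)
Lemma twist_counit (j : H ⊗ H -> H) : algebra_map j ->
  (forall h, j (D (S h)) = S h) -> (forall h, j (D h) = h) ->
  (forall h, j (prod_antimap Q (@tens_l k H) (@tens_r k H) h) = S h) ->
  j (prod_cap Q (@tens_l k H) (@tens_r k H)) = al -> j twist = 1.
Proof.
move=> [jL [j1 jM]] jDS jD jg jcap.
have T := antipodal_id Q; have SL := @antipode_linear _ _ Q.
have -> : j twist = transport Q id S S (qbeta Q) al.
  apply: (transport_unique T SL) => [h|].
    by rewrite -{1}jDS -jM drinfeld_twist_antipode jM jg.
  by rewrite -{1}[al]jD -jM drinfeld_twist_alpha.
by apply/esym/(transport_unique T SL) => [h|]; rewrite !(mul1r, mulr1).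
Qed.

Let eL : scalar eps. Proof. by case: (counit_algebra_map Q). Qed.
Let SL := @antipode_linear _ _ Q.
Let e1 : eps 1 = 1. Proof. by case: (counit_algebra_map Q) => _ []. Qed.

Let SA : algebra_antimap S. Proof. exact: antipode_antimap. Qed.
Let eta : H -> H := fun h => eps h *: (1 : H).
Let etaL : linear eta. Proof. by case: (unit_letter_algebra_map Q H). Qed.

Let L := letter Q [:: in1 S; in2 id].
Let Lhom n : algebra_map (L n).
Proof.
move: n; rewrite /L /letter; case=> [|[|n]] /=; rewrite ?nth_nil.
- exact: in1_map.
- by apply: in2_map; apply: id_algebra_map.
- exact: unit_letter_algebra_map.
Qed.
Let Lcomm m n : m != n -> commuting (L m) (L n).
Proof.
move: m n; rewrite /L /letter; case=> [|[|m]] [|[|n]] //= _; rewrite ?nth_nil; first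
  [ exact: commuting_unit_letter | exact: (commutingC (commuting_unit_letter _ _))
  | exact: in12_comm | apply: commutingC; exact: in12_comm ].
Qed.

Let in1_eta : in1 eta = wmap Q L Unit.
Proof.
apply: funext => h; have [l [p1 _]] := pair1_algebra_map H.
by rewrite /in1 /eta -[toop _]/(eps h *: (1 : H^c)) (linfZ l) p1.
Qed.
Let in2_eta : in2 eta = wmap Q L Unit.
Proof.
apply: funext => h; have [l [p1 _]] := pair2_algebra_map H.
by rewrite /in2 /eta (linfZ l) p1.
Qed.

(** With counits in its second and third legs, [drinfeld_A] reads as two reassociators with a counit
    leg, both equal to 1. *)
Let sand4_eta_inner r : sand4 S eta eta id r (drinfeld_A Q) = r.
Proof.
rewrite -[LHS]sandwich_pair1 sandwich_pair_sand4 // mulr1 in1_eta in2_eta.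
have /= -> := ten4_A Q Lhom Lcomm (x := Letter 0) (y := Unit) (z := Unit) (w := Letter 1) isT.
by rewrite (Phi3_unit2 Q Lhom Lcomm) // Phi3V_unit ?(Phi3_unit2 Q Lhom Lcomm) // mul1r sandwich_pair1.
Qed.

Let sand4_eta_outer r : sand4 eta S id eta r (drinfeld_A Q) = r.
Proof.
rewrite -[LHS]sandwich_pair1 sandwich_pair_sand4 // mulr1 in1_eta in2_eta.
have /= -> := ten4_A Q Lhom Lcomm (x := Unit) (y := Letter 0) (z := Letter 1) (w := Unit) isT.
by rewrite (Phi3_unit1 Q Lhom Lcomm) // Phi3V_unit ?(Phi3_unit3 Q Lhom Lcomm) // mul1r sandwich_pair1.
Qed.

Let lL : linear (@tens_l k H). Proof. by case: (tens_l_map H). Qed.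
Let rL : linear (@tens_r k H). Proof. by case: (tens_r_map H). Qed.
Let lSL : linear (j1S Q (@tens_l k H)). Proof. exact: comp_linear lL SL. Qed.
Let rSL : linear (j2S Q (@tens_r k H)). Proof. exact: comp_linear rL SL. Qed.

Lemma tform_l_twist : tform_l eps twist = 1.
Proof.
have jA := @tform_l_algebra_map k H H eps (counit_algebra_map Q).
have [jL [_ jM]] := jA.
have jl x : tform_l eps (tens_l x) = eta x by rewrite tform_l_pure.
have jr x : tform_l eps (tens_r x) = x by rewrite tform_l_pure // e1 scale1r.
apply: (twist_counit jA) => [h|h|h|]; try exact: comul_counit_l.
- rewrite prod_antimap_comul -[in RHS](comul_counit_r Q h).
  move: (D h); apply: tensor_ext => [||a b].
  + by move=> c x y; rewrite tswap_linear tmap_linear // jL.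
  + by move=> c x y; rewrite tform_r_linear // SL.
  + by rewrite tswap_pure tmap_pure // tform_l_pure // tform_r_pure // counit_antipode (linfZ SL).
- rewrite (algebra_map_sand4 _ _ jA) //.
  have -> : (fun x => tform_l eps (j2S Q (@tens_r k H) x)) = S by apply: funext => x; apply: jr.
  have -> : (fun x => tform_l eps (j1S Q (@tens_l k H) x)) = eta.
    by apply: funext => x; rewrite [LHS]jl /eta counit_antipode.
  have -> : (fun x => tform_l eps (@tens_r k H x)) = id by apply: funext => x; apply: jr.
  have -> : (fun x => tform_l eps (@tens_l k H x)) = eta by apply: funext => x; apply: jl.
  by rewrite jM jl jr sand4_eta_inner /eta counit_alpha scale1r mul1r.
Qed.

Lemma tform_r_twist : tform_r eps twist = 1.
Proof.
have jA := @tform_r_algebra_map k H H eps (counit_algebra_map Q).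
have [jL [_ jM]] := jA.
have jl x : tform_r eps (tens_l x) = x by rewrite tform_r_pure // e1 scale1r.
have jr x : tform_r eps (tens_r x) = eta x by rewrite tform_r_pure.
apply: (twist_counit jA) => [h|h|h|]; try exact: comul_counit_r.
- rewrite prod_antimap_comul -[in RHS](comul_counit_l Q h).
  move: (D h); apply: tensor_ext => [||a b].
  + by move=> c x y; rewrite tswap_linear tmap_linear // jL.
  + by move=> c x y; rewrite tform_l_linear // SL.
  + by rewrite tswap_pure tmap_pure // tform_l_pure // tform_r_pure // counit_antipode (linfZ SL).
- rewrite (algebra_map_sand4 _ _ jA) //.
  have -> : (fun x => tform_r eps (j2S Q (@tens_r k H) x)) = eta.
    by apply: funext => x; rewrite [LHS]jr /eta counit_antipode.
  have -> : (fun x => tform_r eps (j1S Q (@tens_l k H) x)) = S by apply: funext => x; apply: jl.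
  have -> : (fun x => tform_r eps (@tens_r k H x)) = eta by apply: funext => x; apply: jr.
  have -> : (fun x => tform_r eps (@tens_l k H x)) = id by apply: funext => x; apply: jl.
  by rewrite jM jl jr sand4_eta_outer /eta counit_alpha scale1r mulr1.
Qed.

End TwistCounit.

(** * The cocycle identity on the legs of H ⊗ H ⊗ H ⊗ B *)

Section ConcreteCocycle.
Variables (k : fieldType) (H : pzAlgType k) (Q : quasi_hopf H) (B : pzAlgType k).
Local Notation D := (comul Q).
Local Notation Phi := (reass Q).
Local Notation S := (antipode Q).
Local Notation twist := (drinfeld_twist Q).
Local Notation N := (H ⊗ H ⊗ H ⊗ B)%type.

Definition leg1 (h : H) : N := h ⊗ (1 : H ⊗ H ⊗ B).
Definition leg2 (h : H) : N := (1 : H) ⊗ h ⊗ (1 : H ⊗ B).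
Definition leg3 (h : H) : N := (1 : H) ⊗ (1 : H) ⊗ h ⊗ (1 : B).

Lemma leg1_map : algebra_map leg1.
Proof. exact: pure1r_algebra_map. Qed.
Lemma leg2_map : algebra_map leg2.
Proof. exact: (comp_algebra_map (pure1l_algebra_map _ _) (pure1r_algebra_map _ _)). Qed.
Lemma leg3_map : algebra_map leg3.
Proof.
exact: (comp_algebra_map (pure1l_algebra_map _ _)
  (comp_algebra_map (pure1l_algebra_map _ _) (pure1r_algebra_map _ _))).
Qed.
Lemma leg12 : commuting leg1 leg2.
Proof. by move=> x y; rewrite !pureM !mul1r !mulr1. Qed.
Lemma leg13 : commuting leg1 leg3.
Proof. by move=> x y; rewrite !pureM !mul1r !mulr1. Qed.
Lemma leg23 : commuting leg2 leg3.
Proof. by move=> x y; rewrite !pureM !mul1r !mulr1. Qed.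

Let l1 : linear leg1. Proof. by case: leg1_map. Qed.
Let l2 : linear leg2. Proof. by case: leg2_map. Qed.
Let l3 : linear leg3. Proof. by case: leg3_map. Qed.
Let DL : linear D. Proof. by case: (comul_algebra_map Q). Qed.

Lemma ten2_leg12 X : ten2 leg1 leg2 X = tens1 (H ⊗ B)%type X.
Proof.
move: X; apply: tensor_ext => [||x y].
- exact: ten2_linear.
- by move=> c z t; rewrite /tens1 pure_linl tassoc_linear.
- by rewrite ten2_pure // pureM mul1r mulr1 /tens1 tassoc_pure.
Qed.

Lemma ten2_leg23 X : ten2 leg2 leg3 X = (1 : H) ⊗ tens1 B X.
Proof.
move: X; apply: tensor_ext => [||x y].
- exact: ten2_linear.
- by move=> c z t; rewrite /tens1 pure_linl tassoc_linear pure_linr.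
- by rewrite ten2_pure // !pureM !(mul1r, mulr1) /tens1 tassoc_pure.
Qed.

Let pmL (i j : H -> N) : linear i -> linear j -> linear (prod_map Q i j).
Proof. by move=> iL jL; apply: comp_linear DL; apply: ten2_linear. Qed.

Lemma ten2_leg12_leg3 X : ten2 (prod_map Q leg1 leg2) leg3 X = tfirst D (tens1 B X).
Proof.
have p12 := pmL l1 l2.
move: X; apply: tensor_ext => [||x y].
- exact: ten2_linear.
- by move=> c z t; rewrite /tens1 pure_linl tassoc_linear tfirst_linear.
rewrite ten2_pure // /prod_map ten2_leg12 /tens1 tassoc_pure /tfirst tmap_pure //.
move: (D x); apply: tensor_ext => [||a b].
- by move=> c z t; rewrite pure_linl tassoc_linear mulrDl -pzAl.
- by move=> c z t; rewrite pure_linl tassoc_linear.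
- by rewrite !tassoc_pure !pureM !(mul1r, mulr1).
Qed.

Lemma ten2_leg1_leg23 X :
  ten2 leg1 (prod_map Q leg2 leg3) X = tmap id (tfirst D) (tens1 B X).
Proof.
have p23 := pmL l2 l3.
have tL : linear (tfirst D : H ⊗ B -> H ⊗ H ⊗ B) by apply: tfirst_linear.
move: X; apply: tensor_ext => [||x y].
- exact: ten2_linear.
- by move=> c z t; rewrite /tens1 pure_linl tassoc_linear tmap_linear.
rewrite ten2_pure // /prod_map ten2_leg23 /tens1 tassoc_pure tmap_pure // /tfirst tmap_pure //.
by rewrite pureM mulr1 mul1r.
Qed.

Lemma ten3_leg X : ten2 leg1 (ten2 leg2 leg3) X = tassoc3 (X ⊗ (1 : B)).
Proof.
have l23 := ten2_linear l2 l3.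
move: X; apply: linear_tensor_ext3 => [||x y z].
- exact: ten2_linear.
- by move=> c u t; rewrite pure_linl tassoc3_linear.
rewrite !ten2_pure // !pureM !(mul1r, mulr1) /tassoc3 tassoc_pure tmap_pure //.
  by rewrite tassoc_pure.
exact: tassoc_linear.
Qed.

Local Notation leg1S := (fun h => leg1 (S h)).
Local Notation leg2S := (fun h => leg2 (S h)).
Local Notation leg3S := (fun h => leg3 (S h)).

Lemma concrete_cocycle : tens1 (H ⊗ B)%type twist * tfirst D (tens1 B twist)
  = ten2 leg3S (ten2 leg2S leg1S) (inv Phi)
    * ((1 : H) ⊗ tens1 B twist * tmap id (tfirst D) (tens1 B twist))
    * tassoc3 (Phi ⊗ (1 : B)).
Proof.
rewrite -ten2_leg12 -ten2_leg12_leg3 -ten2_leg23 -ten2_leg1_leg23 -ten3_leg.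
exact: (twist_cocycle Q leg1_map leg2_map leg3_map leg12 leg13 leg23).
Qed.

End ConcreteCocycle.

(** The reversed reassociator is built from [inv Phil], so the pentagon of [Phil] is needed with all
    its factors inverted except [x], the reassociator of H. *)
Lemma pentagon_inverse (R : pzRingType) (a ai b bi c ci d di x : R) :
  mutual_inverse a ai -> mutual_inverse b bi -> mutual_inverse c ci ->
  mutual_inverse d di -> a * b * x = c * d -> bi * ai = x * (di * ci).
Proof.
move=> [_ aa] [_ bb] [cc _] [dd _] e.
rewrite -[LHS]mulr1 -cc -[c in c * ci]mulr1 -dd !mulrA -(mulrA _ c) -e !mulrA.
by rewrite -(mulrA bi) aa mulr1 bb mul1r.
Qed.

(** The reversed pentagon in abstract form. Conjugations by the twist come from the reversed
    coproduct ([a], [t]); they cancel against the twists in the reassociators. What is left is the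
    cocycle identity, third hypothesis, and the inverted pentagon of [Phil], fourth hypothesis. *)
Lemma conjugate_cancel (R : pzRingType) (g a ai b w v t ti d dw lw x : R) :
  ai * a = 1 -> ti * t = 1 -> t * d = g * (a * b) * x -> w * v = x * (dw * lw) ->
  g * (a * (b * w) * ai) * (a * v) = t * (d * dw) * ti * (t * lw).
Proof.
move=> aa tt td wv; rewrite !mulrA -(mulrA _ ai) aa mulr1 -(mulrA _ ti) tt mulr1.
by rewrite td -!mulrA wv.
Qed.

Lemma tmap_id (k : fieldType) (A B : lmodType k) (X : A ⊗ B) : tmap id id X = X.
Proof.
move: X; apply: tensor_ext => [||a b] //; first exact: tmap_linear.
by rewrite tmap_pure.
Qed.

(** * The axioms of the reversed comodule algebra *)

Section ReversedComodule.
Variables (k : fieldType) (H : pzAlgType k) (Q : quasi_hopf H) (B C : pzAlgType k).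
Local Notation D := (comul Q).
Local Notation eps := (counit Q).
Local Notation Phi := (reass Q).
Local Notation S := (antipode Q).
Local Notation twist := (drinfeld_twist Q).
Variables (Q' : quasi_bialgebra C) (sg : H -> C).
Hypothesis sgA : algebra_map sg.
Hypothesis comul_sg : forall h, comul Q' (sg h) = rev2 sg (twist * D h * inv twist).
Hypothesis counit_sg : forall h, counit Q' (sg h) = eps h.
Hypothesis reass_sg : reass Q' = tmap (fun h => sg (S h))
  (tmap (fun h => sg (S h)) (fun h => sg (S h))) (inv Phi).

Let SL := @antipode_linear _ _ Q.
Let sgL : linear sg. Proof. by case: sgA. Qed.
Let DA := comul_algebra_map Q.
Let DL : linear D. Proof. by case: DA. Qed.
Let D'L : linear (comul Q'). Proof. by case: (comul_algebra_map Q'). Qed.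
Let epsA := counit_algebra_map Q.
Let eps'L : scalar (counit Q'). Proof. by case: (counit_algebra_map Q'). Qed.
Let r3M : {morph @rev3 k H B C sg : x y / x * y}.
Proof. by case: (rev3_map B sgA) => _ []. Qed.
Let r4M : {morph @rev4 k H B C sg : x y / x * y}.
Proof. by case: (rev4_map B sgA) => _ []. Qed.
Let rM : {morph @rev_coact k H B C sg : x y / x * y}.
Proof. by case: (rev_coact_map B sgA) => _ []. Qed.

Local Notation G := (ten2 (fun h => @leg3 k H B (S h))
  (ten2 (fun h => @leg2 k H B (S h)) (fun h => @leg1 k H B (S h)))).

(** The composite of [sg] with S plays the identity map from H to its opposite. Hence the new
    reassociator is the reversal of S(x3) ⊗ S(x2) ⊗ S(x1) ⊗ 1, the leading factor in the cocycle
    identity. *)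
Lemma rev4_reass : (1 : B) ⊗ reass Q' = rev4 sg (G (inv Phi)).
Proof.
have [r4L _] := rev4_map B sgA; have sSL := comp_linear sgL SL.
have [l1 _] := @leg1_map k H B; have [l2 _] := @leg2_map k H B.
have [l3 _] := @leg3_map k H B.
have l1S := comp_linear l1 SL; have l2S := comp_linear l2 SL.
have l3S := comp_linear l3 SL; have l21 := ten2_linear l2S l1S.
have l321 := ten2_linear l3S l21.
have tL : linear (tmap (fun h => sg (S h)) (fun h => sg (S h))) by apply: tmap_linear.
rewrite reass_sg; move: (inv Phi); apply: linear_tensor_ext3 => [||x y z].
- by move=> c u t; rewrite tmap_linear // pure_linr.
- exact: (comp_linear r4L l321).
rewrite !ten2_pure // !pureM !(mul1r, mulr1) rev4_pure //.
by rewrite !tmap_pure.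
Qed.

Lemma tens1_map (A : pzAlgType k) : algebra_map (@tens1 k H A).
Proof. exact: (comp_algebra_map (@tassoc_algebra_map k H H A) (@pure1r_algebra_map k _ A)). Qed.

Lemma tens1_inverse (A : pzAlgType k) :
  mutual_inverse (tens1 A twist) (tens1 A (inv twist)).
Proof. exact: inv_algebra_map (tens1_map A) (drinfeld_twist_invertible Q). Qed.

Definition rev_reass (Phil : H ⊗ H ⊗ B) : B ⊗ C ⊗ C :=
  rev3 sg (tens1 B twist * inv Phil).

Section LeftComodule.
Variables (lam : B -> H ⊗ B) (Phil : H ⊗ H ⊗ B).
Hypothesis HB : left_comodule_algebra Q lam Phil.

Let lamA : algebra_map lam. Proof. by case: HB. Qed.
Let lamL : linear lam. Proof. by case: lamA. Qed.
Let Phil_unit : invertible Phil. Proof. by case: HB. Qed.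
Let PhilI : mutual_inverse Phil (inv Phil). Proof. exact: invP. Qed.

(** The reversed coproduct is conjugated by the twist, and the twist inside [rev_reass] absorbs
    this; what remains is the coassociativity of [lam] written with [inv Phil]. *)
Lemma rev_coassoc b :
  rev_reass Phil * tfirst (coact sg lam) (coact sg lam b)
  = tmap id (comul Q') (coact sg lam b) * rev_reass Phil.
Proof.
rewrite {2}/coact (tfirst_coact sgA lamA).
rewrite (tmap_comul_rev sgA DA D'L comul_sg) -!r3M; congr (rev3 _ _).
have [_ e] := tens1_inverse B; rewrite !mulrA -(mulrA _ (tens1 B (inv twist))) e mulr1.
rewrite -!mulrA; congr (_ * _).
have [_ _ coas _ _ _ _] := HB.
exact: (intertwine_inv PhilI (u := fun b => tfirst D (lam b)) (fun b => esym (coas b))).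
Qed.

Lemma reass_inverse_pentagon :
  tmap id (tfirst D) (inv Phil) * (1 : H) ⊗ inv Phil
  = tassoc3 (Phi ⊗ (1 : B)) * (tfirst D (inv Phil) * tmap id (tmap id lam) (inv Phil)).
Proof.
have idA := @id_algebra_map k H; have [_ _ _ pent _ _ _] := HB.
apply: pentagon_inverse pent.
- exact: inv_algebra_map (@pure1l_algebra_map k H _) Phil_unit.
- exact: inv_algebra_map (tmap_algebra_map idA (tfirst_algebra_map B DA)) Phil_unit.
- exact: inv_algebra_map (tmap_algebra_map idA (tmap_algebra_map idA lamA)) Phil_unit.
- exact: inv_algebra_map (tfirst_algebra_map (H ⊗ B)%type DA) Phil_unit.
Qed.

Lemma tmap_lam_tens1 : tmap id (tmap id lam) (tens1 B twist) = tens1 (H ⊗ B)%type twist.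
Proof.
have [_ [lam1 _]] := lamA.
rewrite /tens1 -(tassoc_nat _ (@id_linear k H) (@id_linear k H) lamL).
rewrite tmap_pure //; last exact: tmap_linear.
by rewrite lam1 tmap_id.
Qed.

Lemma rev_pentagon :
  (1 : B) ⊗ reass Q' * tmap id (tfirst (comul Q')) (rev_reass Phil)
    * tassoc3 (rev_reass Phil ⊗ (1 : C))
  = tmap id (tmap id (comul Q')) (rev_reass Phil) * tfirst (coact sg lam) (rev_reass Phil).
Proof.
have idA := @id_algebra_map k H.
rewrite rev4_reass (tmap_tfirst_rev sgA DA D'L comul_sg) (tassoc3_rev sgA).
rewrite (tmap_tmap_rev sgA DA D'L comul_sg) (tfirst_coact3 sgA lamA) -!r4M.
congr (rev4 _ _).
have [_ [_ M1]] := tmap_algebra_map idA (tfirst_algebra_map B DA).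
have [_ [_ M2]] := tfirst_algebra_map (H ⊗ B)%type DA.
have [_ [_ M3]] := tmap_algebra_map idA (tmap_algebra_map idA lamA).
have [_ [_ M4]] := @pure1l_algebra_map k H (H ⊗ H ⊗ B)%type.
rewrite M1 M2 M3 M4 tmap_lam_tens1.
apply: conjugate_cancel.
- by rewrite -M4 (proj2 (tens1_inverse B)).
- exact: (proj2 (tens1_inverse _)).
- exact: concrete_cocycle.
- exact: reass_inverse_pentagon.
Qed.

Lemma rev_counit b : tform_r (counit Q') (coact sg lam b) = b.
Proof.
by rewrite /coact (tform_r_rev_coact sgA epsA eps'L counit_sg); case: HB.
Qed.

Lemma rev_reass_counit2 : tmap id (tform_l (counit Q')) (rev_reass Phil) = 1.
Proof.
rewrite /rev_reass (tmap_tform_l_rev3 sgA epsA eps'L counit_sg).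
have mA := tmap_algebra_map (@id_algebra_map k H) (@tform_l_algebra_map k H B eps epsA).
have [_ [r1 _]] := rev_coact_map B sgA; have [_ [_ mM]] := mA.
have [_] := inv_algebra_map mA Phil_unit; have [_ _ _ _ _ -> _] := HB.
rewrite mulr1 mM => ->.
by rewrite mulr1 (tmap_tform_l_tens1 B epsA) tform_r_twist.
Qed.

Lemma rev_reass_counit3 : tmap id (tform_r (counit Q')) (rev_reass Phil) = 1.
Proof.
rewrite /rev_reass (tmap_tform_r_rev3 sgA epsA eps'L counit_sg).
have mA := @tform_l_algebra_map k H (H ⊗ B)%type eps epsA.
have [_ [r1 _]] := rev_coact_map B sgA; have [_ [_ mM]] := mA.
have [_] := inv_algebra_map mA Phil_unit; have [_ _ _ _ _ _ ->] := HB.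
rewrite mulr1 mM => ->.
by rewrite mulr1 (tform_l_tens1 B epsA) tform_l_twist.
Qed.

Lemma rev_reass_unit : invertible (rev_reass Phil).
Proof.
have i := mutual_inverseM (tens1_inverse B) (mutual_inverse_sym PhilI).
have iu : invertible (tens1 B twist * inv Phil) by eexists; exact: i.
by eexists; exact: (inv_algebra_map (rev3_map B sgA) iu).
Qed.

Lemma rev_comodule_algebra : right_comodule_algebra Q' (coact sg lam) (rev_reass Phil).
Proof.
split.
- exact: comp_algebra_map (rev_coact_map B sgA) lamA.
- exact: rev_reass_unit.
- exact: rev_coassoc.
- exact: rev_pentagon.
- exact: rev_counit.
- exact: rev_reass_counit2.
- exact: rev_reass_counit3.
Qed.

Lemma rev_twist_equivalent (lam' : B -> H ⊗ B) (Phil' : H ⊗ H ⊗ B) :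
  left_twist_equivalent Q lam Phil lam' Phil' ->
  right_twist_equivalent Q' (coact sg lam) (rev_reass Phil)
    (coact sg lam') (rev_reass Phil').
Proof.
case=> U [Uu Ue lamE PhilE]; have rA := rev_coact_map B sgA.
have iV := inv_algebra_map rA Uu; have idA := @id_algebra_map k H.
(* For U = u1 ⊗ u2 the witness is u2 ⊗ S^-1(u1). *)
exists (rev_coact sg U); split.
- by eexists; exact: iV.
- by rewrite (tform_r_rev_coact sgA epsA eps'L counit_sg).
- by move=> a; rewrite (inv_unique iV) /coact lamE !rM.
rewrite (inv_unique iV) (tmap_comul_rev sgA DA D'L comul_sg) (tfirst_coact sgA lamA).
rewrite (tassoc_rev sgA) -!r3M; congr (rev3 _ _).
have i1 := inv_algebra_map (@pure1l_algebra_map k H _) Uu.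
have i2 := inv_algebra_map (tmap_algebra_map idA lamA) Uu.
have i4 := mutual_inverse_sym (inv_algebra_map (tfirst_algebra_map B DA) Uu).
(* Inverting [Phil'] reverses its four factors, and this is the order in which they occur in the
   definition of right twist equivalence. *)
rewrite PhilE (inv_unique (mutual_inverseM (mutual_inverseM (mutual_inverseM i1 i2) PhilI) i4)).
rewrite !mulrA -(mulrA _ (tens1 B (inv twist))) (proj2 (tens1_inverse B)) mulr1.
by [].
Qed.

End LeftComodule.
End ReversedComodule.

(** * The inverse antipode as the reversing map *)

Section OppositeCoaction.
Variables (k : fieldType) (H : pzAlgType k) (Q : quasi_hopf H) (B : pzAlgType k).
Local Notation D := (comul Q).
Local Notation eps := (counit Q).
Local Notation Phi := (reass Q).
Local Notation S := (antipode Q).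
Local Notation Sinv := (antipode_inv Q).
Local Notation twist := (drinfeld_twist Q).

Definition sinv (h : H) : H^c := toop (Sinv h).

Let SL := @antipode_linear _ _ Q.

Lemma sinv_S h : sinv (S h) = toop h. Proof. by rewrite /sinv antipodeK. Qed.

Lemma sinv_map : algebra_map sinv.
Proof.
have [_ S1 SM] := antipode_antimap Q; have SK := antipode_invK Q.
have SI : injective S := can_inj (antipodeK Q).
split; first by move=> c x y; apply: SI; rewrite /sinv SL !SK.
split; first by apply: SI; rewrite /sinv SK S1.
by move=> x y; apply: SI; rewrite [RHS]SM /sinv !SK.
Qed.

Lemma rev2_sinv X : rev2 sinv (tmap S S (tswap X)) = tmap (@toop k H) (@toop k H) X.
Proof.
have [r2L _] := rev2_map sinv_map.
move: X; apply: tensor_ext => [||x y].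
- by move=> c z t; rewrite tswap_linear tmap_linear // r2L.
- by move=> c z t; rewrite tmap_linear.
- by rewrite tswap_pure !tmap_pure // rev2_pure ?sinv_S //; apply: sinv_map.
Qed.

(** Write h as S(h') with h' = S^-1(h). Then f Delta(S h') f^-1 = (S ⊗ S) Delta^cop(h'), and
    reversing the legs while applying S^-1 to each gives Delta(h'). *)
Lemma comul_sinv h :
  comul (op_quasi_bialgebra Q) (sinv h) = rev2 sinv (twist * D h * inv twist).
Proof.
rewrite -{2}[h](antipode_invK Q) drinfeld_twist_antipode -mulrA.
rewrite (proj1 (invP (drinfeld_twist_invertible Q))) mulr1 prod_antimap_comul.
by rewrite rev2_sinv.
Qed.

Lemma counit_sinv h : counit (op_quasi_bialgebra Q) (sinv h) = eps h.
Proof. by rewrite -[in RHS](antipode_invK Q h) counit_antipode. Qed.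

Lemma reass_sinv : reass (op_quasi_bialgebra Q) = tmap (fun h => sinv (S h))
  (tmap (fun h => sinv (S h)) (fun h => sinv (S h))) (inv Phi).
Proof.
have -> : (fun h => sinv (S h)) = @toop k H by apply: funext => h; apply: sinv_S.
by [].
Qed.

Lemma op_coactE (lam : B -> H ⊗ B) : op_coact Q lam = coact sinv lam.
Proof.
apply: funext => b; exact (@tlift_rev_coact k H B H^c sinv sinv_map (lam b)).
Qed.

Lemma op_coact_reassE (Phil : H ⊗ H ⊗ B) : op_coact_reass Q Phil = rev_reass Q sinv Phil.
Proof. exact (@tlift_rev3 k H B H^c sinv sinv_map twist (inv Phil)). Qed.

End OppositeCoaction.

Theorem lemma3p2 (k : fieldType) (H : pzAlgType k) (Q : quasi_hopf H)
    (B : pzAlgType k) (lam : B -> (H ⊗ B)%type) (Phil : (H ⊗ H ⊗ B)%type)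
    (HB : left_comodule_algebra Q lam Phil) :
  right_comodule_algebra (op_quasi_bialgebra Q)
    (op_coact Q lam) (op_coact_reass Q Phil) /\
  (forall (lam' : B -> (H ⊗ B)%type) (Phil' : (H ⊗ H ⊗ B)%type),
     left_comodule_algebra Q lam' Phil' ->
     left_twist_equivalent Q lam Phil lam' Phil' ->
     right_twist_equivalent (op_quasi_bialgebra Q)
       (op_coact Q lam) (op_coact_reass Q Phil)
       (op_coact Q lam') (op_coact_reass Q Phil')).
Proof.
have sA := sinv_map Q; have cs := comul_sinv Q.
have es := counit_sinv Q; have rs := reass_sinv Q.
split=> [|lam' Phil' _ LT].
  rewrite op_coactE op_coact_reassE; exact: (rev_comodule_algebra sA cs es rs HB).
rewrite !op_coactE !op_coact_reassE; exact: (rev_twist_equivalent sA cs es HB LT).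
Qed.
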